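(* Let $\lambda\in\mathbb{R}$ and let $\overline{M}_\lambda^{2}$ be the $2$-dimensional space form of curvature $\lambda$. Let $P$ be a compact $\kappa_0$-convex polygon in $\overline{M}_\lambda^{2}$, with sides of length less than $\pi/\sqrt{\lambda}$ if $\lambda>0$, and with curvature $\kappa_{A_i}$ at each vertex $A_i$ satisfying $\kappa_{A_i}\ge \kappa_0>\max\{0,-\lambda\}$. Then the circumradius $R$ of $P$ satisfies $$\mathrm{ta}_\lambda(R)\le \frac{\pi}{2\kappa_0},$$ and the equality holds if and only if the polygon degenerates to a $2$-covered segment.
   Context: The $2$-dimensional space form $\overline{M}_\lambda^{2}$ of curvature $\lambda$ is the simply connected $2$-dimensional Riemannian manifold of constant sectional curvature $\lambda$: the Euclidean plane if $\lambda=0$, the sphere of radius $1/\sqrt{\lambda}$ in $\mathbb{R}^3$ if $\lambda>0$, the hyperbolic plane of curvature $\lambda$ if $\lambda<0$. Define $\mathrm{s}_\lambda(t)=\frac{\sin(\sqrt{\lambda}\,t)}{\sqrt{\lambda}}$ if $\lambda>0$, $\mathrm{s}_\lambda(t)=t$ if $\lambda=0$, $\mathrm{s}_\lambda(t)=\frac{\sinh(\sqrt{|\lambda|}\,t)}{\sqrt{|\lambda|}}$ if $\lambda<0$; $\mathrm{c}_\lambda(t)=\cos(\sqrt{\lambda}\,t)$ if $\lambda>0$, $\mathrm{c}_\lambda(t)=1$ if $\lambda=0$, $\mathrm{c}_\lambda(t)=\cosh(\sqrt{|\lambda|}\,t)$ if $\lambda<0$; and $\mathrm{ta}_\lambda(t)=\mathrm{s}_\lambda(t)/\mathrm{c}_\lambda(t)$.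 Curvature at a vertex: let $A$ be a vertex of a convex polygon $P$ in $\overline{M}_\lambda^{2}$ (with sides of length less than $\pi/\sqrt{\lambda}$ if $\lambda>0$), let $\widehat{A}$ be the interior angle of $P$ at $A$, and let $\ell_1,\ell_2$ be the lengths of the two sides of $P$ meeting at $A$. The curvature of $P$ at $A$ is $$\kappa_A=\frac{\pi-\widehat{A}}{\mathrm{ta}_\lambda(\ell_1/2)+\mathrm{ta}_\lambda(\ell_2/2)}.$$ A compact convex polygon $P$ is called $\kappa_0$-convex if $\kappa_A\ge\kappa_0>0$ at every vertex $A$ of $P$. The circumradius of a closed convex curve (in particular of a polygon) in $\overline{M}_\lambda^{2}$ is the minimum value of $R$ such that a disk of radius $R$ in $\overline{M}_\lambda^{2}$ contains the domain bounded by the curve. A $2$-covered segment is a geodesic segment regarded as a degenerate convex polygon with two vertices (its endpoints), two coinciding sides (both equal to the segment), and interior angle $0$ at each vertex.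
   Formalization: Equality is stated to hold iff the polygon is a 2-covered segment whose vertex curvatures equal κ0; as written, ''if'' fails when κ0 is a non-attained lower bound (e.g. Euclidean segment of length 2 with κ0 = 1). *)

(* Defs.v *)
From HB Require Import structures.
From mathcomp Require Import all_boot all_order all_algebra.
From mathcomp Require Import all_classical all_reals all_analysis.

Set Implicit Arguments.
Unset Strict Implicit.
Unset Printing Implicit Defensive.

Import Order.TTheory GRing.Theory Num.Theory.
Import numFieldNormedType.Exports.

Local Open Scope classical_set_scope.
Local Open Scope ring_scope.

Section SpaceForm.
Context {R : realType}.
Implicit Types (l t r k : R) (x y p q u v : 'rV[R]_3) (D : set 'rV[R]_3).

Definition coshR t : R := (expR t + expR (- t)) / 2.
Definition sinhR t : R := (expR t - expR (- t)) / 2.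
Definition arcoshR t : R := ln (t + Num.sqrt (t ^+ 2 - 1)).

Definition s_ l t : R :=
  if 0 < l then sin (Num.sqrt l * t) / Num.sqrt l
  else if l < 0 then sinhR (Num.sqrt `|l| * t) / Num.sqrt `|l|
  else t.

Definition c_ l t : R :=
  if 0 < l then cos (Num.sqrt l * t)
  else if l < 0 then coshR (Num.sqrt `|l| * t)
  else 1.

Definition ta_ l t : R := s_ l t / c_ l t.

(* The Euclidean form of R^3 if l > 0, the Lorentz form if l < 0, and
   dx1^2 + dx2^2 if l = 0. On tangent vectors to [space_form l] it is the
   Riemannian metric. *)
Definition form l u v : R :=
  Num.sg l * (u 0 0 * v 0 0) + u 0 1 * v 0 1 + u 0 2 * v 0 2.

(* The sphere of radius 1 / sqrt l (l > 0), the upper sheet of the hyperboloid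
   x1^2 + x2^2 - x0^2 = 1 / l (l < 0), the affine plane x0 = 1 (l = 0). *)
Definition space_form l : set 'rV[R]_3 :=
  [set x : 'rV[R]_3 | if l == 0 then x 0 0 = 1
           else form l x x = l^-1 /\ (l < 0 -> 0 < x 0 0)].

Definition dist l x y : R :=
  if 0 < l then acos (l * form l x y) / Num.sqrt l
  else if l < 0 then arcoshR (l * form l x y) / Num.sqrt `|l|
  else Num.sqrt (form l (x - y) (x - y)).

(* For a unit tangent vector v at p, the unit speed geodesic issued from p with
   initial velocity v. *)
Definition geodesic l p v t : 'rV[R]_3 := c_ l t *: p + s_ l t *: v.

(* The initial velocity v of the minimal geodesic from p to q, obtained by
   solving [geodesic l p v (dist l p q) = q]. Meaningful for p != q, not
   antipodal if l > 0. *)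
Definition direction l p q : 'rV[R]_3 :=
  (s_ l (dist l p q))^-1 *: (q - c_ l (dist l p q) *: p).

(* Same restriction as for [direction], except that p = q gives [set p]. *)
Definition segment l p q : set 'rV[R]_3 :=
  [set geodesic l p (direction l p q) t | t in [set t | 0 <= t <= dist l p q]].

Definition geod_convex l D : Prop :=
  forall p q, D p -> D q -> (0 < l -> dist l p q < pi / Num.sqrt l) ->
  segment l p q `<=` D.

(* Boundary of D relative to [space_form l], which is closed in R^3 and carries
   the induced topology. *)
Definition boundary l D : set 'rV[R]_3 :=
  closure D `&` closure (space_form l `\` D).

Definition disk l p r : set 'rV[R]_3 :=
  [set x | space_form l x /\ dist l p x <= r].

Definition is_circumradius l D r : Prop :=
  let covering r' := exists2 o, space_form l o & D `<=` disk l o r' in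
  covering r /\ forall r', covering r' -> r <= r'.

Section Polygon.
Variables (n : nat) (A : 'I_n -> 'rV[R]_3).

(* [ordS] and [ord_pred] are the cyclic successor and predecessor. *)
Definition side l (i : 'I_n) : set 'rV[R]_3 := segment l (A i) (A (ordS i)).

Definition side_length l (i : 'I_n) : R := dist l (A i) (A (ordS i)).

(* The vertices are A, in cyclic order, and D is the region bounded by the sides.
   A 2-gon has two coinciding sides; they are not required to be disjoint, and
   the boundary condition forces D to be this segment. *)
Record convex_polygon l D : Prop := ConvexPolygon {
  polygon_size : (2 <= n)%N ;
  polygon_vertices : forall i, space_form l (A i) ;
  polygon_distinct : injective A ;
  polygon_simple : n != 2%N -> forall i j, i != j ->
    side l i `&` side l j `<=` [set A i; A (ordS i)] ;
  polygon_sub : D `<=` space_form l ;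
  polygon_compact : compact D ;
  polygon_convex : geod_convex l D ;
  polygon_boundary : boundary l D = \bigcup_i side l i }.

(* The angle between the two sides at A i, which is the interior angle because
   the region is convex; it is 0 for a 2-gon. *)
Definition interior_angle l (i : 'I_n) : R :=
  acos (form l (direction l (A i) (A (ord_pred i)))
               (direction l (A i) (A (ordS i)))).

Definition vertex_curvature l (i : 'I_n) : R :=
  (pi - interior_angle l i) /
  (ta_ l (side_length l (ord_pred i) / 2) + ta_ l (side_length l i / 2)).

Definition kappa_convex l k D : Prop :=
  [/\ convex_polygon l D, 0 < k & forall i, k <= vertex_curvature l i].

Definition two_covered_segment l D : Prop :=
  n = 2%N /\ forall i, D = side l i.

End Polygon.
End SpaceForm.

(* Main.v *)
Require Import Defs.
From HB Require Import structures.
From mathcomp Require Import all_boot all_order all_algebra.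
From mathcomp Require Import all_classical all_reals all_analysis.
From mathcomp Require Import ring lra zify.

(** Write [r] for the circumradius and [K = c_ l r / s_ l r], the inverse of
    [ta_ l r]. A chord of length [d] of a circle of radius [r] makes with the
    circle the angle [y(d) = asin (K * ta_ l (d / 2))] ([half_chord_angle]), and
    the triangle cut off by the chord and the centre has base angles [pi / 2 - y(d)].

    Suppose that there are at least three vertices and that [K <= 2 * k / pi].
    Since [asin q <= pi / 2 * q] between 0 and 1, the lower bound [k] on the curvature
    says that the exterior angle at each vertex is more than the sum of [y] over
    the two adjacent sides: the polygon turns faster than a polygon inscribed in a
    circle of radius [r] with the same sides. This property is inherited by
    subpolygons. Indeed, in a triangle [p q x] where the exterior angle at [q] is
    at least [y(pq) + y(qx)], one has [y(px) <= y(pq) + angle at p]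
    ([half_chord_triangle]), so that deleting a vertex preserves the comparison at
    its neighbours. Deleting vertices one after the other ([half_chord_chain])
    gives, for vertices [A_i], [A_j], [A_k] with [A_j] and [A_k] distinct from [A_i],
    [y(A_i A_j) + y(A_i A_k) + angle at A_i < pi] ([half_chord_wedge]).

    The smallest disk containing the polygon contradicts this. Its circle passes
    through a vertex [A_i], and through vertices on both sides of the line from
    [A_i] to the centre, since otherwise the centre could be moved so as to shrink
    the disk ([contact_side], [move_center]). If [A_j] and [A_k] are contact
    vertices on the two sides, the angle at [A_i] between them is the sum of the
    base angles [pi / 2 - y(A_i A_j)] and [pi / 2 - y(A_i A_k)], that is, the left
    hand side above equals [pi]; a contact vertex diametrically opposite to [A_i]
    has [y = pi / 2], against the case [j = k] of the inequality
    ([contact_wedge_false]). Hence [2 * k / pi < K], which is the strict inequality.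

    With two vertices the region is the segment between them
    ([convex_boundary_segment]), [r] is half its length, and the curvature at both
    vertices is exactly [pi / (2 * ta_ l r)]: the inequality is immediate, and it is
    an equality when the curvature equals its lower bound.

    All three geometries are treated at once. Everything metric is expressed with
    the squared chord [chord l x y = form l (x - y) (x - y)], equal to
    [4 * s_ l (d / 2) ^+ 2] at distance [d] ([chord_dist]), which is polynomial in
    the coordinates and satisfies [c_ l d = 1 - l * chord / 2] for every [l].
    Everything about position is expressed with the sign of the determinant
    [det3], because lines are the traces of planes through the origin and segments
    are the traces of the cones spanned by two points ([segment_comb],
    [comb_segment]). In these terms a side of the polygon supports the region, for
    otherwise its midpoint would be an interior point
    ([boundary_segment_support]); hence all triples of vertices in cyclic order are
    positively oriented ([polygon_order]), and a disk that contains the vertices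
    contains the region ([polygon_sub_disk]). *)

Set Implicit Arguments.
Unset Strict Implicit.
Unset Printing Implicit Defensive.

Import Order.TTheory GRing.Theory Num.Theory.
Import numFieldNormedType.Exports.

Local Open Scope classical_set_scope.
Local Open Scope ring_scope.

Local Notation form := Defs.form.

(** * The generalized sine and cosine *)

Section GeneralizedTrig.
Context {R : realType}.
Implicit Types (l a b t : R).

Lemma sinhRD a b : sinhR (a + b) = sinhR a * coshR b + coshR a * sinhR b.
Proof. by rewrite /sinhR /coshR opprD !expRD; field. Qed.

Lemma coshRD a b : coshR (a + b) = coshR a * coshR b + sinhR a * sinhR b.
Proof. by rewrite /sinhR /coshR opprD !expRD; field. Qed.

Lemma sqrt_sqr_norm l : Num.sqrt `|l| ^+ 2 = `|l|.
Proof. by rewrite sqr_sqrtr. Qed.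

Lemma s_D l a b : s_ l (a + b) = s_ l a * c_ l b + c_ l a * s_ l b.
Proof.
rewrite /s_ /c_; case: ltrgtP => hl.
- by rewrite mulrDr sinD mulrDl mulrAC mulrA.
- by rewrite mulrDr sinhRD mulrDl mulrAC mulrA.
- by rewrite mulr1 mul1r.
Qed.

Lemma c_D l a b : c_ l (a + b) = c_ l a * c_ l b - l * (s_ l a * s_ l b).
Proof.
rewrite /s_ /c_; case: ltrgtP => hl.
- have hs : Num.sqrt l != 0 by rewrite gt_eqF ?sqrtr_gt0.
  rewrite mulrDr cosD -[in X in _ = _ - X * _](sqr_sqrtr (ltW hl)).
  by congr (_ - _); field.
- have hs : Num.sqrt `|l| != 0 by rewrite gt_eqF ?sqrtr_gt0 ?normr_gt0 ?lt_eqF.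
  have hq : l = - Num.sqrt `|l| ^+ 2 by rewrite sqrt_sqr_norm ltr0_norm ?opprK.
  rewrite mulrDr coshRD [in X in _ = _ - X * _]hq.
  by move: hs; set q := Num.sqrt _ => hs; field.
- by rewrite -hl; ring.
Qed.

Lemma s_0 l : s_ l 0 = 0.
Proof. by rewrite /s_ !mulr0 sin0 /sinhR oppr0 subrr !mul0r !if_same. Qed.

Lemma c_0 l : c_ l 0 = 1.
Proof.
by rewrite /c_ !mulr0 cos0 /coshR oppr0 expR0 -[1 + 1]/(2%:R) divff ?pnatr_eq0 // !if_same.
Qed.

Lemma s_N l t : s_ l (- t) = - s_ l t.
Proof.
rewrite /s_ !mulrN sinN /sinhR opprK.
by case: ifP => _; [rewrite mulNr | case: ifP => _ //; rewrite -!mulNr opprB].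
Qed.

Lemma c_N l t : c_ l (- t) = c_ l t.
Proof. by rewrite /c_ !mulrN cosN /coshR opprK [expR (- _) + _]addrC. Qed.

Lemma c2_s2 l t : c_ l t ^+ 2 + l * s_ l t ^+ 2 = 1.
Proof. by have := c_D l t (- t); rewrite subrr c_0 c_N s_N => ->; ring. Qed.

Lemma s_B l a b : s_ l (a - b) = s_ l a * c_ l b - c_ l a * s_ l b.
Proof. by rewrite s_D c_N s_N mulrN. Qed.

Lemma s_half l t : s_ l t = 2 * s_ l (t / 2) * c_ l (t / 2).
Proof. by rewrite {1}[t]splitr s_D; ring. Qed.

(** With [chord_dist] this is the relation between cosine and chord that holds for every
    sign of [l]. *)
Lemma c_half l t : c_ l t = 1 - 2 * l * s_ l (t / 2) ^+ 2.
Proof. by rewrite {1}[t]splitr c_D; have := c2_s2 l (t / 2); lra. Qed.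

Lemma s_gt0 l t : 0 < t -> (0 < l -> t < pi / Num.sqrt l) -> 0 < s_ l t.
Proof.
move=> t0 ht; rewrite /s_; case: (ltrgtP 0 l) => hl //.
- have sl : 0 < Num.sqrt l by rewrite sqrtr_gt0.
  rewrite divr_gt0 // sin_gt0_pi // mulr_gt0 //=.
  by rewrite mulrC -ltr_pdivlMr // ht.
- have sl : 0 < Num.sqrt `|l| by rewrite sqrtr_gt0 normr_gt0 lt_eqF.
  rewrite divr_gt0 // /sinhR divr_gt0 // subr_gt0 ltr_expR.
  have : 0 < Num.sqrt `|l| * t by rewrite mulr_gt0.
  lra.
Qed.

Lemma c_gt0 l t : 0 <= t -> (0 < l -> t < pi / Num.sqrt l / 2) -> 0 < c_ l t.
Proof.
move=> t0 ht; rewrite /c_; case: (ltrgtP 0 l) => hl //.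
- have sl : 0 < Num.sqrt l by rewrite sqrtr_gt0.
  apply: cos_gt0_pihalf; apply/andP; split.
    by rewrite (@lt_le_trans _ _ 0) ?mulr_ge0 ?(ltW sl) // oppr_lt0 divr_gt0 ?pi_gt0.
  by rewrite mulrC -ltr_pdivlMr // mulrAC ht.
- by rewrite /coshR divr_gt0 // addr_gt0 ?expR_gt0.
Qed.

Lemma c_ge0 l t : 0 <= t -> (0 < l -> t <= pi / Num.sqrt l / 2) -> 0 <= c_ l t.
Proof.
move=> t0 ht; rewrite /c_; case: (ltrgtP 0 l) => hl //.
- have sl : 0 < Num.sqrt l by rewrite sqrtr_gt0.
  apply: cos_ge0_pihalf; apply/andP; split.
    by rewrite (@le_trans _ _ 0) ?mulr_ge0 ?(ltW sl) // oppr_le0 ltW // divr_gt0 ?pi_gt0.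
  by rewrite mulrC -ler_pdivlMr // mulrAC ht.
- by rewrite /coshR divr_ge0 // addr_ge0 ?expR_ge0.
Qed.

Lemma s_lt_mono l a b : 0 <= a -> a < b -> (0 < l -> b <= pi / Num.sqrt l / 2) ->
  s_ l a < s_ l b.
Proof.
move=> a0 ab hb.
have -> : s_ l b = s_ l ((b + a) / 2 + (b - a) / 2) by congr s_; field.
have -> : s_ l a = s_ l ((b + a) / 2 - (b - a) / 2) by congr s_; field.
have h1 : 0 < s_ l ((b - a) / 2).
  apply: s_gt0 => [|hl]; first by lra.
  by have := hb hl; lra.
have h2 : 0 < c_ l ((b + a) / 2).
  apply: c_gt0 => [|hl]; first by lra.
  by have := hb hl; lra.
by rewrite s_B s_D; have := mulr_gt0 h2 h1; lra.
Qed.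

Lemma continuous_s l : continuous (s_ l).
Proof.
rewrite /s_; case: ltrgtP => hl t; last exact: cvg_id.
- apply: cvgMl; apply: (@continuous_comp _ _ _ ( *%R (Num.sqrt l)) sin).
    exact: mulrl_continuous.
  exact: continuous_sin.
- apply: cvgMl; apply: cvgMl; apply: cvgB.
    apply: (@continuous_comp _ _ _ ( *%R (Num.sqrt `|l|)) expR).
      exact: mulrl_continuous.
    exact: continuous_expR.
  apply: (@continuous_comp _ _ _ (fun t => - (Num.sqrt `|l| * t)) expR).
    by apply: cvgN; exact: mulrl_continuous.
  exact: continuous_expR.
Qed.

Lemma continuous_c l : continuous (c_ l).
Proof.
rewrite /c_; case: ltrgtP => hl t; last exact: cvg_cst.
- apply: (@continuous_comp _ _ _ ( *%R (Num.sqrt l)) cos).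
    exact: mulrl_continuous.
  exact: continuous_cos.
- apply: cvgMl; apply: cvgD.
    apply: (@continuous_comp _ _ _ ( *%R (Num.sqrt `|l|)) expR).
      exact: mulrl_continuous.
    exact: continuous_expR.
  apply: (@continuous_comp _ _ _ (fun t => - (Num.sqrt `|l| * t)) expR).
    by apply: cvgN; exact: mulrl_continuous.
  exact: continuous_expR.
Qed.

End GeneralizedTrig.

(** * Chords and distances *)

Section SpaceForm.
Context {R : realType}.
Implicit Types (l a b t : R) (x y z p q u v w : 'rV[R]_3).

Lemma row3_eq x y :
  x 0 0 = y 0 0 -> x 0 1 = y 0 1 -> x 0 2 = y 0 2 -> x = y.
Proof.
move=> h0 h1 h2; apply/rowP => -[[|[|[|//]]] hi].
- by rewrite (_ : Ordinal hi = 0) //; apply: val_inj.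
- by rewrite (_ : Ordinal hi = 1) //; apply: val_inj.
- by rewrite (_ : Ordinal hi = 2) //; apply: val_inj.
Qed.

(** The squared length of the chord in the ambient space. Unlike [dist] it is polynomial in
    the coordinates for every [l]. *)
Definition chord l x y : R := form l (x - y) (x - y).

Definition det3 p q x : R :=
  p 0 0 * (q 0 1 * x 0 2 - q 0 2 * x 0 1) -
  p 0 1 * (q 0 0 * x 0 2 - q 0 2 * x 0 0) +
  p 0 2 * (q 0 0 * x 0 1 - q 0 1 * x 0 0).

Lemma formC l x y : form l x y = form l y x.
Proof. by rewrite /form; ring. Qed.

Lemma formDZ l a b x y z : form l (a *: x + b *: y) z = a * form l x z + b * form l y z.
Proof. by rewrite /form !mxE; ring. Qed.

Lemma formZ l a x y : form l (a *: x) y = a * form l x y.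
Proof. by rewrite /form !mxE; ring. Qed.

Lemma chordC l x y : chord l x y = chord l y x.
Proof. by rewrite /chord /form !mxE; ring. Qed.

Lemma chordxx l x : chord l x x = 0.
Proof. by rewrite /chord /form !mxE; ring. Qed.

Lemma chordE l x y : chord l x y = form l x x + form l y y - 2 * form l x y.
Proof. by rewrite /chord /form !mxE; ring. Qed.

Lemma space_form0 x : space_form 0 x -> x 0 0 = 1.
Proof. by rewrite /space_form /= eqxx. Qed.

Lemma space_form_form l x : l != 0 -> space_form l x -> form l x x = l^-1.
Proof. by rewrite /space_form /= => /negbTE -> []. Qed.

Lemma space_form_neg l x : l < 0 -> space_form l x -> 0 < x 0 0.
Proof. by move=> hl; rewrite /space_form /= lt_eqF // => -[_]; apply. Qed.

Lemma form_chord l x y : l != 0 -> space_form l x -> space_form l y ->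
  form l x y = l^-1 - chord l x y / 2.
Proof. by move=> l0 hx hy; rewrite chordE !space_form_form //; field. Qed.

(** The sum of two points of the upper sheet is again a timelike vector. This is what makes
    differences of points, which are orthogonal to it, spacelike. *)
Lemma hyperboloid_sum l x y : l < 0 -> space_form l x -> space_form l y ->
  (x 0 1 + y 0 1) ^+ 2 + (x 0 2 + y 0 2) ^+ 2 < (x 0 0 + y 0 0) ^+ 2.
Proof.
move=> hl hx hy; have l0 : l != 0 by rewrite lt_eqF.
have := space_form_form l0 hx; have := space_form_form l0 hy.
have := space_form_neg hl hx; have := space_form_neg hl hy.
rewrite /form ltr0_sg //.
set x0 := x 0 0; set x1 := x 0 1; set x2 := x 0 2.
set y0 := y 0 0; set y1 := y 0 1; set y2 := y 0 2 => y_gt0 x_gt0 ey ex.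
have m0 : l^-1 < 0 by rewrite invr_lt0.
suff : x1 * y1 + x2 * y2 < x0 * y0 by nra.
have [h|h] := ltP (x1 * y1 + x2 * y2) 0.
  by apply: (lt_trans h); rewrite mulr_gt0.
rewrite -(@ltr_pXn2r _ 2) ?nnegrE //; last by rewrite mulr_ge0 ?ltW.
have -> : (x0 * y0) ^+ 2 = (x1 ^+ 2 + x2 ^+ 2 - l^-1) * (y1 ^+ 2 + y2 ^+ 2 - l^-1).
  by rewrite -{1}ex -ey; ring.
have : 0 <= (x1 * y2 - x2 * y1) ^+ 2 by apply: sqr_ge0.
have : 0 < l^-1 ^+ 2 by rewrite exprn_even_gt0 //= lt_eqF.
have := mulr_ge0_le0 (addr_ge0 (addr_ge0 (sqr_ge0 x1) (sqr_ge0 x2))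
  (addr_ge0 (sqr_ge0 y1) (sqr_ge0 y2))) (ltW m0).
nra.
Qed.

(** For [l < 0] the difference [x - y] is orthogonal to the timelike vector [x + y]. *)
Lemma chord_ge0 l x y : space_form l x -> space_form l y -> 0 <= chord l x y.
Proof.
move=> hx hy; have [hl|hl|hl] := ltrgtP 0 l.
- by rewrite /chord /form gtr0_sg // mul1r -!expr2 !addr_ge0 ?sqr_ge0.
- have h := hyperboloid_sum hl hx hy; have l0 : l != 0 by rewrite lt_eqF.
  have ex := space_form_form l0 hx; have ey := space_form_form l0 hy.
  have hx0 := space_form_neg hl hx; have hy0 := space_form_neg hl hy.
  have hp : 0 < (x 0 0 + y 0 0) ^+ 2 by rewrite exprn_gt0 ?addr_gt0.
  rewrite -(pmulr_rge0 _ hp).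
  move: h ex ey hp; rewrite /chord /form ltr0_sg // !mxE.
  set x0 := x 0 0; set x1 := x 0 1; set x2 := x 0 2.
  set y0 := y 0 0; set y1 := y 0 1; set y2 := y 0 2 => h ex ey hp.
  have e : (x0 - y0) * (x0 + y0) = (x1 - y1) * (x1 + y1) + (x2 - y2) * (x2 + y2).
    have -> : (x0 - y0) * (x0 + y0) = x0 * x0 - y0 * y0 by ring.
    by lra.
  have h2 : 0 <= ((x1 - y1) ^+ 2 + (x2 - y2) ^+ 2) * ((x0 + y0) ^+ 2 - ((x1 + y1) ^+ 2 + (x2 + y2) ^+ 2)).
    by apply: mulr_ge0; [rewrite addr_ge0 ?sqr_ge0 | rewrite subr_ge0 ltW].
  have h3 := sqr_ge0 ((x1 - y1) * (x2 + y2) - (x2 - y2) * (x1 + y1)).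
  have -> : (x0 + y0) ^+ 2 * (-1 * ((x0 + - y0) * (x0 + - y0)) +
      (x1 + - y1) * (x1 + - y1) + (x2 + - y2) * (x2 + - y2))
    = ((x1 - y1) ^+ 2 + (x2 - y2) ^+ 2) * (x0 + y0) ^+ 2 - ((x0 - y0) * (x0 + y0)) ^+ 2 by ring.
  by rewrite e; nra.
- rewrite -hl /chord /form sgr0 mul0r add0r -!expr2.
  by rewrite addr_ge0 ?sqr_ge0.
Qed.

Lemma chord_eq0 l x y : space_form l x -> space_form l y -> chord l x y = 0 -> x = y.
Proof.
move=> hx hy; have [hl|hl|hl] := ltrgtP 0 l.
- rewrite /chord /form gtr0_sg // mul1r -!expr2 => /eqP.
  rewrite !paddr_eq0 ?addr_ge0 ?sqr_ge0 // !sqrf_eq0 => /andP[/andP[/eqP h0 /eqP h1] /eqP h2].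
  by move: h0 h1 h2; rewrite !mxE => /subr0_eq ? /subr0_eq ? /subr0_eq ?; apply: row3_eq.
- have h := hyperboloid_sum hl hx hy; have l0 : l != 0 by rewrite lt_eqF.
  have ex := space_form_form l0 hx; have ey := space_form_form l0 hy.
  have hx0 := space_form_neg hl hx; have hy0 := space_form_neg hl hy.
  have hp : 0 < x 0 0 + y 0 0 by rewrite addr_gt0.
  move=> hc.
  suff [h1 h2] : x 0 1 - y 0 1 = 0 /\ x 0 2 - y 0 2 = 0.
    apply: row3_eq; [|by apply: subr0_eq..].
    move/subr0_eq: h1 => h1; move/subr0_eq: h2 => h2.
    have : (x 0 0 - y 0 0) * (x 0 0 + y 0 0) = 0.
      by move: ex ey; rewrite /form ltr0_sg // h1 h2; lra.
    by move/eqP; rewrite mulf_eq0 (gt_eqF hp) orbF subr_eq0 => /eqP.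
  move: h ex ey hp hc; rewrite /chord /form ltr0_sg // !mxE.
  set x0 := x 0 0; set x1 := x 0 1; set x2 := x 0 2.
  set y0 := y 0 0; set y1 := y 0 1; set y2 := y 0 2 => h ex ey hp hc.
  have e : (x0 - y0) * (x0 + y0) = (x1 - y1) * (x1 + y1) + (x2 - y2) * (x2 + y2).
    have -> : (x0 - y0) * (x0 + y0) = x0 * x0 - y0 * y0 by ring.
    by lra.
  have h3 := sqr_ge0 ((x1 - y1) * (x2 + y2) - (x2 - y2) * (x1 + y1)).
  have e2 : (x0 - y0) ^+ 2 = (x1 - y1) ^+ 2 + (x2 - y2) ^+ 2 by lra.
  have e3 : ((x1 - y1) ^+ 2 + (x2 - y2) ^+ 2) * ((x0 + y0) ^+ 2 - ((x1 + y1) ^+ 2 + (x2 + y2) ^+ 2)) <= 0.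
    have : ((x0 - y0) * (x0 + y0)) ^+ 2 = ((x1 - y1) * (x1 + y1) + (x2 - y2) * (x2 + y2)) ^+ 2 by rewrite e.
    by rewrite exprMn e2; nra.
  have : (x1 - y1) ^+ 2 + (x2 - y2) ^+ 2 <= 0.
    rewrite -(@pmulr_lle0 _ ((x0 + y0) ^+ 2 - ((x1 + y1) ^+ 2 + (x2 + y2) ^+ 2))) //.
    by rewrite subr_gt0.
  move=> h4; have h5 := sqr_ge0 (x1 - y1); have h6 := sqr_ge0 (x2 - y2).
  by split; apply/eqP; rewrite -sqrf_eq0; apply/eqP; lra.
- move: hx hy; rewrite -hl => /space_form0 hx /space_form0 hy.
  rewrite /chord /form sgr0 mul0r add0r -!expr2 => /eqP.
  rewrite !paddr_eq0 ?addr_ge0 ?sqr_ge0 // !sqrf_eq0 => /andP[/eqP h1 /eqP h2].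
  move: h1 h2; rewrite !mxE => /subr0_eq ? /subr0_eq ?; apply: row3_eq => //.
  by rewrite hx.
Qed.

Lemma coshR_arcosh t : 1 <= t -> coshR (arcoshR t) = t.
Proof.
move=> t1; rewrite /coshR /arcoshR.
have ht : 0 <= t ^+ 2 - 1 by rewrite subr_ge0 expr_ge1 ?(le_trans _ t1).
have hq := sqr_sqrtr ht; have q0 := sqrtr_ge0 (t ^+ 2 - 1).
move: hq q0; set q := Num.sqrt _ => hq q0.
have hp : 0 < t + q by lra.
rewrite expRN !lnK ?posrE //.
have -> : (t + q)^-1 = t - q.
  apply: (mulfI (lt0r_neq0 hp)); rewrite divff ?lt0r_neq0 //.
  have -> : (t + q) * (t - q) = t ^+ 2 - q ^+ 2 by ring.
  by rewrite hq; ring.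
by field.
Qed.

Lemma arcosh_ge0 t : 1 <= t -> 0 <= arcoshR t.
Proof.
move=> t1; rewrite /arcoshR ln_ge0 //.
by have := sqrtr_ge0 (t ^+ 2 - 1); lra.
Qed.

Lemma lform_bound l x y : 0 < l -> space_form l x -> space_form l y ->
  -1 <= l * form l x y <= 1.
Proof.
move=> hl hx hy; have l0 : l != 0 by rewrite gt_eqF.
have hc := chord_ge0 hx hy.
rewrite form_chord //.
have h : 0 <= form l (x + y) (x + y).
  by rewrite /form gtr0_sg // mul1r -!expr2 !addr_ge0 ?sqr_ge0.
have e : form l (x + y) (x + y) = form l x x + form l y y + 2 * form l x y.
  by rewrite /form !mxE; ring.
move: h; rewrite e !space_form_form // form_chord // => h.
have hl1 : l * l^-1 = 1 by rewrite divff.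
have := mulr_ge0 (ltW hl) h; have := mulr_ge0 (ltW hl) hc.
move: hl1; set m := l^-1 => hl1.
by move=> *; apply/andP; split; lra.
Qed.

Lemma lform_ge1 l x y : l < 0 -> space_form l x -> space_form l y -> 1 <= l * form l x y.
Proof.
move=> hl hx hy; have l0 : l != 0 by rewrite lt_eqF.
rewrite form_chord // mulrBr divff // lerDl oppr_ge0 mulr_le0_ge0 ?(ltW hl) //.
by rewrite divr_ge0 // chord_ge0.
Qed.

Lemma dist_ge0 l x y : space_form l x -> space_form l y -> 0 <= dist l x y.
Proof.
move=> hx hy; rewrite /dist; case: (ltrgtP 0 l) => hl.
- by rewrite divr_ge0 // acos_ge0 ?lform_bound.
- by rewrite divr_ge0 // arcosh_ge0 ?lform_ge1.
- by [].
Qed.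

Lemma dist_le_pi l x y : space_form l x -> space_form l y -> 0 < l ->
  dist l x y <= pi / Num.sqrt l.
Proof.
by move=> hx hy hl; rewrite /dist hl ler_pM2r ?invr_gt0 ?sqrtr_gt0 // acos_lepi ?lform_bound.
Qed.

Lemma c_dist l x y : space_form l x -> space_form l y ->
  c_ l (dist l x y) = 1 - l * chord l x y / 2.
Proof.
move=> hx hy; have [hl|hl|hl] := ltrgtP 0 l.
- rewrite /c_ /dist hl mulrC divfK ?gt_eqF ?sqrtr_gt0 // acosK.
    by rewrite form_chord ?gt_eqF //; field; rewrite gt_eqF.
  by rewrite in_itv /=; exact: lform_bound.
- have q0 : Num.sqrt `|l| != 0 by rewrite gt_eqF ?sqrtr_gt0 ?normr_gt0 ?lt_eqF.
  rewrite /c_ /dist hl [0 < l]ltNge (ltW hl) /= mulrC divfK // coshR_arcosh ?lform_ge1 //.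
  by rewrite form_chord ?lt_eqF //; field; rewrite lt_eqF.
- by rewrite /c_ -hl ltxx !mul0r subr0.
Qed.

(** For [l != 0] this is the half angle formula applied to [c_dist]; for [l = 0] it is the
    definition of [dist]. *)
Lemma chord_dist l x y : space_form l x -> space_form l y ->
  chord l x y = 4 * s_ l (dist l x y / 2) ^+ 2.
Proof.
move=> hx hy; have [l0|l0] := eqVneq l 0.
  have h := chord_ge0 hx hy; rewrite l0 in h *.
  by rewrite /s_ /dist ltxx -/(chord 0 x y) expr_div_n sqr_sqrtr //; field.
have := c_dist hx hy; rewrite c_half => h.
by apply: (mulfI l0); lra.
Qed.

Lemma chord_lt_mono l a b : 0 <= a -> a < b -> (0 < l -> b <= pi / Num.sqrt l) ->
  4 * s_ l (a / 2) ^+ 2 < 4 * s_ l (b / 2) ^+ 2.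
Proof.
move=> a0 ab hb.
have h : s_ l (a / 2) < s_ l (b / 2).
  by apply: s_lt_mono => [||hl]; [lra|lra|have := hb hl; lra].
have h0 : 0 <= s_ l (a / 2).
  have [<-|a1] := eqVneq 0 a; first by rewrite mul0r s_0.
  apply/ltW/s_gt0 => [|hl]; first by rewrite divr_gt0 // lt_neqAle a1.
  by have := hb hl; lra.
by rewrite ltr_pM2l // ltr_pXn2r ?nnegrE // (le_trans h0) // ltW.
Qed.

(** Comparing distances is comparing chords, which turns metric conditions into polynomial
    ones. The upper bound on [t] is where the chord stops being increasing. *)
Lemma dist_lt l x y t : space_form l x -> space_form l y -> 0 <= t ->
  (0 < l -> t <= pi / Num.sqrt l) ->
  (dist l x y < t) = (chord l x y < 4 * s_ l (t / 2) ^+ 2).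
Proof.
move=> hx hy t0 ht; rewrite chord_dist //; apply/idP/idP => [h|].
  by apply: chord_lt_mono; rewrite ?dist_ge0.
apply: contraTT; rewrite -!leNgt le_eqVlt => /orP[/eqP ->//|h].
by apply/ltW/chord_lt_mono => // hl; apply: dist_le_pi.
Qed.

Lemma dist_le l x y t : space_form l x -> space_form l y -> 0 <= t ->
  (0 < l -> t <= pi / Num.sqrt l) ->
  (dist l x y <= t) = (chord l x y <= 4 * s_ l (t / 2) ^+ 2).
Proof.
move=> hx hy t0 ht; rewrite chord_dist //; apply/idP/idP => [|].
  rewrite le_eqVlt => /orP[/eqP <-//|h].
  by apply/ltW/chord_lt_mono; rewrite ?dist_ge0.
apply: contraTT; rewrite -!ltNge => h.
by apply/chord_lt_mono => // hl; apply: dist_le_pi.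
Qed.

Lemma dist_eq l x y t : space_form l x -> space_form l y -> 0 <= t ->
  (0 < l -> t <= pi / Num.sqrt l) ->
  chord l x y = 4 * s_ l (t / 2) ^+ 2 -> dist l x y = t.
Proof.
move=> hx hy t0 ht h; apply/eqP; rewrite eq_le dist_le // h lexx /=.
by rewrite leNgt dist_lt // h ltxx.
Qed.

Lemma distC l x y : dist l x y = dist l y x.
Proof. by rewrite /dist formC -/(chord l x y) chordC. Qed.

Lemma dist_gt0 l x y : space_form l x -> space_form l y -> x != y -> 0 < dist l x y.
Proof.
move=> hx hy; apply: contraNT; rewrite -leNgt => h.
have e : dist l x y = 0 by apply/le_anti; rewrite h dist_ge0.
apply/eqP/(chord_eq0 hx hy).
by rewrite chord_dist // e mul0r s_0 expr0n mulr0.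
Qed.

End SpaceForm.

(** * The tangent plane at a point *)

Ltac gen_coords p := move: (p 0 0) (p 0 1) (p 0 2) => ? ? ?.

(** The component of [q] tangent to the surface at [p]: it is [s_ l (dist l p q)] times
    [direction l p q], but it stays meaningful, and equal to 0, at [q = p]. *)
HB.lock Definition radial {R : realType} (l : R) (p q : 'rV[R]_3) : 'rV[R]_3 :=
  q - c_ l (dist l p q) *: p.

Section Tangent.
Context {R : realType}.
Implicit Types (l a b t : R) (x y z p q u v w : 'rV[R]_3).

Definition tangent l p u : Prop := if l == 0 then u 0 0 = 0 else form l p u = 0.

(** The normalization of the ambient volume that makes [orient] the area form of the tangent
    plane. The points of the surface have form [l^-1], hence the square root; for [l = 0]
    the surface is at height 1. *)
Definition area_scale l : R := if l == 0 then 1 else Num.sqrt `|l|.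

(** The oriented area of the parallelogram spanned by two tangent vectors; for unit vectors
    it is the sine of the oriented angle. *)
Definition orient l p u v : R := area_scale l * det3 p u v.

Lemma tangentDZ l p a b u v : tangent l p u -> tangent l p v -> tangent l p (a *: u + b *: v).
Proof.
rewrite /tangent; case: eqP => l0 hu hv.
  by rewrite !mxE hu hv !mulr0 addr0.
by rewrite formC formDZ ![form l _ p]formC hu hv !mulr0 addr0.
Qed.

Lemma tangentZ l p a u : tangent l p u -> tangent l p (a *: u).
Proof. by move=> hu; have := tangentDZ a 0 hu hu; rewrite scale0r addr0. Qed.

Lemma tangent_radial l p q : space_form l p -> space_form l q -> tangent l p (radial l p q).
Proof.
move=> hp hq; rewrite /tangent radial.unlock; case: eqP => l0.
  rewrite c_dist // l0 !mul0r subr0 scale1r.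
  by move: hp hq; rewrite l0 => /space_form0 hp /space_form0 hq; rewrite !mxE hp hq subrr.
move/eqP: l0 => l0.
have -> : form l p (q - c_ l (dist l p q) *: p) = form l p q - c_ l (dist l p q) * form l p p.
  by rewrite /form !mxE; ring.
by rewrite c_dist // form_chord // space_form_form //; field.
Qed.

(** The law of cosines in terms of chords: the right hand side is the same polynomial for
    the three geometries. *)
Lemma form_radial l p q x : space_form l p -> space_form l q -> space_form l x ->
  form l (radial l p q) (radial l p x) =
  (chord l p q + chord l p x - chord l q x) / 2 - l * (chord l p q * chord l p x) / 4.
Proof.
move=> hp hq hx; rewrite radial.unlock !c_dist //; have [l0|l0] := eqVneq l 0.
  move: hp hq hx; rewrite l0 => /space_form0 hp /space_form0 hq /space_form0 hx.
  by rewrite /chord /form sgr0 !mxE; field.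
set a := 1 - _; set b := 1 - _.
have -> : form l (q - a *: p) (x - b *: p) =
    form l q x - a * form l p x - b * form l p q + a * b * form l p p.
  by rewrite /form !mxE; ring.
rewrite (space_form_form l0 hp) !form_chord // /a /b.
move: (chord l p q) (chord l p x) (chord l q x) => ? ? ?.
by field.
Qed.

Lemma form_radial_radial l p q : space_form l p -> space_form l q ->
  form l (radial l p q) (radial l p q) = s_ l (dist l p q) ^+ 2.
Proof.
move=> hp hq; rewrite form_radial // chordxx chord_dist // [s_ l (dist l p q)]s_half.
have := c2_s2 l (dist l p q / 2).
move: (s_ _ _) (c_ _ _) => s c h.
have -> : (2 * s * c) ^+ 2 = 4 * s ^+ 2 * c ^+ 2 by ring.
have -> : c ^+ 2 = 1 - l * s ^+ 2 by rewrite -h; ring.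
by field.
Qed.

(** Adding multiples of [p] to the other vectors does not change the determinant, so that
    the orientation of a triangle is read off its vertices. *)
Lemma det3_radial l p q x : det3 p (radial l p q) (radial l p x) = det3 p q x.
Proof.
rewrite radial.unlock; move: (c_ _ _) (c_ _ _) => a b; rewrite /det3 !mxE.
by gen_coords p; gen_coords q; gen_coords x; ring.
Qed.

(** The Binet-Cauchy identity in the tangent plane. For [l != 0] it comes from the Gram
    determinants of the ambient form, whose factor [form l p p = l^-1] is absorbed by
    [area_scale]. *)
Lemma gram l p u v w z : space_form l p ->
  tangent l p u -> tangent l p v -> tangent l p w -> tangent l p z ->
  orient l p u v * orient l p w z = form l u w * form l v z - form l u z * form l v w.
Proof.
rewrite /orient /area_scale /tangent => hp; case: eqVneq => [l0|l0] hu hv hw hz.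
  move: hp; rewrite l0 => /space_form0 hp.
  by rewrite /det3 /form hp hu hv hw hz sgr0; ring.
set q := Num.sqrt _.
have hsg : Num.sg l * Num.sg l = 1 by rewrite -expr2 sqr_sg l0.
have hq : q ^+ 2 = l * Num.sg l by rewrite sqrt_sqr_norm normrEsg mulrC.
have e : det3 p u v * det3 p w z = Num.sg l *
   (form l p p * (form l u w * form l v z - form l u z * form l v w)
   - form l p w * (form l u p * form l v z - form l u z * form l v p)
   + form l p z * (form l u p * form l v w - form l u w * form l v p)).
  transitivity (Num.sg l * Num.sg l * (det3 p u v * det3 p w z)); first by rewrite hsg mul1r.
  rewrite /det3 /form; gen_coords p; gen_coords u; gen_coords v; gen_coords w; gen_coords z.
  by ring.
have -> : q * det3 p u v * (q * det3 p w z) = q ^+ 2 * (det3 p u v * det3 p w z) by ring.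
rewrite e hw hz !mul0r space_form_form // hq subr0 addr0.
set g := _ - _; transitivity (l * l^-1 * (Num.sg l * Num.sg l) * g); first by ring.
by rewrite hsg divff // !mul1r.
Qed.

(** The tangent space is two-dimensional: it is the orthogonal of [p], or the plane where
    the first coordinate is 0. *)
Lemma tangent_coplanar l p u v w : space_form l p ->
  tangent l p u -> tangent l p v -> tangent l p w -> det3 u v w = 0.
Proof.
rewrite /tangent => hp; case: eqVneq => [l0|l0] hu hv hw.
  by rewrite /det3 hu hv hw; ring.
have h0 : Num.sg l * p 0 0 * det3 u v w = 0.
  transitivity (form l p u * (v 0 1 * w 0 2 - v 0 2 * w 0 1)
    - form l p v * (u 0 1 * w 0 2 - u 0 2 * w 0 1) + form l p w * (u 0 1 * v 0 2 - u 0 2 * v 0 1)).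
    by rewrite /det3 /form; gen_coords p; gen_coords u; gen_coords v; gen_coords w; ring.
  by rewrite hu hv hw; ring.
have h1 : p 0 1 * det3 u v w = 0.
  transitivity (- form l p u * (v 0 0 * w 0 2 - v 0 2 * w 0 0)
    + form l p v * (u 0 0 * w 0 2 - u 0 2 * w 0 0) - form l p w * (u 0 0 * v 0 2 - u 0 2 * v 0 0)).
    by rewrite /det3 /form; gen_coords p; gen_coords u; gen_coords v; gen_coords w; ring.
  by rewrite hu hv hw; ring.
have h2 : p 0 2 * det3 u v w = 0.
  transitivity (form l p u * (v 0 0 * w 0 1 - v 0 1 * w 0 0)
    - form l p v * (u 0 0 * w 0 1 - u 0 1 * w 0 0) + form l p w * (u 0 0 * v 0 1 - u 0 1 * v 0 0)).
    by rewrite /det3 /form; gen_coords p; gen_coords u; gen_coords v; gen_coords w; ring.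
  by rewrite hu hv hw; ring.
have : l^-1 * det3 u v w = 0.
  rewrite -(space_form_form l0 hp) /form.
  transitivity (Num.sg l * p 0 0 * det3 u v w * p 0 0 + p 0 1 * det3 u v w * p 0 1
    + p 0 2 * det3 u v w * p 0 2); first by ring.
  by rewrite h0 h1 h2; ring.
by move/eqP; rewrite mulf_eq0 invr_eq0 (negbTE l0) /= => /eqP.
Qed.

Lemma orient_radial l p q x : orient l p (radial l p q) (radial l p x) = area_scale l * det3 p q x.
Proof. by rewrite /orient det3_radial. Qed.

Lemma area_scale_gt0 l : 0 < area_scale l.
Proof. by rewrite /area_scale; case: eqVneq => // l0; rewrite sqrtr_gt0 normr_gt0. Qed.

Definition unit_tangent l p u := tangent l p u /\ form l u u = 1.

Lemma cos2Dorient2 l p u v : space_form l p -> unit_tangent l p u -> unit_tangent l p v ->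
  form l u v ^+ 2 + orient l p u v ^+ 2 = 1.
Proof.
move=> hp [tu eu] [tv ev].
by rewrite [orient _ _ _ _ ^+ 2]expr2 gram // eu ev [form l v u]formC; ring.
Qed.

(** The addition formula for the cosine of oriented angles is the Binet-Cauchy identity with
    a repeated unit vector. *)
Lemma cos_tangentD l p u v w : space_form l p ->
  unit_tangent l p u -> unit_tangent l p v -> unit_tangent l p w ->
  form l u w = form l u v * form l v w - orient l p u v * orient l p v w.
Proof. by move=> hp [tu eu] [tv ev] [tw ew]; rewrite gram // ev; ring. Qed.

Lemma sin_tangentD l p u v w : space_form l p ->
  unit_tangent l p u -> unit_tangent l p v -> unit_tangent l p w ->
  orient l p u w = orient l p u v * form l v w + form l u v * orient l p v w.
Proof.
move=> hp [tu eu] [tv ev] [tw ew]; rewrite /orient.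
suff : det3 p u w * form l v v = det3 p u v * form l v w + form l u v * det3 p v w.
  by rewrite ev mulr1 => ->; ring.
have h := tangent_coplanar hp tu tv tw.
have e y : det3 p u w * form l v y =
    det3 p u v * form l w y + det3 p v w * form l u y - det3 u v w * form l p y.
  by rewrite /det3 /form; gen_coords p; gen_coords u; gen_coords v; gen_coords w; gen_coords y; ring.
by rewrite e h [form l w v]formC; ring.
Qed.

Definition angle l u v : R := acos (form l u v).

Lemma unit_form_bound l p u v : space_form l p -> unit_tangent l p u -> unit_tangent l p v ->
  -1 <= form l u v <= 1.
Proof.
move=> hp hu hv; rewrite -ler_norml -(@ler_pXn2r _ 2) ?nnegrE //.
rewrite expr1n -normrX ger0_norm ?sqr_ge0 // -(cos2Dorient2 hp hu hv).
by rewrite lerDl sqr_ge0.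
Qed.

Lemma cos_angle l p u v : space_form l p -> unit_tangent l p u -> unit_tangent l p v ->
  cos (angle l u v) = form l u v.
Proof. by move=> hp hu hv; rewrite acosK // in_itv /= (unit_form_bound hp). Qed.

Lemma angle_ge0 l p u v : space_form l p -> unit_tangent l p u -> unit_tangent l p v ->
  0 <= angle l u v.
Proof. by move=> hp hu hv; rewrite acos_ge0 // (unit_form_bound hp). Qed.

Lemma angle_lepi l p u v : space_form l p -> unit_tangent l p u -> unit_tangent l p v ->
  angle l u v <= pi.
Proof. by move=> hp hu hv; rewrite acos_lepi // (unit_form_bound hp). Qed.

Lemma sin_angleD l p u v w : space_form l p ->
  unit_tangent l p u -> unit_tangent l p v -> unit_tangent l p w ->
  orient l p u w = orient l p u v * cos (angle l v w) + cos (angle l u v) * orient l p v w.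
Proof.
by move=> hp hu hv hw; rewrite (cos_angle hp hu hv) (cos_angle hp hv hw) (sin_tangentD hp hu hv hw).
Qed.

Lemma cos_angleD l p u v w : space_form l p ->
  unit_tangent l p u -> unit_tangent l p v -> unit_tangent l p w ->
  cos (angle l u w) = cos (angle l u v) * cos (angle l v w) - orient l p u v * orient l p v w.
Proof.
move=> hp hu hv hw.
rewrite (cos_angle hp hu hv) (cos_angle hp hv hw) (cos_angle hp hu hw).
exact: cos_tangentD.
Qed.

Lemma angleC l u v : angle l u v = angle l v u.
Proof. by rewrite /angle formC. Qed.

Lemma directionE l p q : direction l p q = (s_ l (dist l p q))^-1 *: radial l p q.
Proof. by rewrite radial.unlock. Qed.

Lemma unit_direction l p q : space_form l p -> space_form l q -> 0 < s_ l (dist l p q) ->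
  unit_tangent l p (direction l p q).
Proof.
move=> hp hq hs; rewrite directionE; split; first exact/tangentZ/tangent_radial.
rewrite formZ formC formZ form_radial_radial // mulrA -invfM -expr2 mulVf //.
by rewrite expf_neq0 // gt_eqF.
Qed.

Lemma form_direction l p q x : space_form l p -> space_form l q -> space_form l x ->
  0 < s_ l (dist l p q) -> 0 < s_ l (dist l p x) ->
  s_ l (dist l p q) * s_ l (dist l p x) * form l (direction l p q) (direction l p x) =
  (chord l p q + chord l p x - chord l q x) / 2 - l * (chord l p q * chord l p x) / 4.
Proof.
move=> hp hq hx h1 h2; rewrite -form_radial // !directionE.
move: (radial _ _ _) (radial _ _ _) (s_ _ _) (s_ _ _) h1 h2 => u v a b h1 h2.
rewrite formZ [form l v _]formC formZ [form l u v]formC.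
by field; rewrite !gt_eqF.
Qed.

Lemma det3_radialr l p q x : det3 p q (radial l p x) = det3 p q x.
Proof.
rewrite radial.unlock; move: (c_ _ _) => a; rewrite /det3 !mxE.
by gen_coords p; gen_coords q; gen_coords x; ring.
Qed.

(** The determinant ignores the component of [direction l p q] along [p]. *)
Lemma det3_direction l p q u : det3 p (direction l p q) u = (s_ l (dist l p q))^-1 * det3 p q u.
Proof.
rewrite /direction; move: (_^-1) (c_ _ _) => a b; rewrite /det3 !mxE.
by gen_coords p; gen_coords q; gen_coords u; ring.
Qed.

Lemma orient_direction l p q x : 0 < s_ l (dist l p q) -> 0 < s_ l (dist l p x) ->
  s_ l (dist l p q) * s_ l (dist l p x) * orient l p (direction l p q) (direction l p x) =
  area_scale l * det3 p q x.
Proof.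
move=> h1 h2; rewrite -orient_radial !directionE /orient.
have -> : det3 p ((s_ l (dist l p q))^-1 *: radial l p q) ((s_ l (dist l p x))^-1 *: radial l p x) =
  (s_ l (dist l p q))^-1 * (s_ l (dist l p x))^-1 * det3 p (radial l p q) (radial l p x).
  move: (_^-1) (_^-1) (radial _ _ _) (radial _ _ _) => a b u v; rewrite /det3 !mxE.
  by gen_coords p; gen_coords u; gen_coords v; ring.
move: (s_ _ _) (s_ _ _) (det3 _ _ _) h1 h2 => a b f h1 h2.
by field; rewrite !gt_eqF.
Qed.

End Tangent.

(** * Angles seen from a point *)

HB.lock Definition angle_at {R : realType} (l : R) (p q x : 'rV[R]_3) : R :=
  angle l (direction l p q) (direction l p x).

(** The sine of the oriented angle at [p] from [q] to [x]. *)
HB.lock Definition sin_at {R : realType} (l : R) (p q x : 'rV[R]_3) : R :=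
  orient l p (direction l p q) (direction l p x).

(** The condition under which [direction l p q] is defined: [p] and [q] are distinct, and
    not antipodal if [l > 0]. *)
Definition visible {R : realType} (l : R) (p q : 'rV[R]_3) : Prop :=
  [/\ space_form l p, space_form l q & 0 < s_ l (dist l p q)].

Section AngleAt.
Context {R : realType}.
Implicit Types (l e : R) (p q x v w : 'rV[R]_3).

Lemma visibleC l p q : visible l p q -> visible l q p.
Proof. by case=> hp hq h; split=> //; rewrite distC. Qed.

Lemma unit_visible l p q : visible l p q -> unit_tangent l p (direction l p q).
Proof. by case=> hp hq h; apply: unit_direction. Qed.

Lemma angle_atC l p q x : angle_at l p q x = angle_at l p x q.
Proof. rewrite angle_at.unlock; exact: angleC. Qed.

Lemma angle_at_ge0 l p q x : visible l p q -> visible l p x -> 0 <= angle_at l p q x.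
Proof.
move=> hq hx; have [hp _ _] := hq; rewrite angle_at.unlock.
exact: (angle_ge0 hp (unit_visible hq) (unit_visible hx)).
Qed.

Lemma angle_at_lepi l p q x : visible l p q -> visible l p x -> angle_at l p q x <= pi.
Proof.
move=> hq hx; have [hp _ _] := hq; rewrite angle_at.unlock.
exact: (angle_lepi hp (unit_visible hq) (unit_visible hx)).
Qed.

Lemma angle_at_refl l p q : visible l p q -> angle_at l p q q = 0.
Proof. by move/unit_visible => [_ h]; rewrite angle_at.unlock /angle h acos1. Qed.

Lemma law_of_cosines l p q x : visible l p q -> visible l p x ->
  s_ l (dist l p q) * s_ l (dist l p x) * cos (angle_at l p q x) =
  (chord l p q + chord l p x - chord l q x) / 2 - l * (chord l p q * chord l p x) / 4.
Proof.
move=> hq hx; have [hp hq' sq] := hq; have [_ hx' sx] := hx; rewrite angle_at.unlock.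
by rewrite (cos_angle hp (unit_visible hq) (unit_visible hx)); apply: form_direction.
Qed.

Lemma sin_atE l p q x : visible l p q -> visible l p x ->
  s_ l (dist l p q) * s_ l (dist l p x) * sin_at l p q x = area_scale l * det3 p q x.
Proof. by move=> [_ _ h1] [_ _ h2]; rewrite sin_at.unlock orient_direction. Qed.

Lemma sin_angle_at l p q x : visible l p q -> visible l p x ->
  sin (angle_at l p q x) = `|sin_at l p q x|.
Proof.
move=> hq hx; have [hp _ _] := hq; have uq := unit_visible hq; have ux := unit_visible hx.
rewrite angle_at.unlock sin_at.unlock sin_acos ?(unit_form_bound hp uq ux) //.
by rewrite -(cos2Dorient2 hp uq ux) addrAC subrr add0r sqrtr_sqr.
Qed.

Lemma sin_atD l p q v w : visible l p q -> visible l p v -> visible l p w ->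
  sin_at l p q w =
  sin_at l p q v * cos (angle_at l p v w) + cos (angle_at l p q v) * sin_at l p v w.
Proof.
move=> hq hv hw; have [hp _ _] := hq.
have uq := unit_visible hq; have uv := unit_visible hv; have uw := unit_visible hw.
rewrite angle_at.unlock sin_at.unlock.
exact: (sin_angleD hp uq uv uw).
Qed.

Lemma cos_atD l p q v w : visible l p q -> visible l p v -> visible l p w ->
  cos (angle_at l p q w) =
  cos (angle_at l p q v) * cos (angle_at l p v w) - sin_at l p q v * sin_at l p v w.
Proof.
move=> hq hv hw; have [hp _ _] := hq.
have uq := unit_visible hq; have uv := unit_visible hv; have uw := unit_visible hw.
rewrite angle_at.unlock sin_at.unlock.
exact: (cos_angleD hp uq uv uw).
Qed.

Lemma sin_at_ge0 l e p q x : visible l p q -> visible l p x ->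
  (0 <= e * sin_at l p q x) = (0 <= e * det3 p q x).
Proof.
move=> hq hx; have [_ _ h1] := hq; have [_ _ h2] := hx.
rewrite -(pmulr_rge0 _ (mulr_gt0 h1 h2)) mulrCA sin_atE // mulrCA.
by rewrite pmulr_rge0 ?area_scale_gt0.
Qed.

Lemma sin_at_gt0 l e p q x : visible l p q -> visible l p x ->
  (0 < e * sin_at l p q x) = (0 < e * det3 p q x).
Proof.
move=> hq hx; have [_ _ h1] := hq; have [_ _ h2] := hx.
rewrite -(pmulr_rgt0 _ (mulr_gt0 h1 h2)) mulrCA sin_atE // mulrCA.
by rewrite pmulr_rgt0 ?area_scale_gt0.
Qed.

Lemma norm_sign_mul (e z : R) : e * e = 1 -> 0 <= e * z -> `|z| = e * z.
Proof.
move=> he hz; rewrite -(ger0_norm hz) normrM.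
have -> : `|e| = 1 by apply/eqP; rewrite -(@eqrXn2 _ 2) // -normrX expr2 he normr1 expr1n.
by rewrite mul1r.
Qed.

(** The number [e] is 1 or -1 and selects the orientation for which [p], [q], [x] is
    positively oriented. *)
Lemma sin_angle_at_sign l e p q x : e * e = 1 -> visible l p q -> visible l p x ->
  0 <= e * det3 p q x -> sin (angle_at l p q x) = e * sin_at l p q x.
Proof.
move=> he hq hx h; rewrite sin_angle_at //; apply: norm_sign_mul => //.
by rewrite sin_at_ge0.
Qed.

Lemma sin_angle_atD l e p q v w : e * e = 1 ->
  visible l p q -> visible l p v -> visible l p w ->
  0 <= e * det3 p q v -> 0 <= e * det3 p v w ->
  sin (angle_at l p q v + angle_at l p v w) = e * sin_at l p q w.
Proof.
move=> he hq hv hw h1 h2.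
rewrite sinD (sin_angle_at_sign he hq hv h1) (sin_angle_at_sign he hv hw h2).
by rewrite (sin_atD hq hv hw); ring.
Qed.

(** Sine and cosine of the sum are those of the total angle. The hypothesis on the total
    triangle makes the sine of the sum positive, which keeps the sum below [pi]. *)
Lemma angle_atD l e p q v w : e * e = 1 ->
  visible l p q -> visible l p v -> visible l p w ->
  0 <= e * det3 p q v -> 0 <= e * det3 p v w -> 0 < e * det3 p q w ->
  angle_at l p q w = angle_at l p q v + angle_at l p v w.
Proof.
move=> he hq hv hw h1 h2 h3; have [hp _ _] := hq.
have sD : 0 < sin (angle_at l p q v + angle_at l p v w).
  by rewrite (sin_angle_atD he hq hv hw h1 h2) sin_at_gt0.
have cD : cos (angle_at l p q v + angle_at l p v w) = cos (angle_at l p q w).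
  rewrite cosD (sin_angle_at_sign he hq hv h1) (sin_angle_at_sign he hv hw h2).
  by rewrite (cos_atD hq hv hw) mulrACA he mul1r.
have := angle_at_ge0 hq hv; have := angle_at_ge0 hv hw.
have := angle_at_lepi hq hv; have := angle_at_lepi hv hw.
have := angle_at_ge0 hq hw; have := angle_at_lepi hq hw.
move: sD cD.
move: (angle_at l p q w) (angle_at l p q v) (angle_at l p v w) => a b c sD cD *.
apply: cos_inj; rewrite ?in_itv /=; [by apply/andP; split| |by []].
apply/andP; split; first exact: addr_ge0.
rewrite leNgt; apply/negP => hgt.
move: sD; rewrite -[b + c](subrK pi) sinDpi oppr_gt0 ltNge sin_ge0_pi //.
by apply/andP; split; lra.
Qed.

End AngleAt.

(** * Segments as traces of cones *)

Section Segment.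
Context {R : realType}.
Implicit Types (l a b t : R) (x y z p q u v w o : 'rV[R]_3).

Lemma det3ppx p x : det3 p p x = 0. Proof. by rewrite /det3; ring. Qed.
Lemma det3pxp p x : det3 p x p = 0. Proof. by rewrite /det3; ring. Qed.
Lemma det3pxx p x : det3 p x x = 0. Proof. by rewrite /det3; ring. Qed.
Lemma det3_rot p q x : det3 p q x = det3 q x p. Proof. by rewrite /det3; ring. Qed.
Lemma det3_swap p q x : det3 p q x = - det3 q p x. Proof. by rewrite /det3; ring. Qed.
Lemma det3_lin p q a b u v : det3 p q (a *: u + b *: v) = a * det3 p q u + b * det3 p q v.
Proof.
rewrite /det3 !mxE; gen_coords p; gen_coords q; gen_coords u; gen_coords v.
by ring.
Qed.

(** Cramer's rule: the barycentric coordinates of [z] in the triangle [p q x]. *)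
Lemma det3_cramer p q x z :
  det3 p q x *: z = det3 z q x *: p + det3 p z x *: q + det3 p q z *: x.
Proof.
by apply: row3_eq; rewrite /det3 !mxE; gen_coords p; gen_coords q; gen_coords x;
  gen_coords z; ring.
Qed.

(** The equation says that [l * form l z z = 1] for the combination [z]. It is written with
    the chord so that it keeps its meaning for [l = 0], where it becomes [(a + b) ^+ 2 = 1]. *)
Lemma space_form_comb l p q a b : space_form l p -> space_form l q -> 0 <= a -> 0 <= b ->
  (a + b) ^+ 2 - l * (a * b) * chord l p q = 1 -> 0 < a + b ->
  space_form l (a *: p + b *: q).
Proof.
move=> hp hq a0 b0 h hab; rewrite /space_form /=; case: eqVneq => [l0|l0].
  have [hp0 hq0] : p 0 0 = 1 /\ q 0 0 = 1.
    by move: hp hq; rewrite l0 => /space_form0 ? /space_form0 ?.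
  rewrite !mxE hp0 hq0 !mulr1; apply/eqP.
  have : (a + b) ^+ 2 = 1 by rewrite -h l0; ring.
  by move/eqP; rewrite sqrf_eq1 => /orP[//|/eqP e]; exfalso; lra.
split.
  have -> : form l (a *: p + b *: q) (a *: p + b *: q) =
     a ^+ 2 * form l p p + b ^+ 2 * form l q q + 2 * (a * b) * form l p q.
    by rewrite /form !mxE; gen_coords p; gen_coords q; ring.
  rewrite (space_form_form l0 hp) (space_form_form l0 hq) form_chord //.
  transitivity (l^-1 * ((a + b) ^+ 2 - l * (a * b) * chord l p q)); first by field.
  by rewrite h mulr1.
move=> hl; rewrite !mxE; have hp0 := space_form_neg hl hp; have hq0 := space_form_neg hl hq.
have [a1|a1] := eqVneq a 0.
  by rewrite a1 add0r in hab; rewrite a1 mul0r add0r mulr_gt0.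
by rewrite ltr_pwDl ?mulr_gt0 ?mulr_ge0 ?(ltW hq0) // lt_neqAle eq_sym a1.
Qed.

Lemma comb_norm l p q a b : space_form l p -> space_form l q ->
  space_form l (a *: p + b *: q) -> (a + b) ^+ 2 - l * (a * b) * chord l p q = 1.
Proof.
move=> hp hq hx; have [l0|l0] := eqVneq l 0.
  move: hx hp hq; rewrite l0 => /space_form0 hx /space_form0 hp /space_form0 hq.
  by move: hx; rewrite !mxE hp hq !mulr1 => ->; ring.
have : l * form l (a *: p + b *: q) (a *: p + b *: q) = 1.
  by rewrite space_form_form // divff.
have -> : form l (a *: p + b *: q) (a *: p + b *: q) =
     a ^+ 2 * form l p p + b ^+ 2 * form l q q + 2 * (a * b) * form l p q.
  by rewrite /form !mxE; gen_coords p; gen_coords q; ring.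
rewrite (space_form_form l0 hp) (space_form_form l0 hq) form_chord // => <-.
by field.
Qed.

(** The side condition of [geod_convex], trivial when [l <= 0]. *)
Definition not_antipodal l p q := 0 < l -> dist l p q < pi / Num.sqrt l.

Lemma not_antipodalC l p q : not_antipodal l p q -> not_antipodal l q p.
Proof. by rewrite /not_antipodal distC. Qed.

Lemma chord_lt4 l p q : space_form l p -> space_form l q -> not_antipodal l p q ->
  0 < 4 - l * chord l p q.
Proof.
move=> hp hq h; rewrite chord_dist //.
have := c2_s2 l (dist l p q / 2).
have : 0 < c_ l (dist l p q / 2).
  apply: c_gt0 => [|hl]; first by rewrite divr_ge0 ?dist_ge0.
  by have := h hl; lra.
by move: (s_ _ _) (c_ _ _) => s c c0 e; have := mulr_gt0 c0 c0; lra.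
Qed.

(** At distance [pi / sqrt l] the vector [p + q] has form 0, and the form is definite when
    [l > 0]. *)
Lemma antipodal_opp l p q : space_form l p -> space_form l q -> ~ not_antipodal l p q ->
  q = - p.
Proof.
move=> hp hq h; have [hl hd] : 0 < l /\ pi / Num.sqrt l <= dist l p q.
  have [hl|hl] := boolP (0 < l); last by exfalso; apply: h => hl'; rewrite hl' in hl.
  by split => //; rewrite leNgt; apply/negP => h'; apply: h.
have l0 : l != 0 by rewrite gt_eqF.
have e : dist l p q = pi / Num.sqrt l by apply/le_anti; rewrite hd dist_le_pi.
have : c_ l (dist l p q) = -1.
  by rewrite /c_ hl e mulrC divfK ?cospi // gt_eqF // sqrtr_gt0.
rewrite c_dist // => hc.
have hf : form l (p + q) (p + q) = 0.
  have -> : form l (p + q) (p + q) = form l p p + form l q q + 2 * form l p q.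
    by rewrite /form !mxE; gen_coords p; gen_coords q; ring.
  rewrite !space_form_form // form_chord //; apply: (mulfI l0).
  transitivity (4 * (l * l^-1) - l * chord l p q); first by field.
  by rewrite divff //; lra.
move: hf; rewrite /form gtr0_sg // mul1r -!expr2 => /eqP.
rewrite !paddr_eq0 ?addr_ge0 ?sqr_ge0 // !sqrf_eq0 => /andP[/andP[/eqP h0 /eqP h1] /eqP h2].
by move: h0 h1 h2; rewrite !mxE => *; apply: row3_eq; rewrite !mxE; lra.
Qed.

Lemma s_dist_gt0 l p q : space_form l p -> space_form l q -> p != q -> not_antipodal l p q ->
  0 < s_ l (dist l p q).
Proof. by move=> hp hq hpq h; apply: s_gt0 => //; apply: dist_gt0. Qed.

Lemma s_dist_ge0 l p q : space_form l p -> space_form l q -> 0 <= s_ l (dist l p q).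
Proof.
move=> hp hq; have := dist_ge0 hp hq; rewrite le_eqVlt => /orP[/eqP <-|h0].
  by rewrite s_0.
have := dist_le_pi hp hq; set d := dist _ _ _ in h0 * => hd.
rewrite s_half mulr_ge0 //; last first.
  by apply: c_ge0 => [|hl]; [lra | have := hd hl; lra].
rewrite mulr_ge0 // ltW // s_gt0 // => [|hl]; first by lra.
by have := hd hl; have : 0 < pi / Num.sqrt l; [rewrite divr_gt0 ?pi_gt0 ?sqrtr_gt0|lra].
Qed.

(** The coefficients are [s_ l (d - t) / s_ l d] and [s_ l t / s_ l d], nonnegative because
    [d] is below half a great circle. *)
Lemma segment_comb l p q x : space_form l p -> space_form l q -> p != q -> not_antipodal l p q ->
  segment l p q x ->
  exists a b, [/\ 0 <= a, 0 <= b, space_form l x & x = a *: p + b *: q].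
Proof.
move=> hp hq hpq hn [t /= /andP[t0 td] <-].
have sd := s_dist_gt0 hp hq hpq hn.
have d0 := dist_gt0 hp hq hpq.
have hs (u : R) : 0 <= u <= dist l p q -> 0 <= s_ l u.
  move=> /andP[]; rewrite le_eqVlt => /orP[/eqP <- _|u0 ud]; first by rewrite s_0.
  by apply/ltW/s_gt0 => // hl; apply: le_lt_trans ud (hn hl).
exists (s_ l (dist l p q - t) / s_ l (dist l p q)), (s_ l t / s_ l (dist l p q)).
have a0 : 0 <= s_ l (dist l p q - t) / s_ l (dist l p q).
  by rewrite divr_ge0 ?hs //; lra.
have b0 : 0 <= s_ l t / s_ l (dist l p q) by rewrite divr_ge0 ?hs //; lra.
have e : geodesic l p (direction l p q) t =
    (s_ l (dist l p q - t) / s_ l (dist l p q)) *: p + (s_ l t / s_ l (dist l p q)) *: q.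
  rewrite /geodesic /direction s_B.
  move: (s_ l (dist l p q)) sd => s sd; move: (c_ l (dist l p q)) => c.
  move: (s_ l t) (c_ l t) => s' c'.
  by apply: row3_eq; rewrite !mxE; gen_coords p; gen_coords q; field; rewrite gt_eqF.
split=> //; rewrite e; apply: space_form_comb => //.
- have := c2_s2 l (dist l p q); have := c2_s2 l t.
  have := c_dist hp hq; rewrite s_B.
  move: (s_ l (dist l p q)) sd => s sd; move: (c_ l (dist l p q)) => c.
  move: (s_ l t) (c_ l t) => s' c' hc h1 h2.
  have hs0 : s != 0 by rewrite gt_eqF.
  apply: (mulIf (expf_neq0 2 hs0)); rewrite mul1r.
  have -> : (((s * c' - c * s') / s + s' / s) ^+ 2 -
     l * ((s * c' - c * s') / s * (s' / s)) * chord l p q) * s ^+ 2 =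
     (s * c' - c * s' + s') ^+ 2 - (s * c' - c * s') * s' * (2 * (1 - c)).
    rewrite hc; field.
    by [].
  transitivity (s ^+ 2 * c' ^+ 2 + s' ^+ 2 - c ^+ 2 * s' ^+ 2); first by ring.
  have -> : c ^+ 2 = 1 - l * s ^+ 2 by rewrite -h2; ring.
  transitivity (s ^+ 2 * (c' ^+ 2 + l * s' ^+ 2)); first by ring.
  by rewrite h1 mulr1.
- rewrite -mulrDl divr_gt0 //.
  have [t1|t1] := eqVneq t 0; first by rewrite t1 subr0 s_0 addr0.
  rewrite ltr_wpDl ?hs //; first by lra.
  apply: s_gt0; first by rewrite lt_neqAle eq_sym t1.
  by move=> hl; apply: le_lt_trans td (hn hl).
Qed.

Lemma c_dist_comb l p q a b : space_form l p -> space_form l q ->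
  space_form l (a *: p + b *: q) ->
  c_ l (dist l p (a *: p + b *: q)) = a + b * c_ l (dist l p q).
Proof.
move=> hp hq; set x := a *: p + b *: q => hx; have [l0|l0] := eqVneq l 0.
  have : x 0 0 = 1 by apply: space_form0; rewrite -l0.
  move: hp hq; rewrite /x l0 /c_ ltxx !mxE => /space_form0 -> /space_form0 ->.
  by rewrite !mulr1.
have E y : space_form l y -> c_ l (dist l p y) = l * form l p y.
  by move=> hy; rewrite c_dist // form_chord //; field.
rewrite !E // /x formC formDZ (space_form_form l0 hp) formC.
by field.
Qed.

Lemma radial_comb l p q a b : space_form l p -> space_form l q ->
  space_form l (a *: p + b *: q) -> radial l p (a *: p + b *: q) = b *: radial l p q.
Proof.
move=> hp hq hx; rewrite radial.unlock (c_dist_comb hp hq hx); move: (c_ _ _) => c.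
by apply: row3_eq; rewrite !mxE; gen_coords p; gen_coords q; ring.
Qed.

(** The converse of [segment_comb]: the distance [t] from [p] has [s_ l t = b * s_ l d], and
    [s_ l (d - t) = a * s_ l d >= 0] forces [t <= d]. *)
Lemma comb_segment l p q a b : space_form l p -> space_form l q -> p != q ->
  not_antipodal l p q -> 0 <= a -> 0 <= b -> space_form l (a *: p + b *: q) ->
  segment l p q (a *: p + b *: q).
Proof.
move=> hp hq hpq hn a0 b0; set x := a *: p + b *: q => hx.
have sd := s_dist_gt0 hp hq hpq hn.
have d0 := dist_gt0 hp hq hpq.
set t := dist l p x.
have hc := c_dist_comb hp hq hx; rewrite -/x -/t in hc.
have hs : s_ l t = b * s_ l (dist l p q).
  apply/eqP; rewrite -(@eqrXn2 _ 2) ?s_dist_ge0 ?mulr_ge0 ?s_dist_ge0 //.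
  rewrite exprMn -!form_radial_radial //.
  rewrite /x radial_comb //.
  by rewrite formZ formC formZ; apply/eqP; ring.
exists t; last first.
  rewrite /geodesic /direction hs hc /x; move: (s_ _ _) (c_ _ _) sd => s c sd.
  by apply: row3_eq; rewrite !mxE; gen_coords p; gen_coords q; field; rewrite gt_eqF.
rewrite /= /t dist_ge0 //= -/t leNgt; apply/negP => td.
have h1 : 0 <= s_ l (dist l p q - t).
  rewrite s_B hs hc.
  have -> : s_ l (dist l p q) * (a + b * c_ l (dist l p q)) -
    c_ l (dist l p q) * (b * s_ l (dist l p q)) = a * s_ l (dist l p q) by ring.
  by rewrite mulr_ge0 // ltW.
have : 0 < s_ l (t - dist l p q).
  apply: s_gt0 => [|hl]; first by rewrite subr_gt0.
  by rewrite ltrBlDr; apply: (le_lt_trans (dist_le_pi hp hx hl)); rewrite ltrDl.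
by rewrite -opprB s_N oppr_gt0 ltNge h1.
Qed.

Lemma convex_comb l (D : set 'rV[R]_3) p q a b : D `<=` space_form l -> geod_convex l D ->
  D p -> D q -> not_antipodal l p q -> 0 <= a -> 0 <= b ->
  space_form l (a *: p + b *: q) -> D (a *: p + b *: q).
Proof.
move=> hD hc hp hq hn a0 b0 hx.
have [e|hpq] := eqVneq p q; last first.
  by apply: (hc p q) => //; apply: comb_segment => //; apply: hD.
have := comb_norm (hD _ hp) (hD _ hq) hx.
rewrite -e chordxx mulr0 subr0 => /eqP; rewrite sqrf_eq1 => /orP[/eqP h|/eqP h].
  by rewrite -scalerDl h scale1r.
by exfalso; lra.
Qed.

(** The normalizing factor is the square root of the left hand side of the equation in
    [space_form_comb]. This is positive, except for antipodal points with equal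
    coefficients. *)
Lemma normalize_comb l p q a b : space_form l p -> space_form l q -> not_antipodal l p q ->
  0 <= a -> 0 <= b -> 0 < a + b ->
  exists2 T, 0 < T & space_form l ((a / T) *: p + (b / T) *: q).
Proof.
move=> hp hq hn a0 b0 hab.
have hch := chord_lt4 hp hq hn.
set N := (a + b) ^+ 2 - l * (a * b) * chord l p q.
have N0 : 0 < N.
  have h1 : 0 <= (a - b) ^+ 2 by apply: sqr_ge0.
  have h2 : 0 < (a + b) ^+ 2 by rewrite exprn_gt0.
  have h3 := mulr_ge0 (mulr_ge0 a0 b0) (ltW hch).
  rewrite lt_neqAle; apply/andP; split; last by rewrite /N; lra.
  apply/eqP => /esym e.
  have e1 : (a - b) ^+ 2 = 0.
    by move: e; rewrite /N; lra.
  have e2 : a * b * (4 - l * chord l p q) = 0.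
    by move: e; rewrite /N; lra.
  move/eqP: e1; rewrite sqrf_eq0 subr_eq0 => /eqP e1.
  move/eqP: e2; rewrite e1 mulf_eq0 (gt_eqF hch) orbF -expr2 sqrf_eq0 => /eqP e2.
  by move: hab; rewrite e1 e2; lra.
exists (Num.sqrt N); first by rewrite sqrtr_gt0.
have T0 : 0 < Num.sqrt N by rewrite sqrtr_gt0.
have T2 : Num.sqrt N ^+ 2 = N by rewrite sqr_sqrtr // ltW.
apply: space_form_comb => //.
- by rewrite divr_ge0 // ltW.
- by rewrite divr_ge0 // ltW.
- have hT : Num.sqrt N != 0 by rewrite gt_eqF.
  apply: (mulIf (expf_neq0 2 hT)); rewrite mul1r [RHS]T2 {T2 T0}.
  transitivity ((a + b) ^+ 2 - l * (a * b) * chord l p q) => //.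
  by move: (Num.sqrt N) hT => T hT; field.
- by rewrite -mulrDl divr_gt0.
Qed.

(** Disks of radius at most a quarter of a great circle are convex, in a form that applies
    directly to the three vertices of a triangle. With [T = a + b + d], and [W] the sum of
    the pairwise products of coefficients weighted by the chords, the equation of the
    surface is [T ^+ 2 - l * W = 1] and the chord from [o] is the combination of the chords
    minus [2 * W / (1 + T)]; the bound [l * r <= 2] says that this correction outweighs the
    excess of [T] over 1. *)
Lemma chord_comb3 l o p q z a b d r : space_form l o ->
  space_form l p -> space_form l q -> space_form l z ->
  0 <= a -> 0 <= b -> 0 <= d -> space_form l (a *: p + b *: q + d *: z) ->
  0 <= r -> l * r <= 2 -> chord l o p <= r -> chord l o q <= r -> chord l o z <= r ->
  chord l o (a *: p + b *: q + d *: z) <= r.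
Proof.
move=> ho hp hq hz a0 b0 d0; set x := _ + d *: z => hx r0 lr h1 h2 h3.
set W := a * b * chord l p q + a * d * chord l p z + b * d * chord l q z.
have W0 : 0 <= W by rewrite !addr_ge0 // mulr_ge0 ?chord_ge0 // mulr_ge0.
set T := a + b + d.
have T0 : 0 <= T by rewrite /T !addr_ge0.
have hT : T ^+ 2 - l * W = 1.
  have [l0|l0] := eqVneq l 0.
    have : x 0 0 = 1 by apply: space_form0; rewrite -l0.
    move: hp hq hz; rewrite /x l0 !mxE => /space_form0 -> /space_form0 -> /space_form0 ->.
    by rewrite !mulr1 -/T => ->; ring.
  have : l * form l x x = 1 by rewrite space_form_form // divff.
  have -> : form l x x = a ^+ 2 * form l p p + b ^+ 2 * form l q q + d ^+ 2 * form l z z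
      + 2 * (a * b) * form l p q + 2 * (a * d) * form l p z + 2 * (b * d) * form l q z.
    by rewrite /x /form !mxE; gen_coords p; gen_coords q; gen_coords z; ring.
  rewrite (space_form_form l0 hp) (space_form_form l0 hq) (space_form_form l0 hz).
  by rewrite !form_chord // => <-; rewrite /T /W; field.
have e : chord l o x * (1 + T) =
   (a * chord l o p + b * chord l o q + d * chord l o z) * (1 + T) - 2 * W.
  have [l0|l0] := eqVneq l 0.
    have hx0 : x 0 0 = 1 by apply: space_form0; rewrite -l0.
    have hT1 : a + b + d = 1.
      move: hp hq hz hx0; rewrite /x l0 !mxE => /space_form0 -> /space_form0 -> /space_form0 ->.
      by rewrite !mulr1.
    have -> : a = 1 - b - d by rewrite -hT1; ring.
    rewrite /x /T /W hT1 l0.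
    have -> : a = 1 - b - d by rewrite -hT1; ring.
    rewrite /chord /form sgr0 !mxE; gen_coords o; gen_coords p; gen_coords q; gen_coords z.
    by ring.
  apply: (mulfI l0).
  have E y : space_form l y -> l * chord l o y = 2 - 2 * l * form l o y.
    by move=> hy; rewrite form_chord //; field.
  have -> : l * (chord l o x * (1 + T)) = l * chord l o x * (1 + T) by ring.
  have -> : l * ((a * chord l o p + b * chord l o q + d * chord l o z) * (1 + T) - 2 * W) =
    (a * (l * chord l o p) + b * (l * chord l o q) + d * (l * chord l o z)) * (1 + T) - 2 * (l * W).
    by ring.
  have -> : l * W = T ^+ 2 - 1 by rewrite -hT; ring.
  rewrite !E //.
  have -> : form l o x = a * form l o p + b * form l o q + d * form l o z.
    by rewrite /x /form !mxE; gen_coords o; gen_coords p; gen_coords q; gen_coords z; ring.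
  by rewrite /T; ring.
have T1 : 0 < 1 + T by lra.
rewrite -(ler_pM2r T1) e.
have h4 : (a * chord l o p + b * chord l o q + d * chord l o z) <= T * r.
  have := ler_wpM2l a0 h1; have := ler_wpM2l b0 h2; have := ler_wpM2l d0 h3.
  by rewrite /T; lra.
have h5 := ler_wpM2r (ltW T1) h4.
suff : r * (T ^+ 2 - 1) <= 2 * W by lra.
have -> : T ^+ 2 - 1 = l * W by rewrite -hT; ring.
by have := ler_wpM2r W0 lr; lra.
Qed.

End Segment.

(** * Chord-tangent angles in a triangle *)

Section HalfChordTrig.
Context {R : realType}.

Lemma sin_between (y t : R) : 0 <= y -> y <= t -> t <= pi - y -> sin y <= sin t.
Proof.
move=> y0 yt ty; have p0 := @pi_gt0 R.
have mono (a b : R) : 0 <= a -> a <= b -> b <= pi / 2 -> sin a <= sin b.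
  move=> a0 ab bp; rewrite le_eqVlt; move: ab; rewrite le_eqVlt => /orP[/eqP ->|ab].
    by rewrite eqxx.
  by rewrite ltr_sin ?ab ?orbT // in_itv /=; apply/andP; split; lra.
have [h|h] := leP t (pi / 2); first by apply: mono.
have -> : sin t = sin (pi - t) by rewrite sinB sinpi cospi; ring.
by apply: mono; lra.
Qed.

(** Since [cos (y - z) < cos t], it suffices that [sin z <= sin y * cos (y - z)]; by the
    addition formulas this compares [sin z = sin (y - (y - z))] with [sin (y + (y - z))]. *)
Lemma sin_lt_sin_cos (y z t : R) : 0 <= z -> 0 <= t -> t + z < y -> y <= pi / 2 ->
  sin z < sin y * cos t.
Proof.
move=> z0 t0 hy yp; have p0 := @pi_gt0 R.
have h1 : cos (y - z) < cos t.
  by rewrite ltr_cos ?in_itv /=; [lra | apply/andP; split; lra..].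
have h2 : 0 < sin y by rewrite sin_gt0_pi //; apply/andP; split; lra.
have h3 : sin z <= sin (y + (y - z)) by apply: sin_between; lra.
have h4 : sin z = sin (y - (y - z)) by congr sin; ring.
have h5 : sin y * cos (y - z) < sin y * cos t by rewrite ltr_pM2l.
rewrite sinD in h3; rewrite sinB in h4; lra.
Qed.

(** The analytic core of [half_chord_triangle]. The sides [a], [b], [c] are opposite to the
    vertices [p], [q], [x] of the triangle, [B] is the angle at [q] and [al] the angle at
    [p]; [ta], [ka] stand for the sine and cosine of half of [a], and [ya] for its
    chord-tangent angle. The laws of sines and cosines give two identities. The first one,
    [I1], shows that if [al + yc < yb] then also [B + yc < ya]: both angles are too small.
    The second one, [I2], then bounds the sum of the two projections of the sides from
    above, while [sin_lt_sin_cos] bounds each projection from below. *)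
Lemma half_chord_trig (l K ta tb tc ka kb kc ya yb yc B al : R) : 0 <= K ->
  0 < ta -> 0 < tb -> 0 < tc -> 0 < ka -> 0 < kb -> 0 < kc ->
  ka ^+ 2 + l * ta ^+ 2 = 1 -> kb ^+ 2 + l * tb ^+ 2 = 1 -> kc ^+ 2 + l * tc ^+ 2 = 1 ->
  0 <= B -> 0 <= al -> 0 <= ya <= pi / 2 -> 0 <= yb <= pi / 2 -> 0 <= yc <= pi / 2 ->
  sin ya = K * (ta / ka) -> sin yb = K * (tb / kb) -> sin yc = K * (tc / kc) ->
  (2 * tc * kc) * (2 * ta * ka) * cos B =
    2 * (tc ^+ 2 + ta ^+ 2 - tb ^+ 2) - 4 * l * tc ^+ 2 * ta ^+ 2 ->
  (2 * tc * kc) * (2 * tb * kb) * cos al =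
    2 * (tc ^+ 2 + tb ^+ 2 - ta ^+ 2) - 4 * l * tc ^+ 2 * tb ^+ 2 ->
  2 * ta * ka * sin B = 2 * tb * kb * sin al ->
  yc + ya + B <= pi -> yb <= yc + al.
Proof.
move=> K0 ta0 tb0 tc0 ka0 kb0 kc0 ea eb ec B0 al0 /andP[ya0 ya1] /andP[yb0 yb1] /andP[yc0 yc1].
move=> sa sb sc lB lal ls hB.
have kaN : ka != 0 by rewrite gt_eqF.
have kbN : kb != 0 by rewrite gt_eqF.
have kcN : kc != 0 by rewrite gt_eqF.
have tcN : tc != 0 by rewrite gt_eqF.
have p0 := @pi_gt0 R.
have cB : 2 * ta * ka * cos B * sin yc =
    K * ((tc ^+ 2 + ta ^+ 2 - tb ^+ 2) - 2 * l * tc ^+ 2 * ta ^+ 2) / kc ^+ 2.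
  rewrite sc; transitivity (K / kc ^+ 2 / 2 * ((2 * tc * kc) * (2 * ta * ka) * cos B)).
    by field.
  by rewrite lB; field.
have cal : 2 * tb * kb * cos al * sin yc =
    K * ((tc ^+ 2 + tb ^+ 2 - ta ^+ 2) - 2 * l * tc ^+ 2 * tb ^+ 2) / kc ^+ 2.
  rewrite sc; transitivity (K / kc ^+ 2 / 2 * ((2 * tc * kc) * (2 * tb * kb) * cos al)).
    by field.
  by rewrite lal; field.
(* The terms in [cos yc] agree by the law of sines, the other ones by the law of cosines. *)
have I1 : 2 * ta * ka * (sin ya - sin (B + yc)) = 2 * tb * kb * (sin yb - sin (al + yc)).
  rewrite !sinD.
  have -> : 2 * ta * ka * (sin ya - (sin B * cos yc + cos B * sin yc)) =
    2 * ta * ka * sin ya - 2 * ta * ka * sin B * cos yc - 2 * ta * ka * cos B * sin yc by ring.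
  rewrite cB ls.
  have -> : 2 * tb * kb * (sin yb - (sin al * cos yc + cos al * sin yc)) =
    2 * tb * kb * sin yb - 2 * tb * kb * sin al * cos yc - 2 * tb * kb * cos al * sin yc by ring.
  rewrite cal sa sb.
  apply: (mulIf (expf_neq0 2 kcN)).
  transitivity (2 * K * ta ^+ 2 * kc ^+ 2 - 2 * tb * kb * sin al * cos yc * kc ^+ 2
     - K * (tc ^+ 2 + ta ^+ 2 - tb ^+ 2 - 2 * l * tc ^+ 2 * ta ^+ 2)).
    by field; rewrite kaN kcN.
  transitivity (2 * K * tb ^+ 2 * kc ^+ 2 - 2 * tb * kb * sin al * cos yc * kc ^+ 2
     - K * (tc ^+ 2 + tb ^+ 2 - ta ^+ 2 - 2 * l * tc ^+ 2 * tb ^+ 2)).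
    have -> : kc ^+ 2 = 1 - l * tc ^+ 2 by rewrite -ec; ring.
    by ring.
  by field; rewrite kbN kcN.
have I2 : K * (2 * ta * ka) * cos B + K * (2 * tb * kb) * cos al =
   sin yc * (2 * (1 - l * ta ^+ 2) + 2 * (1 - l * tb ^+ 2) - 2).
  rewrite sc; transitivity (K / (2 * tc * kc) * ((2 * tc * kc) * (2 * ta * ka) * cos B
    + (2 * tc * kc) * (2 * tb * kb) * cos al)).
    by field; rewrite tcN kcN.
  by rewrite lB lal; field; rewrite tcN kcN.
clear lB lal ls cB cal.
rewrite leNgt; apply/negP => hlt.
have sal : sin (al + yc) < sin yb.
  by rewrite ltr_sin ?in_itv /=; [lra | apply/andP; split; lra..].
have sB : sin (B + yc) < sin ya.
  have h1 : 0 < 2 * tb * kb * (sin yb - sin (al + yc)).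
    by rewrite !mulr_gt0 // subr_gt0.
  by move: h1; rewrite -I1 pmulr_rgt0 ?mulr_gt0 // subr_gt0.
have hB2 : B + yc < ya.
  rewrite ltNge; apply/negP => h; move: sB; rewrite ltNge sin_between //; lra.
have key (y th k t : R) : 0 <= th -> th + yc < y -> y <= pi / 2 -> 0 < k -> 0 < t ->
    sin y = K * (t / k) -> 2 * k ^+ 2 * sin yc < K * (2 * t * k) * cos th.
  move=> th0 hy yp k0 t0 sy.
  have -> : K * (2 * t * k) = 2 * k ^+ 2 * sin y by rewrite sy; field; rewrite gt_eqF.
  by rewrite -[ltRHS]mulrA ltr_pM2l ?mulr_gt0 ?exprn_gt0 // sin_lt_sin_cos.
have h1 := key ya B ka ta B0 hB2 ya1 ka0 ta0 sa.
have h2 := key yb al kb tb al0 _ yb1 kb0 tb0 sb.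
have {}h2 : 2 * kb ^+ 2 * sin yc < K * (2 * tb * kb) * cos al by apply: h2; lra.
have syc : 0 <= sin yc by rewrite sin_ge0_pi //; apply/andP; split; lra.
have eka : 1 - l * ta ^+ 2 = ka ^+ 2 by rewrite -ea; ring.
have ekb : 1 - l * tb ^+ 2 = kb ^+ 2 by rewrite -eb; ring.
rewrite eka ekb in I2.
by clear -h1 h2 I2 syc; lra.
Qed.

End HalfChordTrig.

(** With [K = c_ l r / s_ l r], the angle between a circle of radius [r] and a chord of
    length [dist l p q]. *)
HB.lock Definition half_chord_angle {R : realType} (l K : R) (p q : 'rV[R]_3) : R :=
  asin (K * ta_ l (dist l p q / 2)).

(** The distance of [p] and [q] is at most the diameter of a circle of radius [r], where
    [K = c_ l r / s_ l r]. *)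
Definition chord_fits {R : realType} (l K : R) (p q : 'rV[R]_3) : Prop :=
  visible l p q /\ K * ta_ l (dist l p q / 2) <= 1.

Section HalfChord.
Context {R : realType}.
Implicit Types (l K : R) (p q x : 'rV[R]_3).

Lemma half_dist_gt0 l p q : visible l p q ->
  [/\ 0 < s_ l (dist l p q / 2), 0 < c_ l (dist l p q / 2) &
    s_ l (dist l p q) = 2 * s_ l (dist l p q / 2) * c_ l (dist l p q / 2)].
Proof.
move=> [hp hq hs]; have d0 := dist_ge0 hp hq.
have d1 : 0 < dist l p q.
  by rewrite lt_neqAle d0 andbT; apply/eqP => e; move: hs; rewrite -e s_0 ltxx.
have hc : 0 <= c_ l (dist l p q / 2).
  apply: c_ge0 => [|hl]; first by lra.
  by rewrite ler_pM2r ?invr_gt0 // dist_le_pi.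
have hh := s_half l (dist l p q).
have hs2 : 0 < s_ l (dist l p q / 2).
  apply: s_gt0 => [|hl]; first by lra.
  have := dist_le_pi hp hq hl; have : 0 < pi / Num.sqrt l by rewrite divr_gt0 ?pi_gt0 ?sqrtr_gt0.
  by lra.
split => //; rewrite lt_neqAle hc andbT; apply/eqP => e.
by move: hs; rewrite hh -e mulr0 ltxx.
Qed.

Lemma half_ta_gt0 l p q : visible l p q -> 0 < ta_ l (dist l p q / 2).
Proof. by move=> /half_dist_gt0[h1 h2 _]; rewrite divr_gt0. Qed.

Lemma asin_bounds (x : R) : 0 <= x <= 1 -> 0 <= asin x <= pi / 2 /\ sin (asin x) = x.
Proof.
move=> /andP[x0 x1].
have hb : -1 <= x <= 1 by rewrite x1 andbT (le_trans _ x0) // lerN10.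
have e : sin (asin x) = x by rewrite asinK ?in_itv.
split=> //; rewrite asin_lepi2 // andbT leNgt; apply/negP => hneg.
have p0 := @pi_gt0 R; have h3 := asin_geNpi2 hb.
have : sin (asin x) < sin 0 by rewrite ltr_sin ?in_itv /=; [|apply/andP; split; lra..].
by rewrite sin0 e ltNge x0.
Qed.

Lemma half_chord_angle_bounds l K p q : 0 <= K -> chord_fits l K p q ->
  0 <= half_chord_angle l K p q <= pi / 2 /\
  sin (half_chord_angle l K p q) = K * ta_ l (dist l p q / 2).
Proof.
move=> K0 [hs hK]; rewrite half_chord_angle.unlock; apply: asin_bounds.
by rewrite hK andbT mulr_ge0 // ltW // half_ta_gt0.
Qed.

Lemma half_chord_angleC l K p q : half_chord_angle l K p q = half_chord_angle l K q p.
Proof. by rewrite half_chord_angle.unlock distC. Qed.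

Lemma chord_fitsC l K p q : chord_fits l K p q -> chord_fits l K q p.
Proof. by case=> h1 h2; split; [exact: visibleC | rewrite distC]. Qed.

Lemma law_of_sines l p q x : visible l p q -> visible l q x -> visible l p x ->
  s_ l (dist l q x) * sin (angle_at l q p x) = s_ l (dist l p x) * sin (angle_at l p q x).
Proof.
move=> hc ha hb; have hc' := visibleC hc.
have [_ _ s0] := hc; have [_ _ s1] := ha; have [_ _ s2] := hb.
rewrite (sin_angle_at hc' ha) (sin_angle_at hc hb); apply: (mulfI (lt0r_neq0 s0)).
rewrite !mulrA -{1}(gtr0_norm s0) -{2}(gtr0_norm s0) -(gtr0_norm s1) -(gtr0_norm s2).
rewrite -!normrM (sin_atE hc hb).
have := sin_atE hc' ha; rewrite [dist l q p]distC => ->.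
by rewrite -normrN -mulrN -det3_swap.
Qed.

(** Deleting the vertex [q] of a polygon replaces the sides [pq] and [qx] by [px] and
    decreases the angle at [p] by [angle_at l p q x]. The conclusion says that the exterior
    angle at [p] grows at least as much as the half chord angle of the side issued from [p]. *)
Lemma half_chord_triangle l K p q x :
  0 <= K -> chord_fits l K p q -> chord_fits l K q x -> chord_fits l K p x ->
  half_chord_angle l K p q + half_chord_angle l K q x + angle_at l q p x <= pi ->
  half_chord_angle l K p x <= half_chord_angle l K p q + angle_at l p q x.
Proof.
move=> K0 gc ga gb.
have [yc0 sc] := half_chord_angle_bounds K0 gc.
have [ya0 sa] := half_chord_angle_bounds K0 ga.
have [yb0 sb] := half_chord_angle_bounds K0 gb.
have [vc _] := gc; have [va _] := ga; have [vb _] := gb; have vc' := visibleC vc.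
have [hp hq _] := vc; have [_ hx _] := va.
have [c1 c2 c3] := half_dist_gt0 vc.
have [a1 a2 a3] := half_dist_gt0 va.
have [b1 b2 b3] := half_dist_gt0 vb.
have L1 := law_of_cosines vc' va.
have L2 := law_of_cosines vc vb.
have hls := law_of_sines vc va vb.
have B0 := angle_at_ge0 vc' va.
have al0 := angle_at_ge0 vc vb.
move=> hB; apply: (@half_chord_trig _ l K (s_ l (dist l q x / 2)) (s_ l (dist l p x / 2))
    (s_ l (dist l p q / 2)) (c_ l (dist l q x / 2)) (c_ l (dist l p x / 2))
    (c_ l (dist l p q / 2)) (half_chord_angle l K q x) (half_chord_angle l K p x)
    (half_chord_angle l K p q) (angle_at l q p x) (angle_at l p q x)
    K0 a1 b1 c1 a2 b2 c2 _ _ _ B0 al0 ya0 yb0 yc0 sa sb sc _ _ _ hB).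
- exact: c2_s2.
- exact: c2_s2.
- exact: c2_s2.
- rewrite -c3 -a3 [dist l p q]distC L1.
  rewrite (chord_dist hq hp) (chord_dist hq hx) (chord_dist hp hx) [dist l q p]distC.
  by move: (s_ _ _) (s_ _ _) (s_ _ _) => *; field.
- rewrite -c3 -b3 L2.
  rewrite (chord_dist hp hq) (chord_dist hq hx) (chord_dist hp hx).
  by move: (s_ _ _) (s_ _ _) (s_ _ _) => *; field.
- by rewrite -a3 -b3.
Qed.

End HalfChord.

(** * Deleting vertices of a polygon *)

(** The angles are generalized because [lra] would otherwise compare them by unfolding. *)
Ltac lra_atoms y ang :=
  repeat match goal with
  | |- context [y ?a ?b] => generalize (y a b)
  | |- context [ang ?a ?b ?c] => generalize (ang a b c)
  end; intros; lra.

Section DeleteVertices.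
Context {R : realType}.
Variables (l K e : R) (n : nat) (B : nat -> 'rV[R]_3).
Let y i j := half_chord_angle l K (B i) (B j).
Let ang i j k := angle_at l (B i) (B j) (B k).
Hypothesis K_ge0 : 0 <= K.
Hypothesis e_sign : e * e = 1.
Hypothesis B_periodic : forall i, B (i + n) = B i.
Hypothesis B_order : forall i j k, (i < j < k)%N -> (k < i + n)%N ->
  0 < e * det3 (B i) (B j) (B k).
Hypothesis B_fits : forall i j, (i < j < i + n)%N -> chord_fits l K (B i) (B j).
Hypothesis B_turn : forall i,
  y i i.+1 + y i.+1 i.+2 + ang i.+1 i i.+2 < pi.

Let B_order0 i j k : (i < j)%N -> (j <= k)%N -> (k < i + n)%N ->
  0 <= e * det3 (B i) (B j) (B k).
Proof.
move=> ij; rewrite leq_eqVlt => /orP[/eqP ->|jk] ki.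
  by rewrite det3pxx mulr0.
by rewrite ltW // B_order // ij.
Qed.

Lemma vertex_angleD i j k m : (i < j)%N -> (j <= k)%N -> (k <= m)%N ->
  (m < i + n)%N -> ang i j m = ang i j k + ang i k m.
Proof.
move=> ij jk km mi.
have hv k' : (j <= k')%N -> (k' <= m)%N -> visible l (B i) (B k').
  move=> jk' k'm.
  by have /B_fits[] : (i < k' < i + n)%N by rewrite (leq_trans ij jk') (leq_ltn_trans k'm mi).
have jm' := leq_trans jk km.
have [jm|jm] := ltnP j m; last first.
  have <- : j = m by apply/eqP; rewrite eqn_leq jm' jm.
  have <- : j = k by apply/eqP; rewrite eqn_leq jk (leq_trans km jm).
  by rewrite /ang (angle_at_refl (hv j _ _)) // addr0.
apply: (angle_atD e_sign).
- exact: hv.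
- exact: hv.
- exact: hv.
- by rewrite B_order0 // (leq_ltn_trans km mi).
- by rewrite B_order0 // (leq_trans ij jk).
- by rewrite B_order // ij.
Qed.

Let ang_ge0 i j k : (i < j < i + n)%N -> (i < k < i + n)%N -> 0 <= ang i j k.
Proof. by move=> /B_fits[hj _] /B_fits[hk _]; apply: angle_at_ge0. Qed.

Let angC i j k : ang i j k = ang i k j. Proof. exact: angle_atC. Qed.
Let yC i j : y i j = y j i. Proof. exact: half_chord_angleC. Qed.

(** Induction on the number of deleted vertices. The two conclusions, at both ends of the
    diagonal from [i] to [(i + m).+1], are needed together: the second one provides the
    hypothesis of [half_chord_triangle] at the next vertex to be deleted. *)
Lemma half_chord_chain i m : ((i + m).+1 < i + n)%N ->
  y i (i + m).+1 <= y i i.+1 + ang i i.+1 (i + m).+1 /\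
  y i (i + m).+1 <= y (i + m) (i + m).+1 + ang (i + m).+1 (i + m) i.
Proof.
elim: m => [|m IH] hm.
  rewrite addn0 in hm *; split; rewrite lerDl.
    by apply: ang_ge0; lia.
  have -> : ang i.+1 i i = ang i.+1 (i + n) (i + n) by rewrite /ang B_periodic.
  by apply: ang_ge0; lia.
have [|IH1 IH2] := IH; first by lia.
rewrite addnS in hm *; move: IH1 IH2 hm; set j := (i + m)%N => IH1 IH2 hm.
have ij : (i <= j)%N by rewrite /j; lia.
have gij : chord_fits l K (B i) (B j.+1) by apply: B_fits; lia.
have gj : chord_fits l K (B j.+1) (B j.+2) by apply: B_fits; lia.
have gij2 : chord_fits l K (B i) (B j.+2) by apply: B_fits; lia.
have split_j : ang j.+1 j.+2 j = ang j.+1 j.+2 i + ang j.+1 i j.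
  transitivity (ang j.+1 j.+2 (j + n)); first by rewrite /ang B_periodic.
  rewrite (@vertex_angleD _ _ (i + n)); [|lia..].
  by rewrite /ang !B_periodic.
have tri : y i j.+1 + y j.+1 j.+2 + ang j.+1 i j.+2 <= pi.
  have := B_turn j; rewrite [ang _ j _]angC split_j [ang _ i j.+2]angC [ang _ i j]angC.
  by clear split_j IH; move: IH1 IH2; lra_atoms y ang.
have split_i : ang i i.+1 j.+2 = ang i i.+1 j.+1 + ang i j.+1 j.+2.
  by apply: vertex_angleD; lia.
split.
  have : y i j.+2 <= y i j.+1 + ang i j.+1 j.+2 by apply: half_chord_triangle.
  by clear IH; move: IH1 IH2 split_i split_j tri; lra_atoms y ang.
have : y j.+2 i <= y j.+2 j.+1 + ang j.+2 j.+1 i.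
  refine (half_chord_triangle K_ge0 (chord_fitsC gj)
    (chord_fitsC gij) (chord_fitsC gij2) _).
  suff : y j.+2 j.+1 + y j.+1 i + ang j.+1 j.+2 i <= pi by [].
  clear IH; move: IH1 IH2 split_i split_j tri; rewrite (yC j.+2) (yC j.+1 i) (angC j.+1 i j.+2).
  by lra_atoms y ang.
by rewrite (yC j.+2 i) (yC j.+2).
Qed.

(** The turning condition at the vertex [i] of the triangle, possibly degenerate, that
    remains when all vertices but [i], [j] and [k] have been deleted. *)
Lemma half_chord_wedge i j k : (2 < n)%N -> (i < j)%N -> (j <= k)%N -> (k < i + n)%N ->
  y i j + y i k + ang i j k < pi.
Proof.
move=> n2 ij jk ki.
(* One diagonal cuts off the vertices from [i] to [j], the other those from [k] to [i + n]. *)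
have [m hm] : exists m, j = (i + m).+1 by exists (j - i.+1)%N; lia.
have [m' hm'] : exists m', (i + n)%N = (k + m').+1 by exists (i + n - k.+1)%N; lia.
have [h1 _] := @half_chord_chain i m ltac:(lia); rewrite -hm in h1.
have [_ h2] := @half_chord_chain k m' ltac:(lia).
rewrite -hm' in h2.
set q := (k + m')%N in hm' h2.
have h3 := B_turn q; rewrite -hm' in h3.
have eB : B (i + n).+1 = B i.+1 by rewrite -addSn B_periodic.
have hA : ang i i.+1 q = ang i i.+1 j + ang i j k + ang i k q.
  rewrite (@vertex_angleD i i.+1 k q); [|lia..].
  by rewrite (@vertex_angleD i i.+1 j k); [|lia..].
have e1 : y k (i + n) = y i k by rewrite yC /y B_periodic.
have e2 : ang (i + n) q k = ang i k q.
  rewrite angC /ang (B_periodic i); reflexivity.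
have e3 : y (i + n) (i + n).+1 = y i i.+1.
  rewrite /y eB (B_periodic i); reflexivity.
have e4 : ang (i + n) q (i + n).+1 = ang i i.+1 q.
  rewrite angC /ang eB (B_periodic i); reflexivity.
rewrite e1 e2 in h2; rewrite e3 e4 in h3.
by clear e1 e2 e3 e4; move: h1 h2 h3 hA; lra_atoms y ang.
Qed.

End DeleteVertices.

(** * Chords of a circle *)

Section Contact.
Context {R : realType}.
Implicit Types (l K e r : R) (p q x o : 'rV[R]_3).

Lemma tangent_cauchy l p u v : space_form l p -> tangent l p u -> tangent l p v ->
  form l u v ^+ 2 <= form l u u * form l v v.
Proof.
move=> hp hu hv; have := gram hp hu hv hu hv.
have := sqr_ge0 (orient l p u v); rewrite [form l v u]formC; lra.
Qed.

(** The sine formula for the sum and the Cauchy-Schwarz inequality in the tangent plane at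
    [o]. The hypothesis keeps the right hand side in the range where the chord is
    increasing. *)
Lemma dist_triangle l o p q : space_form l o -> space_form l p -> space_form l q ->
  (0 < l -> dist l o p + dist l o q <= pi / Num.sqrt l) ->
  dist l p q <= dist l o p + dist l o q.
Proof.
move=> ho hp hq hl; rewrite dist_le //; last by rewrite addr_ge0 ?dist_ge0.
have h := tangent_cauchy ho (tangent_radial ho hp) (tangent_radial ho hq).
rewrite (form_radial_radial ho hp) (form_radial_radial ho hq) -exprMn in h.
have h0 : 0 <= s_ l (dist l o p) * s_ l (dist l o q) by rewrite mulr_ge0 ?s_dist_ge0.
have {h} : - (s_ l (dist l o p) * s_ l (dist l o q)) <= form l (radial l o p) (radial l o q).
  rewrite lerNl; apply: le_trans (ler_norm _) _; rewrite normrN.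
  by rewrite -(@ler_pXn2r _ 2) ?nnegrE // -normrX ger0_norm ?sqr_ge0.
rewrite form_radial // [chord l o p]chord_dist // [chord l o q]chord_dist //.
have -> : (dist l o p + dist l o q) / 2 = dist l o p / 2 + dist l o q / 2 by rewrite mulrDl.
rewrite s_D (s_half l (dist l o p)) (s_half l (dist l o q)).
have := c2_s2 l (dist l o p / 2); have := c2_s2 l (dist l o q / 2).
move: (s_ l (dist l o p / 2)) (s_ l (dist l o q / 2))
  (c_ l (dist l o p / 2)) (c_ l (dist l o q / 2)) (chord _ _ _) => a b c d S e1 e2 h {h0}.
have -> : 4 * (a * d + c * b) ^+ 2 = 4 * a ^+ 2 * d ^+ 2 + 4 * c ^+ 2 * b ^+ 2 + 8 * a * b * c * d by ring.
have -> : d ^+ 2 = 1 - l * b ^+ 2 by rewrite -e1; ring.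
have -> : c ^+ 2 = 1 - l * a ^+ 2 by rewrite -e2; ring.
lra.
Qed.

Lemma visible_neq l p q : space_form l p -> space_form l q ->
  p != q -> not_antipodal l p q -> visible l p q.
Proof. by move=> hp hq hpq hn; split=> //; apply: s_dist_gt0. Qed.

(** By the triangle inequality through the centre, half the distance is at most [r], and
    [ta_ l] is increasing: the difference of the two sides is a positive multiple of
    [s_ l (r - d / 2)]. *)
Lemma chord_fits_disk l r o p q : space_form l o -> visible l p q ->
  0 < s_ l r -> 0 <= r -> (0 < l -> r <= pi / Num.sqrt l / 2) ->
  dist l o p <= r -> dist l o q <= r -> chord_fits l (c_ l r / s_ l r) p q.
Proof.
move=> ho hv sr r0 hr dp dq; split=> //; have [hp hq sd] := hv.
have [t0 k0 _] := half_dist_gt0 hv.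
have d2 : dist l p q / 2 <= r.
  have h : dist l p q <= dist l o p + dist l o q.
    by apply: dist_triangle => // hl; have := hr hl; lra.
  lra.
have h : 0 <= s_ l (r - dist l p q / 2).
  have [->|hne] := eqVneq r (dist l p q / 2); first by rewrite subrr s_0.
  apply/ltW/s_gt0 => [|hl]; first by rewrite subr_gt0 lt_neqAle d2 eq_sym hne.
  have d0 := dist_ge0 hp hq.
  have := hr hl; have : 0 < pi / Num.sqrt l by rewrite divr_gt0 ?pi_gt0 ?sqrtr_gt0.
  by lra.
rewrite /ta_ mulf_div ler_pdivrMr ?mulr_gt0 // mul1r -subr_ge0.
by rewrite s_B in h.
Qed.

(** The law of cosines in an isosceles triangle. *)
Lemma cos_contact l r o p q : space_form l o -> visible l p q ->
  0 < s_ l r -> dist l o p = r -> dist l o q = r ->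
  cos (angle_at l p o q) = c_ l r / s_ l r * ta_ l (dist l p q / 2).
Proof.
move=> ho hv sr dp dq; have [hp hq sd] := hv.
have [t0 k0 e] := half_dist_gt0 hv.
have hvo : visible l p o by split=> //; rewrite distC dp.
have := law_of_cosines hvo hv; rewrite [dist l p o]distC dp.
have -> : (chord l p o + chord l p q - chord l o q) / 2 - l * (chord l p o * chord l p q) / 4
   = chord l p q / 2 * (1 - l * chord l o p / 2).
  rewrite [chord l p o]chordC (chord_dist ho hp) (chord_dist ho hq) dp dq.
  by move: (s_ _ _) (chord _ _ _) => a b; field.
rewrite -c_dist // dp chord_dist // {1}e /ta_.
move: (s_ l r) sr => s sr; move: (s_ _ _) (c_ l r) (c_ _ _) t0 k0 => t c k t0 k0 h.
have hn : s * (2 * t * k) != 0 by rewrite gt_eqF // !mulr_gt0.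
apply: (mulfI hn); rewrite h; field.
by rewrite !gt_eqF.
Qed.

Lemma angle_contact l r o p q : space_form l o ->
  0 <= c_ l r -> 0 < s_ l r -> chord_fits l (c_ l r / s_ l r) p q ->
  dist l o p = r -> dist l o q = r ->
  angle_at l p o q = pi / 2 - half_chord_angle l (c_ l r / s_ l r) p q.
Proof.
move=> ho cr sr g dp dq; have [hv hK] := g; have [hp hq sd] := hv.
have K0 : 0 <= c_ l r / s_ l r by rewrite divr_ge0 // ltW.
have [/andP[b0 b1] b2] := half_chord_angle_bounds K0 g.
have hvo : visible l p o by split=> //; rewrite distC dp.
have p0 := @pi_gt0 R.
apply: cos_inj; rewrite ?in_itv /=.
- by rewrite angle_at_ge0 // angle_at_lepi.
- by apply/andP; split; lra.
- by rewrite (cos_contact ho hv sr dp dq) cosB cos_pihalf sin_pihalf mul0r add0r mul1r b2.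
Qed.

(** Two points of the circle aligned with its centre [o] are opposite to each other, so that
    half their distance is [r] and [K * ta_ l r = 1]. *)
Lemma diametral_angle l r o p q : space_form l o ->
  0 <= c_ l r -> 0 < s_ l r -> chord_fits l (c_ l r / s_ l r) p q ->
  dist l o p = r -> dist l o q = r -> det3 o p q = 0 ->
  half_chord_angle l (c_ l r / s_ l r) p q = pi / 2.
Proof.
move=> ho cr sr g dp dq hdet; have [hv hK] := g; have [hp hq sd] := hv.
have [t0 k0 _] := half_dist_gt0 hv.
have h1 := gram ho (tangent_radial ho hp) (tangent_radial ho hq)
  (tangent_radial ho hp) (tangent_radial ho hq).
have h2 := form_radial ho hp hq.
have h3 := form_radial_radial ho hp.
rewrite orient_radial hdet !mulr0 h3 (form_radial_radial ho hq) dp dq in h1.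
rewrite [form l (radial l o q) _]formC in h1.
have h4 := form_radial ho hp hp; rewrite h3 chordxx dp in h4.
have eS : chord l o q = chord l o p by rewrite (chord_dist ho hq) (chord_dist ho hp) dp dq.
rewrite eS in h2.
have c0 : 0 < chord l p q by rewrite chord_dist // mulr_gt0 // exprn_gt0.
have h5 : form l (radial l o p) (radial l o q) = s_ l r ^+ 2 - chord l p q / 2.
  by rewrite h2 h4; field.
rewrite h5 in h1.
have h6 : chord l p q * (chord l p q - 4 * s_ l r ^+ 2) = 0 by clear -h1; lra.
move/eqP: h6; rewrite mulf_eq0 (gt_eqF c0) /= subr_eq0 chord_dist // => /eqP h6.
have h7 : s_ l (dist l p q / 2) = s_ l r.
  by apply/eqP; rewrite -(@eqrXn2 _ 2) ?(ltW t0) ?(ltW sr) //; apply/eqP; clear -h6; lra.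
have h8 : c_ l (dist l p q / 2) = c_ l r.
  apply/eqP; rewrite -(@eqrXn2 _ 2) ?(ltW k0) //; apply/eqP.
  by have := c2_s2 l r; have := c2_s2 l (dist l p q / 2); rewrite h7; clear; lra.
have e1 : c_ l r / s_ l r * (s_ l r / c_ l r) = 1.
  by rewrite mulf_div [s_ l r * _]mulrC divff // gt_eqF // mulr_gt0 // -h8.
rewrite half_chord_angle.unlock /ta_ h7 h8 e1.
transitivity (asin (sin (pi / 2 : R))); first by rewrite sin_pihalf.
by apply: sinK; rewrite in_itv /=; have := @pi_gt0 R; move=> p0; apply/andP; split; lra.
Qed.

(** At the contact vertex [i], the centre lies in the wedge spanned by the contact vertices
    [j] and [k], so that the angle of this wedge is [(pi / 2 - y_ij) + (pi / 2 - y_ik)],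
    against [half_chord_wedge]. That the wedge is convex, and [j] comes before [k] in the
    cyclic order, follows from the fact that this sum is at most [pi]. *)
Lemma contact_wedge_false l e r n (B : nat -> 'rV[R]_3) o i j k :
  let K := c_ l r / s_ l r in
  e * e = 1 -> 0 <= c_ l r -> 0 < s_ l r -> space_form l o ->
  (forall i j k, (i < j < k)%N -> (k < i + n)%N -> 0 < e * det3 (B i) (B j) (B k)) ->
  (forall i j, (i < j < i + n)%N -> chord_fits l K (B i) (B j)) ->
  (forall i j k, (i < j)%N -> (j <= k)%N -> (k < i + n)%N ->
    half_chord_angle l K (B i) (B j) + half_chord_angle l K (B i) (B k) +
    angle_at l (B i) (B j) (B k) < pi) ->
  (i < j < i + n)%N -> (i < k < i + n)%N ->
  dist l o (B i) = r -> dist l o (B j) = r -> dist l o (B k) = r ->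
  0 <= e * det3 o (B i) (B j) -> e * det3 o (B i) (B k) <= 0 -> False.
Proof.
move=> K he cr sr ho hord hgood hw hj hk di dj dk.
have K0 : 0 <= K by rewrite divr_ge0 // ltW.
have hne m : (i < m < i + n)%N -> dist l o (B m) = r -> e * det3 o (B i) (B m) != 0.
  move=> hm dm; apply/eqP => /eqP.
  have e0 : e != 0 by apply: contra_eq_neq he => ->; rewrite mul0r eq_sym oner_neq0.
  rewrite mulf_eq0 (negbTE e0) /= => /eqP hd.
  have hpi := diametral_angle ho cr sr (hgood _ _ hm) di dm hd.
  have /andP[im mi] := hm.
  have := hw i m m im (leqnn m) mi; rewrite hpi.
  by rewrite (angle_at_refl (hgood _ _ hm).1) addr0 -splitr ltxx.
rewrite le_eqVlt eq_sym (negbTE (hne j hj dj)) /= => pj.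
rewrite le_eqVlt (negbTE (hne k hk dk)) /= => pk.
have gj := hgood _ _ hj; have gk := hgood _ _ hk.
have [vj _] := gj; have [vk _] := gk; have [hBi _ _] := vj.
have vo : visible l (B i) o by split=> //; rewrite distC di.
have aj := angle_contact ho cr sr gj di dj.
have ak := angle_contact ho cr sr gk di dk.
have oj : 0 < e * det3 (B i) (B j) o by rewrite -det3_rot.
have ok : 0 < e * det3 (B i) o (B k) by rewrite det3_swap mulrN oppr_gt0.
have [bj _] := half_chord_angle_bounds K0 gj.
have [bk _] := half_chord_angle_bounds K0 gk.
have SS : 0 <= e * det3 (B i) (B j) (B k).
  rewrite -(sin_at_ge0 e vj vk) -(sin_angle_atD he vj vo vk (ltW oj) (ltW ok)).
  rewrite angle_atC aj ak -/K sin_ge0_pi //.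
  move: bj bk; move: (half_chord_angle _ _ _ _) (half_chord_angle _ _ _ _).
  by move=> a b /andP[? ?] /andP[? ?]; apply/andP; split; lra.
have /andP[ij ji] := hj; have /andP[ik ki] := hk.
have [jk|kj|jk] := ltngtP j k.
- have := hw i j k ij (ltnW jk) ki.
  have hjk : 0 < e * det3 (B i) (B j) (B k) by apply: hord => //; rewrite ij.
  rewrite (angle_atD he vj vo vk (ltW oj) (ltW ok) hjk) [angle_at _ _ _ o]angle_atC aj ak -/K.
  by move: (half_chord_angle _ _ _ _) (half_chord_angle _ _ _ _) => a b; lra.
- have := hord i k j; rewrite ik kj => /(_ isT ji).
  by rewrite det3_rot det3_swap -det3_rot mulrN oppr_gt0 ltNge SS.
- by move: pk; rewrite -jk ltNge (ltW pj).
Qed.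

End Contact.

(** * Supporting lines of convex sets *)

Section Support.
Context {R : realType}.
Implicit Types (l e : R) (p q x y z m u v w : 'rV[R]_3) (D : set 'rV[R]_3).

(** The rotation of [u] by a quarter turn, namely the cross product of [p] and [u] for the
    ambient form. *)
Lemma exists_normal l p u : space_form l p -> unit_tangent l p u ->
  exists w, [/\ unit_tangent l p w, form l u w = 0 &
    forall x, tangent l p x -> form l w x = orient l p u x].
Proof.
move=> hp [tu eu]; set k := area_scale l.
pose w : 'rV[R]_3 := \row_i [:: Num.sg l * k * (p 0 1 * u 0 2 - p 0 2 * u 0 1);
   k * (p 0 2 * u 0 0 - p 0 0 * u 0 2); k * (p 0 0 * u 0 1 - p 0 1 * u 0 0)]`_i.
have w0 : w 0 0 = Num.sg l * k * (p 0 1 * u 0 2 - p 0 2 * u 0 1) by rewrite mxE.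
have w1 : w 0 1 = k * (p 0 2 * u 0 0 - p 0 0 * u 0 2) by rewrite mxE.
have w2 : w 0 2 = k * (p 0 0 * u 0 1 - p 0 1 * u 0 0) by rewrite mxE.
have E x : (l == 0 -> x 0 0 = 0) -> form l w x = orient l p u x.
  rewrite /form /orient -/k w0 w1 w2 /det3 => hx.
  have [l0|l0] := eqVneq l 0.
    by rewrite hx ?l0 ?eqxx // !mulr0; ring.
  have hsg : Num.sg l * Num.sg l = 1 by rewrite -expr2 sqr_sg l0.
  transitivity (Num.sg l * Num.sg l * k * (p 0 1 * u 0 2 - p 0 2 * u 0 1) * x 0 0
    + k * (p 0 2 * u 0 0 - p 0 0 * u 0 2) * x 0 1 + k * (p 0 0 * u 0 1 - p 0 1 * u 0 0) * x 0 2).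
    by ring.
  by rewrite hsg; ring.
have Et x : tangent l p x -> form l w x = orient l p u x.
  by move=> hx; apply: E => l0; move: hx; rewrite /tangent l0.
have tw : tangent l p w.
  rewrite /tangent; case: eqVneq => [l0|l0]; first by rewrite w0 l0 sgr0 !mul0r.
  rewrite formC E /orient ?det3pxp ?mulr0 // => l0'.
  by rewrite l0' in l0.
exists w; split=> //; last by rewrite formC Et // /orient det3pxx mulr0.
have huw : form l u w = 0 by rewrite formC Et // /orient det3pxx mulr0.
split=> //; have := gram hp tu tw tu tw.
rewrite -(Et w tw) eu huw mul0r subr0 mul1r.
(* By [gram], [form l w w] is 0 or 1. The value 0 is excluded by expanding it
   in coordinates. *)
move=> h; have : form l w w * (form l w w - 1) = 0 by rewrite mulrBr h; ring.
move/eqP; rewrite mulf_eq0 subr_eq0 => /orP[/eqP hw|/eqP //].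
exfalso; have [l0|l0] := eqVneq l 0.
  move: hp hw tu eu; rewrite /form /tangent /area_scale w0 w1 w2 /k /area_scale l0 eqxx sgr0.
  move=> /space_form0 -> h0 hu h1; move: h0 h1; rewrite hu; lra.
have hsg : Num.sg l * Num.sg l = 1 by rewrite -expr2 sqr_sg l0.
have hk : k ^+ 2 = l * Num.sg l.
  by rewrite /k /area_scale (negbTE l0) sqrt_sqr_norm normrEsg mulrC.
have : form l w w = k ^+ 2 * Num.sg l * (form l p p * form l u u - form l p u ^+ 2).
  rewrite /form w0 w1 w2.
  have -> : Num.sg l * (Num.sg l * k * (p 0 1 * u 0 2 - p 0 2 * u 0 1) *
     (Num.sg l * k * (p 0 1 * u 0 2 - p 0 2 * u 0 1))) =
     (Num.sg l * Num.sg l) * Num.sg l * k ^+ 2 * (p 0 1 * u 0 2 - p 0 2 * u 0 1) ^+ 2 by ring.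
  rewrite hsg.
  transitivity (k ^+ 2 * (Num.sg l * (p 0 1 * u 0 2 - p 0 2 * u 0 1) ^+ 2 +
    (Num.sg l * Num.sg l) * ((p 0 2 * u 0 0 - p 0 0 * u 0 2) ^+ 2 + (p 0 0 * u 0 1 - p 0 1 * u 0 0) ^+ 2))).
    by rewrite hsg; ring.
  by gen_coords p; gen_coords u; ring.
have -> : form l p u = 0 by move: tu; rewrite /tangent (negbTE l0).
rewrite hw eu (space_form_form l0 hp) hk.
have -> : l * Num.sg l * Num.sg l * (l^-1 * 1 - 0 ^+ 2) = l * l^-1 * (Num.sg l * Num.sg l) by ring.
rewrite hsg divff // mulr1 => /esym/eqP; rewrite oner_eq0; by [].
Qed.

Lemma normal_det3_neq0 l p q w : unit_tangent l p w ->
  (forall x, tangent l p x -> form l w x = orient l p (direction l p q) x) ->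
  det3 p q w != 0.
Proof.
move=> [tw ew] hw; apply/eqP => h0; have := hw w tw.
by rewrite ew /orient det3_direction h0 !mulr0 => /eqP; rewrite oner_eq0.
Qed.

Lemma det3_eq0_comb l p q x : visible l p q -> det3 p q x = 0 ->
  exists a b, x = a *: p + b *: q.
Proof.
move=> hv h0; have [hp _ _] := hv.
have [w [uw _ /(normal_det3_neq0 uw) hw]] := exists_normal hp (unit_visible hv).
exists (det3 x q w / det3 p q w), (det3 p x w / det3 p q w).
apply: (scalerI hw); rewrite det3_cramer h0 scale0r addr0 scalerDr !scalerA.
by rewrite ![det3 p q w * _]mulrC !divfK.
Qed.

Lemma continuous_det3 u v : continuous (fun z : 'rV[R]_3 => det3 z u v).
Proof.
move=> z; rewrite /det3.
have h (i : 'I_3) (k : R) : (fun y : 'rV[R]_3 => y 0 i * k) @ z --> (z 0 i * k).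
  by apply: (@cvgMl _ _ (nbhs z)); exact: coord_continuous.
have h1 : (fun y : 'rV[R]_3 => y 0 0 * (u 0 1 * v 0 2 - u 0 2 * v 0 1) -
    y 0 1 * (u 0 0 * v 0 2 - u 0 2 * v 0 0)) @ z -->
    z 0 0 * (u 0 1 * v 0 2 - u 0 2 * v 0 1) - z 0 1 * (u 0 0 * v 0 2 - u 0 2 * v 0 0).
  by apply: (@cvgB _ _ _ (nbhs z)); exact: h.
by apply: (@cvgD _ _ _ (nbhs z)); [exact: h1 | exact: h].
Qed.

Lemma near_det3_sign m u v (k : R) : 0 < k * det3 m u v -> \forall z \near m, 0 < k * det3 z u v.
Proof.
move=> h.
have hc : (k * det3 z u v) @[z --> m] --> k * det3 m u v.
  by apply: (@cvgMr _ _ (nbhs m)); exact: continuous_det3.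
exact: (cvgr_gt _ hc).
Qed.

Lemma not_boundary l D m : (\forall z \near m, space_form l z -> D z) -> ~ boundary l D m.
Proof.
move=> hn [_ hcl]; have [z [[hz hnD] hD]] := hcl _ hn.
exact/hnD/hD.
Qed.

(** A point [z] whose barycentric coordinates with respect to [p], [q], [x] are nonnegative
    is reached in two steps, through a point of the segment [p q]. The first two coordinates
    are taken positive in order to have that intermediate point. *)
Lemma triangle_in_convex l D p q x z : D `<=` space_form l -> geod_convex l D ->
  D p -> D q -> D x -> not_antipodal l p q -> det3 p q x != 0 -> space_form l z ->
  0 < det3 p q x * det3 z q x -> 0 < det3 p q x * det3 p z x -> 0 <= det3 p q x * det3 p q z ->
  D z.
Proof.
move=> hD hc Dp Dq Dx hn hd hz h1 h2 h3.
set d := det3 p q x in hd h1 h2 h3.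
set a := d * det3 z q x / d ^+ 2; set b := d * det3 p z x / d ^+ 2.
set c := d * det3 p q z / d ^+ 2.
have d2 : 0 < d ^+ 2 by rewrite exprn_even_gt0.
have a0 : 0 < a by rewrite divr_gt0.
have b0 : 0 < b by rewrite divr_gt0.
have c0 : 0 <= c by rewrite divr_ge0 // ltW.
have ez : z = a *: p + b *: q + c *: x.
  apply: (scalerI hd); rewrite det3_cramer -/d !scalerDr !scalerA /a /b /c.
  by congr (_ *: _ + _ *: _ + _ *: _); field.
have [T T0 hm] := normalize_comb (hD _ Dp) (hD _ Dq) hn (ltW a0) (ltW b0) (addr_gt0 a0 b0).
set m := _ + _ in hm.
have Dm : D m.
  by apply: (convex_comb hD hc Dp Dq hn _ _ hm); rewrite divr_ge0 // ltW.
have ez2 : z = T *: m + c *: x.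
  rewrite ez /m scalerDr !scalerA.
  by congr (_ *: _ + _ *: _ + _); field; rewrite gt_eqF.
have hnm : not_antipodal l m x.
  apply: contrapT => hna; have ex := antipodal_opp hm (hD _ Dx) hna.
  move/eqP: hd; apply; rewrite /d ex /m.
  have -> : - (a / T *: p + b / T *: q) = (- (a / T)) *: p + (- (b / T)) *: q.
    by rewrite opprD !scaleNr.
  by rewrite det3_lin det3pxp det3pxx !mulr0 addr0.
by rewrite ez2; apply: (convex_comb hD hc Dm Dx hnm (ltW T0) c0); rewrite -ez2.
Qed.

(** If the region had points [x] and [y] strictly on both sides of the line, the triangles
    [p q x] and [p q y] would form a neighbourhood of the midpoint of [p q], which could not
    be a boundary point. *)
Lemma boundary_segment_support l D p q x y : D `<=` space_form l -> geod_convex l D ->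
  D p -> D q -> D x -> D y -> visible l p q -> not_antipodal l p q ->
  segment l p q `<=` boundary l D -> 0 < det3 p q x -> det3 p q y < 0 -> False.
Proof.
move=> hD hc Dp Dq Dx Dy hv hn hb hx hy.
have hp := hD _ Dp; have hq := hD _ Dq.
(* [m] is the midpoint of the segment. *)
have [T T0 hm] := normalize_comb hp hq hn ler01 ler01 (ltr0Sn _ 1).
set m := _ + _ in hm.
have hpq : p != q.
  by apply: contraTneq hx => ->; rewrite det3ppx ltxx.
have i0 : 0 <= 1 / T by rewrite divr_ge0 // ltW.
have mb := hb _ (comb_segment hp hq hpq hn i0 i0 hm).
apply: (not_boundary _ mb).
have pos w k : 0 < k * det3 p q w -> 0 < k * det3 m q w /\ 0 < - k * det3 m p w.
  move=> hw; have i1 : 0 < 1 / T by rewrite divr_gt0.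
  have -> : det3 m q w = 1 / T * det3 p q w.
    rewrite /m /det3 !mxE; gen_coords p; gen_coords q; gen_coords w; move: (1 / T) => ?.
    by ring.
  have -> : det3 m p w = - (1 / T * det3 p q w).
    rewrite /m /det3 !mxE; gen_coords p; gen_coords q; gen_coords w; move: (1 / T) => ?.
    by ring.
  rewrite mulrNN; have h1 : 0 < k * (1 / T * det3 p q w) by rewrite mulrCA mulr_gt0.
  by split.
have hx2 : 0 < det3 p q x * det3 p q x by rewrite mulr_gt0.
have hy2 : 0 < det3 p q y * det3 p q y by rewrite nmulr_rgt0.
have [x1 x2] := pos x _ hx2; have [y1 y2] := pos y _ hy2.
have n1 := near_det3_sign x1; have n2 := near_det3_sign x2.
have n3 := near_det3_sign y1; have n4 := near_det3_sign y2.
near=> z => hz.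
have s w : det3 p z w = - det3 z p w by rewrite det3_swap.
have [hs|hs] := leP 0 (det3 p q z).
- apply: (triangle_in_convex hD hc Dp Dq Dx hn _ hz); first by rewrite gt_eqF.
  + by near: z.
  + by rewrite s mulrN -mulNr; near: z.
  + by rewrite mulr_ge0 // ltW.
- apply: (triangle_in_convex hD hc Dp Dq Dy hn _ hz); first by rewrite lt_eqF.
  + by near: z.
  + by rewrite s mulrN -mulNr; near: z.
  + by rewrite ltW // nmulr_rgt0.
Unshelve. all: by end_near.
Qed.

End Support.

(** * Cyclic order of the vertices *)

Section PolygonOrder.
Context {R : realType}.
Variables (l : R) (D : set 'rV[R]_3) (n : nat) (B : nat -> 'rV[R]_3).
Hypothesis n_gt2 : (2 < n)%N.
Hypothesis D_sub : D `<=` space_form l.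
Hypothesis D_convex : geod_convex l D.
Hypothesis B_periodic : forall i, B (i + n) = B i.
Hypothesis B_in : forall i, D (B i).
Hypothesis B_neq : forall i j, (i < j < i + n)%N -> B i != B j.
Hypothesis B_side : forall i, not_antipodal l (B i) (B i.+1).
Hypothesis B_boundary : forall i, segment l (B i) (B i.+1) `<=` boundary l D.
Hypothesis B_simple : forall i j, (i < j < i + n)%N -> forall x,
  segment l (B i) (B i.+1) x -> segment l (B j) (B j.+1) x -> x = B i \/ x = B i.+1.
Hypothesis B_angle : forall i, angle_at l (B i.+1) (B i) (B i.+2) < pi.

Let B_sf i : space_form l (B i). Proof. exact/D_sub. Qed.

Let B_next i : B i != B i.+1.
Proof. by apply: B_neq; lia. Qed.

Let B_visible i : visible l (B i) (B i.+1).
Proof. exact: visible_neq. Qed.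

Let side_comb i a b : 0 <= a -> 0 <= b -> space_form l (a *: B i + b *: B i.+1) ->
  segment l (B i) (B i.+1) (a *: B i + b *: B i.+1).
Proof. exact: comb_segment. Qed.

Let side_start i : segment l (B i) (B i.+1) (B i).
Proof.
have -> : segment l (B i) (B i.+1) (B i) =
    segment l (B i) (B i.+1) (1 *: B i + 0 *: B i.+1) by rewrite scale1r scale0r addr0.
by apply: side_comb; rewrite ?ler01 // scale1r scale0r addr0.
Qed.

Let side_end i : segment l (B i) (B i.+1) (B i.+1).
Proof.
have -> : segment l (B i) (B i.+1) (B i.+1) =
    segment l (B i) (B i.+1) (0 *: B i + 1 *: B i.+1) by rewrite scale1r scale0r add0r.
by apply: side_comb; rewrite ?ler01 // scale1r scale0r add0r.
Qed.

(** If two consecutive sides were aligned, they would point in the same direction, as the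
    angle is not [pi]. Then the shorter one would be contained in the longer one, against
    the fact that sides meet only at vertices. *)
Lemma consecutive_det_neq0 i : det3 (B i) (B i.+1) (B i.+2) != 0.
Proof.
apply/eqP => hdet.
have vq := visibleC (B_visible i); have vx := B_visible i.+1.
have hd : det3 (B i.+1) (B i) (B i.+2) = 0 by rewrite det3_swap hdet oppr0.
have [a [b ex]] := det3_eq0_comb vq hd.
have h0 : sin (angle_at l (B i.+1) (B i) (B i.+2)) = 0.
  rewrite (sin_angle_at vq vx); apply/normr0P/eqP.
  have [_ _ s1] := vq; have [_ _ s2] := vx.
  apply: (mulfI (lt0r_neq0 (mulr_gt0 s1 s2))).
  by rewrite (sin_atE vq vx) hd !mulr0.
have ha : angle_at l (B i.+1) (B i) (B i.+2) = 0.
  have := angle_at_ge0 vq vx; rewrite le_eqVlt => /orP[/eqP <-//|hgt].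
  have : 0 < sin (angle_at l (B i.+1) (B i) (B i.+2)) by rewrite sin_gt0_pi // hgt B_angle.
  by rewrite h0 ltxx.
have hx : space_form l (a *: B i.+1 + b *: B i) by rewrite -ex.
have hb : 0 < b.
  have [hp hq s1] := vq; have [_ hx' s2] := vx.
  have := law_of_cosines vq vx; rewrite ha cos0 mulr1 -(form_radial hp hq hx').
  rewrite ex (radial_comb hp hq hx) -ex formC formZ (form_radial_radial hp hq) => h.
  have := mulr_gt0 s1 s2; rewrite h pmulr_lgt0 // exprn_gt0 //.
have neq02 : B i != B i.+2 by apply: B_neq; lia.
have neq12 : B i.+1 != B i.+2 by apply: B_neq; lia.
have [a0|a0] := leP 0 a.
  have hs : segment l (B i) (B i.+1) (B i.+2).
    rewrite ex addrC; apply: side_comb => //; first exact: ltW.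
    by rewrite addrC.
  have ii : (i < i.+1 < i + n)%N by lia.
  have [e|e] := B_simple ii hs (side_end i.+1).
    by rewrite e eqxx in neq02.
  by rewrite e eqxx in neq12.
have eB : B i = (- a / b) *: B i.+1 + b^-1 *: B i.+2.
  rewrite ex scalerDr !scalerA mulVf ?gt_eqF // scale1r addrA -scalerDl.
  by rewrite mulNr [b^-1 * a]mulrC addNr scale0r add0r.
have hs : segment l (B i.+1) (B i.+2) (B i).
  rewrite eB; apply: side_comb; rewrite -?eB //; last by rewrite invr_ge0 ltW.
  by rewrite divr_ge0 ?ltW // oppr_gt0.
have hs2 : segment l (B (i + n)) (B (i + n).+1) (B i).
  by rewrite -[X in segment _ _ _ X]B_periodic; exact: side_start.
have ii : (i.+1 < i + n < i.+1 + n)%N by lia.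
have [e|e] := B_simple ii hs hs2.
  by move: (B_next i); rewrite -e eqxx.
by rewrite e eqxx in neq02.
Qed.

Lemma side_not_separating i x y : D x -> D y ->
  0 <= det3 (B i) (B i.+1) x * det3 (B i) (B i.+1) y.
Proof.
move=> Dx Dy.
have H u v := @boundary_segment_support _ l D (B i) (B i.+1) u v
  D_sub D_convex (B_in i) (B_in i.+1).
rewrite leNgt; apply/negP.
have [hx|hx|<-] := ltgtP 0 (det3 (B i) (B i.+1) x); last by rewrite mul0r ltxx.
  by rewrite pmulr_rlt0 // => hy; apply: (H x y).
by rewrite nmulr_rlt0 // => hy; apply: (H y x).
Qed.

(** The polygon always turns in the same direction, because the vertices [i] and [i.+3] lie
    on the same side of the line through [i.+1] and [i.+2]. *)
Lemma exists_orientation : exists2 e : R, e * e = 1 &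
  forall i, 0 < e * det3 (B i) (B i.+1) (B i.+2).
Proof.
have step e i : e * e = 1 -> 0 < e * det3 (B i) (B i.+1) (B i.+2) ->
    0 < e * det3 (B i.+1) (B i.+2) (B i.+3).
  move=> he h; have := side_not_separating i.+1 (B_in i) (B_in i.+3).
  rewrite -det3_rot => hp; rewrite -(pmulr_rgt0 _ h) mulrACA he mul1r.
  rewrite lt_neqAle hp andbT eq_sym mulf_neq0 //; exact: consecutive_det_neq0.
have [h|h|h] := ltgtP 0 (det3 (B 0%N) (B 1%N) (B 2%N)).
- exists 1; first by rewrite mulr1.
  by elim=> [|i IH]; [rewrite mul1r | apply: step => //; rewrite mulr1].
- exists (-1); first by rewrite mulrNN mulr1.
  by elim=> [|i IH]; [rewrite mulN1r oppr_gt0 | apply: step => //; rewrite mulrNN mulr1].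
- by have := consecutive_det_neq0 0%N; rewrite -h eqxx.
Qed.

Variable e : R.
Hypothesis e_sign : e * e = 1.
Hypothesis e_turn : forall i, 0 < e * det3 (B i) (B i.+1) (B i.+2).

Lemma side_support i x : D x -> 0 <= e * det3 (B i) (B i.+1) x.
Proof.
move=> Dx; rewrite -(pmulr_rge0 _ (e_turn i)) mulrACA e_sign mul1r.
exact: side_not_separating.
Qed.

(** A vertex on the line of a side is on the correct side of the two adjacent side lines,
    hence in the side itself, against simplicity. *)
Lemma side_support_strict i j : (i.+1 < j < i + n)%N -> 0 < e * det3 (B i) (B i.+1) (B j).
Proof.
move=> /andP[ij ji]; rewrite lt_neqAle side_support // andbT eq_sym.
have e0 : e != 0 by apply: contra_eq_neq e_sign => ->; rewrite mul0r eq_sym oner_neq0.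
rewrite mulf_neq0 //; apply/eqP => hd.
have [a [b ex]] := det3_eq0_comb (B_visible i) hd.
have a0 : 0 <= a.
  have := side_support i.+1 (B_in j).
  rewrite ex addrC det3_lin det3pxp mulr0 add0r -det3_rot mulrCA.
  by rewrite pmulr_lge0 ?e_turn.
have b0 : 0 <= b.
  have := side_support (i + n).-1 (B_in j).
  have -> : ((i + n).-1.+1 = i + n)%N by lia.
  rewrite B_periodic ex det3_lin det3pxx mulr0 add0r mulrCA.
  have := e_turn (i + n).-1.
  have -> : ((i + n).-1.+1 = i + n)%N by lia.
  by rewrite -addSn !B_periodic => h; rewrite pmulr_lge0.
have hs : segment l (B i) (B i.+1) (B j).
  by rewrite ex; apply: side_comb => //; rewrite -ex.
have ii : (i < j < i + n)%N by lia.
have [h|h] := B_simple ii hs (side_start j).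
  by move: (B_neq ii); rewrite h eqxx.
have : B i.+1 != B j by apply: B_neq; lia.
by rewrite h eqxx.
Qed.

(** The three-term relation between the minors with first column [p]; positive terms on the
    right give a positive term on the left. *)
Lemma det3_plucker p q u v w :
  det3 p u w * det3 p q v = det3 p u v * det3 p q w + det3 p v w * det3 p q u :> R.
Proof.
by rewrite /det3; gen_coords p; gen_coords q; gen_coords u; gen_coords v; gen_coords w; ring.
Qed.

(** Induction on [k]: both [j] and [k.+1] are compared with [k] as seen from [i], and
    [det3_plucker] with the side starting at [i] makes positivity transitive. *)
Lemma polygon_order i j k : (i < j < k)%N -> (k < i + n)%N -> 0 < e * det3 (B i) (B j) (B k).
Proof.
move=> /andP[ij]; elim: k => // k IH; rewrite ltnS leq_eqVlt => /orP[/eqP <-|jk] ki.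
  rewrite det3_rot -(B_periodic i); apply: side_support_strict; lia.
have {}IH := IH jk (ltnW ki).
move: ij; rewrite leq_eqVlt => /orP[/eqP ej|ij].
  by rewrite -ej in jk *; apply: side_support_strict; lia.
have h1 : 0 < e * det3 (B i) (B i.+1) (B k) by apply: side_support_strict; lia.
have h2 : 0 < e * det3 (B i) (B i.+1) (B k.+1) by apply: side_support_strict; lia.
have h3 : 0 < e * det3 (B i) (B i.+1) (B j) by apply: side_support_strict; lia.
have h4 : 0 < e * det3 (B i) (B k) (B k.+1).
  by rewrite det3_rot -(B_periodic i); apply: side_support_strict; lia.
rewrite -(pmulr_lgt0 _ h1) mulrACA e_sign mul1r det3_plucker.
have p1 := mulr_gt0 IH h2; have p2 := mulr_gt0 h4 h3.
rewrite mulrACA e_sign mul1r in p1; rewrite mulrACA e_sign mul1r in p2.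
exact: addr_gt0.
Qed.

(** The triangles with vertex [B 0] cover the region. The triangle that contains [x] is
    found at the first diagonal from [B 0], the last side included, that does not have [x]
    strictly on its positive side. *)
Lemma polygon_fan x : D x -> exists j a b c,
  [/\ 0 <= a, 0 <= b, 0 <= c & x = a *: B 0%N + b *: B j + c *: B j.+1].
Proof.
move=> Dx; pose g m := e * det3 (B 0%N) (B m) x.
have g1 : 0 <= g 1%N by apply: side_support.
have gn : exists m, (1 < m < n)%N && (g m <= 0).
  exists n.-1; apply/andP; split; first by lia.
  have := side_support n.-1 Dx; have -> : (n.-1.+1 = 0 + n)%N by lia.
  by rewrite B_periodic /g det3_swap mulrN oppr_ge0.
have [m /andP[hm gm] hmin] := ex_minnP gn.
have [j hj] : exists j, m = j.+1 by exists m.-1; lia.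
rewrite hj in hm gm hmin.
have gj : 0 <= g j.
  have [h|h] := leP 0 (g j) => //.
  have [ej|ej] := eqVneq j 1%N; first by move: g1; rewrite -ej leNgt h.
  have hj2 : (1 < j < n)%N && (g j <= 0) by rewrite (ltW h) andbT; lia.
  by have := hmin _ hj2; rewrite ltnn.
have hd : 0 < e * det3 (B 0%N) (B j) (B j.+1).
  by apply: polygon_order; lia.
have hs := side_support j Dx.
set d := e * det3 (B 0%N) (B j) (B j.+1) in hd.
have dn : d != 0 by rewrite gt_eqF.
exists j, (e * det3 (B j) (B j.+1) x / d), (- g j.+1 / d), (g j / d); split.
- by rewrite divr_ge0 // ltW.
- by rewrite divr_ge0 ?oppr_ge0 // ltW.
- by rewrite divr_ge0 // ltW.
apply: (scalerI dn); rewrite !scalerDr !scalerA ![d * (_ / d)]mulrC !divfK //.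
rewrite /d -scalerA det3_cramer !scalerDr !scalerA /g.
by congr (_ *: _ + _ *: _ + _);
  [rewrite det3_rot | rewrite det3_swap mulrN -[det3 _ _ x]det3_rot det3_swap mulrN opprK].
Qed.

Lemma polygon_sub_disk o rho : space_form l o -> 0 <= rho -> l * rho <= 2 ->
  (forall i, chord l o (B i) <= rho) -> forall x, D x -> chord l o x <= rho.
Proof.
move=> ho r0 lr hB x Dx; have [j [a [b [c [a0 b0 c0 ex]]]]] := polygon_fan Dx.
by rewrite ex; apply: chord_comb3 => //; rewrite -ex; exact: D_sub.
Qed.

End PolygonOrder.

(** * Shrinking a disk by moving its centre *)

Section MoveCenter.
Context {R : realType}.
Implicit Types (l e r t K k : R) (o p q x v w u : 'rV[R]_3).

(** The exact variation of the chord when the centre moves along a geodesic. The term of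
    first order in [t] is the last one, the other one being quadratic. *)
Lemma chord_geodesic l o v x t : space_form l o -> space_form l x -> unit_tangent l o v ->
  space_form l (geodesic l o v t) ->
  chord l (geodesic l o v t) x = chord l o x
    + 4 * s_ l (t / 2) ^+ 2 * (1 - l * chord l o x / 2)
    - 2 * s_ l t * form l v (radial l o x).
Proof.
move=> ho hx [tv ev] hg; have [l0|l0] := eqVneq l 0.
  move: tv ev ho hx; rewrite radial.unlock /geodesic l0 /tangent eqxx.
  move=> v0 ev /space_form0 ho /space_form0 hx.
  rewrite /s_ /c_ !ltxx !mul0r subr0 mulr1.
  have -> : 4 * (t / 2) ^+ 2 = t ^+ 2 * form 0 v v by rewrite ev; field.
  rewrite /chord /form sgr0 !mxE.
  by gen_coords o; gen_coords x; gen_coords v; ring.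
rewrite chordE (space_form_form l0 hg) (space_form_form l0 hx).
have fvo : form l v o = 0 by move: tv; rewrite /tangent (negbTE l0) formC.
have -> : form l v (radial l o x) = form l v x.
  rewrite radial.unlock; transitivity (form l v x - c_ l (dist l o x) * form l v o).
    move: (c_ _ _) => c; rewrite /form !mxE; gen_coords v; gen_coords o; gen_coords x.
    by ring.
  by rewrite fvo mulr0 subr0.
rewrite /geodesic formDZ form_chord // [c_ l t]c_half.
by move: (s_ _ _) (s_ _ _) (chord _ _ _) (form _ _ _) => *; field.
Qed.

Lemma near_right0 (P : R -> Prop) : (\forall t \near 0, P t) -> \forall t \near 0^'+, P t.
Proof. by move=> h; apply: cvg_within. Qed.

Lemma geodesic_near l o v : space_form l o -> unit_tangent l o v ->
  \forall t \near 0, space_form l (geodesic l o v t).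
Proof.
move=> ho [tv ev].
have h0 : (c_ l t * o 0 0 + s_ l t * v 0 0) @[t --> 0] --> c_ l 0 * o 0 0 + s_ l 0 * v 0 0.
  by apply: cvgD; apply: cvgMl; [exact: continuous_c | exact: continuous_s].
have hpos : 0 < l \/ l = 0 \/ (l < 0 /\ \forall t \near 0, 0 < c_ l t * o 0 0 + s_ l t * v 0 0).
  have [hl|hl|hl] := ltgtP 0 l; [by left| |by right; left].
  right; right; split=> //; apply: (cvgr_gt _ h0).
  by rewrite c_0 s_0 mul1r mul0r addr0 (space_form_neg hl).
have form_ok t : l != 0 -> form l (geodesic l o v t) (geodesic l o v t) = l^-1.
  move=> l0; have fvo : form l o v = 0 by move: tv; rewrite /tangent (negbTE l0).
  rewrite /geodesic; move: (c2_s2 l t); move: (c_ l t) (s_ l t) => c s hcs.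
  have -> : form l (c *: o + s *: v) (c *: o + s *: v) =
     c ^+ 2 * form l o o + s ^+ 2 * form l v v + 2 * c * s * form l o v.
    by rewrite /form !mxE; gen_coords o; gen_coords v; ring.
  rewrite fvo ev (space_form_form l0 ho) mulr0 addr0 mulr1.
  by apply: (mulfI l0); rewrite divff // -hcs; field.
case: hpos => [hl|[hl|[hl hn]]].
- near=> t; rewrite /space_form /= gt_eqF //; split; first by apply: form_ok; rewrite gt_eqF.
  by move=> hl'; have := lt_trans hl hl'; rewrite ltxx.
- near=> t; rewrite /space_form /= hl eqxx /geodesic !mxE.
  move: ho tv; rewrite hl /tangent eqxx => /space_form0 -> ->.
  by rewrite /c_ ltxx mulr1 mulr0 addr0.
- near=> t; rewrite /space_form /= lt_eqF //; split; first by apply: form_ok; rewrite lt_eqF.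
  by move=> _; rewrite /geodesic !mxE; near: t.
Unshelve. all: by end_near.
Qed.

Lemma near_s_gt0 l : \forall t \near 0^'+, 0 < s_ l (t / 2).
Proof.
have b0 : 0 < (if 0 < l then pi / Num.sqrt l else 1).
  by case: ifP => // hl; rewrite divr_gt0 ?pi_gt0 ?sqrtr_gt0.
near=> t.
have t0 : 0 < t by near: t; exact: nbhs_right_gt.
apply: s_gt0; first by rewrite divr_gt0.
move=> hl; have : t < (if 0 < l then pi / Num.sqrt l else 1) by near: t; exact: nbhs_right_lt.
by rewrite hl; lra.
Unshelve. all: by end_near.
Qed.

Lemma cvg_s_half l : s_ l (t / 2) @[t --> 0] --> (0 : R).
Proof.
have h : (t / 2) @[t --> (0 : R)] --> (0 / 2 : R) by apply: cvgMl; exact: cvg_id.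
rewrite mul0r in h.
have h2 : s_ l t @[t --> (0 : R)] --> s_ l 0 by exact: continuous_s.
rewrite s_0 in h2; exact: (cvg_comp _ _ h h2).
Qed.

Lemma cvg_c_half l : c_ l (t / 2) @[t --> 0] --> (1 : R).
Proof.
have h : (t / 2) @[t --> (0 : R)] --> (0 / 2 : R) by apply: cvgMl; exact: cvg_id.
rewrite mul0r in h.
have h2 : c_ l t @[t --> (0 : R)] --> c_ l 0 by exact: continuous_c.
rewrite c_0 in h2; exact: (cvg_comp _ _ h h2).
Qed.

(** Moving the centre by a small amount in the direction [v] brings it closer to the points
    on the circle, to first order, and keeps the other points inside by continuity. There
    are finitely many points, so that one displacement suits all. *)
Lemma move_center l o v (n : nat) (A : 'I_n -> 'rV[R]_3) (rho : R) :
  space_form l o -> unit_tangent l o v -> (forall i, space_form l (A i)) ->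
  (forall i, chord l o (A i) <= rho) ->
  (forall i, chord l o (A i) = rho -> 0 < form l v (radial l o (A i))) ->
  exists2 o', space_form l o' & forall i, chord l o' (A i) < rho.
Proof.
move=> ho hv hA hle hct.
have hn : \forall t \near 0^'+, forall i, chord l o (A i)
    + 4 * s_ l (t / 2) ^+ 2 * (1 - l * chord l o (A i) / 2)
    - 2 * s_ l t * form l v (radial l o (A i)) < rho.
  apply: filter_forall => i.
  move: (hle i); rewrite le_eqVlt => /orP[/eqP hc|hc].
    have := hct i hc; rewrite hc; move: (form _ _ _) => f f0.
    have hlim : (2 * c_ l (t / 2) * f - 2 * s_ l (t / 2) * (1 - l * rho / 2)) @[t --> 0] -->
        2 * 1 * f - 2 * 0 * (1 - l * rho / 2).
      apply: cvgB; apply: cvgMl; apply: cvgMr; [exact: cvg_c_half | exact: cvg_s_half].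
    have h1 : \forall t \near 0^'+, 0 < 2 * c_ l (t / 2) * f - 2 * s_ l (t / 2) * (1 - l * rho / 2).
      apply: near_right0; apply: (cvgr_gt _ hlim); lra.
    have h2 := near_s_gt0 l.
    near=> t; rewrite [s_ l t]s_half.
    have t1 : 0 < s_ l (t / 2) by near: t.
    have t2 : 0 < 2 * c_ l (t / 2) * f - 2 * s_ l (t / 2) * (1 - l * rho / 2) by near: t.
    have := mulr_gt0 t1 t2.
    by move: (s_ _ _) (c_ _ _) => a b; lra.
  apply: near_right0.
  have hlim : (chord l o (A i) + 4 * s_ l (t / 2) ^+ 2 * (1 - l * chord l o (A i) / 2)
    - 2 * (2 * s_ l (t / 2) * c_ l (t / 2)) * form l v (radial l o (A i))) @[t --> 0] -->
    chord l o (A i) + 4 * 0 ^+ 2 * (1 - l * chord l o (A i) / 2)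
    - 2 * (2 * 0 * 1) * form l v (radial l o (A i)).
    apply: cvgB.
      apply: cvgD; first exact: cvg_cst.
      apply: cvgMl; apply: cvgMr; rewrite expr2.
      by under eq_cvg do rewrite expr2; apply: cvgM; exact: cvg_s_half.
    apply: cvgMl; apply: cvgMr; apply: cvgM; last exact: cvg_c_half.
    by apply: cvgMr; exact: cvg_s_half.
  have : \forall t \near 0, chord l o (A i) + 4 * s_ l (t / 2) ^+ 2 * (1 - l * chord l o (A i) / 2)
    - 2 * (2 * s_ l (t / 2) * c_ l (t / 2)) * form l v (radial l o (A i)) < rho.
    by apply: (cvgr_lt _ hlim); lra.
  by apply: filterS => t; rewrite -s_half.
have hg := near_right0 (geodesic_near ho hv).
have [t [h1 h2]] := @filter_ex _ (0^'+ : set_system R) _ _ (filterI hn hg).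
exists (geodesic l o v t) => // i.
by rewrite chord_geodesic.
Unshelve. all: by end_near.
Qed.

Lemma form_orthonormal_comb l u w (a b : R) : form l u u = 1 -> form l w w = 1 -> form l u w = 0 ->
  form l (a *: u + b *: w) (a *: u + b *: w) = a ^+ 2 + b ^+ 2.
Proof.
move=> h1 h2 h3; transitivity (a ^+ 2 * form l u u + b ^+ 2 * form l w w + 2 * a * b * form l u w).
  by rewrite /form !mxE; gen_coords u; gen_coords w; ring.
by rewrite h1 h2 h3; ring.
Qed.

(** If all contact points except [A i] are strictly on one side of the line from [o] to [A
    i], the normal to this line that points to their side has a positive product with each
    of them, and product 0 with [A i]. Tilting it slightly towards [A i] makes all products
    positive. *)
Lemma contact_side l e o (n : nat) (A : 'I_n -> 'rV[R]_3) (C : 'I_n -> Prop) i : e * e = 1 ->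
  (forall j, visible l o (A j) \/ ~ C j) -> C i ->
  (forall j, C j -> j != i -> e * det3 o (A i) (A j) < 0) ->
  exists2 v, unit_tangent l o v & forall j, C j -> 0 < form l v (radial l o (A j)).
Proof.
move=> he hv Ci hneg.
have vis j : C j -> visible l o (A j) by move=> Cj; case: (hv j).
have vi := vis i Ci; have [ho hAi si] := vi.
have ui := unit_visible vi.
have [w [uw huw hw]] := exists_normal ho ui.
have fw j : C j -> form l w (radial l o (A j)) =
    area_scale l / s_ l (dist l o (A i)) * det3 o (A i) (A j).
  move=> /vis[_ hj _]; rewrite (hw _ (tangent_radial ho hj)).
  by rewrite /orient det3_direction det3_radialr mulrA.
have fu : form l (direction l o (A i)) (radial l o (A i)) = s_ l (dist l o (A i)).
  rewrite directionE formZ form_radial_radial //.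
  by rewrite expr2 mulrA mulVf ?mul1r // gt_eqF.
have hn : \forall d \near 0^'+, forall j, C j -> j != i ->
    0 < - e * form l w (radial l o (A j)) + d * form l (direction l o (A i)) (radial l o (A j)).
  apply: filter_forall => j.
  have [Cj|nCj] := pselect (C j); last by near=> d => Cj.
  have [ij|ij] := eqVneq j i; first by near=> d.
  have hlt := hneg j Cj ij.
  move: (form l (direction l o (A i)) (radial l o (A j))) => g.
  have f0 : 0 < - e * form l w (radial l o (A j)).
    rewrite (fw j Cj) mulNr mulrCA oppr_gt0 pmulr_rlt0 //.
    by rewrite divr_gt0 ?area_scale_gt0.
  move: (form l w _) f0 => f f0.
  have hlim : (- e * f + d * g) @[d --> 0] --> - e * f + 0 * g.
    by apply: cvgD; [exact: cvg_cst | apply: cvgMl; exact: cvg_id].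
  have : \forall d \near 0^'+, 0 < - e * f + d * g.
    by apply: near_right0; apply: (cvgr_gt _ hlim); rewrite mul0r addr0.
  by apply: filterS => d ? _ _.
have [d [hd d0]] := @filter_ex _ (0^'+ : set_system R) _ _ (filterI hn (nbhs_right_gt 0)).
(* The vector [- e *: w] is the normal that points to the other contact points. *)
set N := Num.sqrt (d ^+ 2 + (- e) ^+ 2).
have N2 : 0 < d ^+ 2 + (- e) ^+ 2 by rewrite sqrrN [e ^+ 2]expr2 he addr_gt0 // exprn_gt0.
have N0 : 0 < N by rewrite sqrtr_gt0.
exists (N^-1 *: (d *: direction l o (A i) + (- e) *: w)).
  have [tu eu] := ui; have [tw ew] := uw.
  split; first by apply: tangentZ; apply: tangentDZ.
  rewrite formZ formC formZ (form_orthonormal_comb _ _ eu ew huw)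
    -[X in _ * (_ * X)](sqr_sqrtr (ltW N2)) -/N.
  by field; rewrite gt_eqF.
move=> j Cj; rewrite formZ formDZ mulr_gt0 ?invr_gt0 //.
have [->|ij] := eqVneq j i; last by rewrite addrC; apply: hd.
by rewrite fu (fw i Ci) det3pxx !mulr0 addr0 mulr_gt0.
Unshelve. all: by end_near.
Qed.

(** The centre is the pole of the line through [p] and [q], that is, a multiple of the
    normal to this line. *)
Lemma hemisphere_cover l e p q (D : set 'rV[R]_3) : 0 < l -> e * e = 1 -> visible l p q ->
  D `<=` space_form l -> (forall x, D x -> 0 <= e * det3 p q x) ->
  exists2 o, space_form l o & D `<=` disk l o (pi / Num.sqrt l / 2).
Proof.
move=> hl he hv hD hpos; have [hp hq hs] := hv; have l0 : l != 0 by rewrite gt_eqF.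
have [w [[tw ew] _ hw]] := exists_normal hp (unit_visible hv).
have sl : 0 < Num.sqrt l by rewrite sqrtr_gt0.
have s2 : Num.sqrt l ^+ 2 = l by rewrite sqr_sqrtr // ltW.
have ho : space_form l ((e / Num.sqrt l) *: w).
  rewrite /space_form /= (negbTE l0); split; last by move=> h; have := lt_trans hl h; rewrite ltxx.
  rewrite formZ formC formZ ew mulr1 mulf_div he -expr2 s2.
  by rewrite mul1r.
exists ((e / Num.sqrt l) *: w) => // x Dx; have hx := hD x Dx; split=> //.
have pos0 : 0 <= pi / Num.sqrt l / 2 by rewrite !divr_ge0 ?pi_ge0.
rewrite dist_le //; last by move=> _; have : 0 < pi / Num.sqrt l; [rewrite divr_gt0 ?pi_gt0|lra].
have hc0 : c_ l (pi / Num.sqrt l / 2) = 0.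
  rewrite /c_ hl; transitivity (cos (pi / 2 : R)); last exact: cos_pihalf.
  by congr cos; field; rewrite gt_eqF.
have hf : 0 <= form l ((e / Num.sqrt l) *: w) x.
  have fwp : form l w p = 0 by move: tw; rewrite /tangent (negbTE l0) formC.
  rewrite formZ.
  have -> : form l w x = form l w (radial l p x).
    rewrite radial.unlock; transitivity (form l w x - c_ l (dist l p x) * form l w p).
      by rewrite fwp mulr0 subr0.
    move: (c_ _ _) => c; rewrite /form !mxE; gen_coords w; gen_coords p; gen_coords x.
    by ring.
  rewrite (hw _ (tangent_radial hp hx)) /orient det3_direction det3_radialr.
  have -> : e / Num.sqrt l * (area_scale l * ((s_ l (dist l p q))^-1 * det3 p q x)) =
     area_scale l / Num.sqrt l / s_ l (dist l p q) * (e * det3 p q x).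
    by field; rewrite !gt_eqF.
  by rewrite mulr_ge0 ?hpos // !divr_ge0 // ltW // area_scale_gt0.
rewrite form_chord // in hf; rewrite c_half in hc0.
have := mulr_ge0 (ltW hl) hf; rewrite mulrBr divff //.
move: (chord _ _ _) (s_ _ _) hc0 => S s hc0 h.
rewrite -(ler_pM2l hl); lra.
Qed.

(** Jordan's inequality in strict form. By the mean value theorem the slope of [sin] from 0
    to [y] is larger than that from [y] to [pi / 2]. *)
Lemma jordan_lt (y : R) : 0 < y -> y < pi / 2 -> y < pi / 2 * sin y.
Proof.
move=> y0 y1; have p0 := @pi_gt0 R; rewrite ltNge; apply/negP => hle.
have hd (x : R) : is_derive x 1 (@sin R) (cos x) by exact: is_derive_sin.
have hc a b : {within `[a, b], continuous (@sin R)}.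
  by apply: continuous_subspaceT => x; exact: continuous_sin.
have [c1 /[!in_itv]/= /andP[c10 c11] e1] := MVT y0 (fun (x : R) _ => hd x) (hc 0 y).
have [c2 /[!in_itv]/= /andP[c20 c21] e2] := MVT y1 (fun (x : R) _ => hd x) (hc y (pi / 2)).
rewrite sin0 !subr0 in e1; rewrite sin_pihalf in e2.
have hcos : cos c2 < cos c1 by rewrite ltr_cos ?in_itv /=; [lra | apply/andP; split; lra..].
have h1 : cos c1 * (pi / 2) <= 1.
  rewrite -(ler_pM2r y0) mul1r mulrAC -e1; lra.
have h2 : 1 <= cos c2 * (pi / 2).
  have h3 : 0 < pi / 2 - y by lra.
  rewrite -(ler_pM2r h3) mul1r; nra.
have h4 : cos c2 * (pi / 2) < cos c1 * (pi / 2) by rewrite ltr_pM2r // divr_gt0.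
lra.
Qed.

(** Jordan's inequality applied to [asin]. Equality occurs at [pi / 2], for chords that are
    diameters, and is recorded in the second case; it is harmless because the angles of the
    polygon are positive. *)
Lemma half_chord_angle_le l K k p q : 0 <= K -> 0 < k -> K <= 2 * k / pi -> chord_fits l K p q ->
  half_chord_angle l K p q < k * ta_ l (dist l p q / 2) \/
  half_chord_angle l K p q = pi / 2 /\ pi / 2 <= k * ta_ l (dist l p q / 2).
Proof.
move=> K0 k0 hK g; have [/andP[b0 b1] b2] := half_chord_angle_bounds K0 g.
have t0 := half_ta_gt0 g.1; have p0 := @pi_gt0 R.
move: (ta_ _ _) t0 b2 => t t0 b2; move: (half_chord_angle _ _ _ _) b0 b1 b2 => y y0 y1 b2.
have hkt : pi / 2 * sin y <= k * t.
  rewrite b2 mulrA ler_pM2r //.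
  by rewrite ler_pdivlMr // in hK; lra.
move: y0; rewrite le_eqVlt => /orP[/eqP <-|y0]; first by left; rewrite mulr_gt0.
move: y1; rewrite le_eqVlt => /orP[/eqP ey|y1].
  by right; split=> //; move: hkt; rewrite ey sin_pihalf mulr1.
by left; apply: lt_le_trans hkt; apply: jordan_lt.
Qed.

End MoveCenter.

(** * Polygons with at least three vertices *)

Section CyclicIndex.
Variables (n : nat) (n_gt0 : (0 < n)%N).

(** Reading the indices modulo [n] makes the vertices a periodic sequence, in which the
    cyclic order is the order of [nat] on each period. *)
Definition cyc m : 'I_n := Ordinal (ltn_pmod m n_gt0).

Lemma cycS m : ordS (cyc m) = cyc m.+1.
Proof. by apply: val_inj; rewrite /= -addn1 modnDml addn1. Qed.

Lemma cyc_pred m : ord_pred (cyc m.+1) = cyc m.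
Proof. by rewrite -cycS ordSK. Qed.

Lemma cycD m : cyc (m + n) = cyc m.
Proof. by apply: val_inj; rewrite /= modnDr. Qed.

Lemma cyc_ord (i : 'I_n) : cyc i = i.
Proof. by apply: val_inj; rewrite /= modn_small. Qed.

Lemma cyc_neq i j : (i < j < i + n)%N -> cyc i != cyc j.
Proof.
move=> /andP[ij ji]; apply/eqP => /(congr1 val) /= /eqP.
rewrite eq_sym eqn_mod_dvd ?(ltnW ij) // gtnNdvd //; first by rewrite subn_gt0.
by rewrite ltn_subLR // ltnW.
Qed.

Lemma cyc_rep (i j : 'I_n) : i != j -> exists m, (i < m < i + n)%N /\ cyc m = j.
Proof.
move=> hij; have [lt_ij|le_ji] := ltnP i j.
  by exists j; split; [rewrite lt_ij (leq_trans (ltn_ord j)) // leq_addl | exact: cyc_ord].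
exists (j + n)%N; split; last by rewrite cycD cyc_ord.
have lt_ji : (j < i)%N by rewrite ltn_neqAle le_ji andbT eq_sym.
by rewrite ltn_add2r lt_ji andbT (leq_trans (ltn_ord i)) // leq_addl.
Qed.

End CyclicIndex.

Lemma cyclic_order_not_opp {R : realType} (e : R) n (B : nat -> 'rV[R]_3) i j : (2 < n)%N ->
  (forall i j k, (i < j < k)%N -> (k < i + n)%N -> 0 < e * det3 (B i) (B j) (B k)) ->
  (i < j < i + n)%N -> B j <> - B i.
Proof.
move=> n2 hord hij opp.
have zero x : det3 (B i) (B j) x = 0.
  by rewrite opp /det3 !mxE; gen_coords (B i); gen_coords x; ring.
have [h|h] := eqVneq j i.+1.
  have := hord i j j.+1; rewrite zero mulr0 ltxx => H.
  by have : false; [apply: H; lia|].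
have := hord i i.+1 j; rewrite det3_rot det3_swap -det3_rot zero oppr0 mulr0 ltxx => H.
by have : false; [apply: H; lia|].
Qed.

(** In the second case of [half_chord_angle_le], strictness comes from the positivity of the
    interior angle [a]. *)
Lemma turn_arith {R : realType} (k t1 t2 y1 y2 a : R) : 0 < a ->
  y1 < k * t1 \/ y1 = pi / 2 /\ pi / 2 <= k * t1 ->
  y2 < k * t2 \/ y2 = pi / 2 /\ pi / 2 <= k * t2 ->
  k * (t1 + t2) <= pi - a -> y1 + y2 + a < pi.
Proof.
by rewrite mulrDr; move: (k * t1) (k * t2) => x1 x2 a0 [h1|[h1 h1']] [h2|[h2 h2']] h3; lra.
Qed.

Section ManyVertices.
Context {R : realType}.
Variables (l : R) (n : nat) (A : 'I_n -> 'rV[R]_3) (D : set 'rV[R]_3) (r : R).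
Hypothesis polygonP : convex_polygon A l D.

Lemma polygon_closed : closed D.
Proof. exact/(compact_closed (@norm_hausdorff _ _))/(polygon_compact polygonP). Qed.

Lemma boundary_sub : boundary l D `<=` D.
Proof. by move=> x [hx _]; rewrite (closure_id D).1 //; exact: polygon_closed. Qed.

Lemma side_sub_boundary i : side A l i `<=` boundary l D.
Proof. by move=> x hx; rewrite (polygon_boundary polygonP); exists i. Qed.

Lemma vertex_neq_next i : A i != A (ordS i).
Proof.
apply/eqP => /(polygon_distinct polygonP) /(congr1 val) /= e.
have n2 := polygon_size polygonP; have i_n := ltn_ord i.
move: e; have [e|h] := eqVneq i.+1 n; first by rewrite e modnn; lia.
by rewrite modn_small; lia.
Qed.

Lemma vertex_in i : D (A i).
Proof.
apply: boundary_sub; apply: (@side_sub_boundary i); exists 0.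
  by rewrite /= lexx dist_ge0 //; exact: (polygon_vertices polygonP).
by rewrite /geodesic c_0 s_0 scale1r scale0r addr0.
Qed.

Hypothesis short_sides : 0 < l -> forall i, side_length A l i < pi / Num.sqrt l.

Lemma side_visible i : visible l (A i) (A (ordS i)).
Proof.
apply: visible_neq.
- exact: (polygon_vertices polygonP).
- exact: (polygon_vertices polygonP).
- exact: vertex_neq_next.
- by move=> hl; exact: short_sides.
Qed.

Hypothesis circumradiusP : is_circumradius l D r.

Lemma circumradius_gt0 : 0 < r.
Proof.
have [[ctr ho hD] _] := circumradiusP.
have n2 := polygon_size polygonP.
have i : 'I_n by exists 0%N; lia.
have [_ h1] := hD _ (vertex_in i); have [_ h2] := hD _ (vertex_in (ordS i)).
have d0 := dist_ge0 ho (polygon_vertices polygonP i).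
rewrite lt_neqAle (le_trans d0 h1) andbT.
apply/eqP => e; have := vertex_neq_next i.
have E j : D (A j) -> A j = ctr.
  move=> Dj; have hj := polygon_vertices polygonP j.
  apply/esym/eqP; apply: contraTT isT => hne.
  have := dist_gt0 ho hj hne; have [_] := hD _ Dj; rewrite -e => h.
  by rewrite ltNge h.
move/eqP; apply; exact: (etrans (E i (vertex_in i)) (esym (E _ (vertex_in (ordS i))))).
Qed.

Variable k : R.
Hypothesis k_gt0 : 0 < k.
Hypothesis curvature_ge : forall i, k <= vertex_curvature A l i.

Lemma turn_angle i :
  k * (ta_ l (side_length A l (ord_pred i) / 2) + ta_ l (side_length A l i / 2)) <=
  pi - angle_at l (A i) (A (ord_pred i)) (A (ordS i)).
Proof.
have vi : 0 < ta_ l (side_length A l i / 2) := half_ta_gt0 (side_visible i).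
have vp : 0 < ta_ l (side_length A l (ord_pred i) / 2) := half_ta_gt0 (side_visible (ord_pred i)).
have := curvature_ge i.
rewrite /vertex_curvature (ler_pdivlMr _ _ (addr_gt0 vp vi)) angle_at.unlock.
exact.
Qed.

Hypothesis n_gt2 : (2 < n)%N.
Let n_gt0 : (0 < n)%N. Proof. lia. Qed.
Let next_lt m : (m < m.+1 < m + n)%N. Proof. by clear -n_gt2; lia. Qed.
Let B m := A (cyc n_gt0 m).

Let B_periodic m : B (m + n) = B m.
Proof. by rewrite /B cycD. Qed.

Let B_in m : D (B m). Proof. exact: vertex_in. Qed.

Let B_neq i j : (i < j < i + n)%N -> B i != B j.
Proof.
by move=> h; apply/eqP => /(polygon_distinct polygonP)/eqP; apply/negP/cyc_neq.
Qed.

Let sideE m : side A l (cyc n_gt0 m) = segment l (B m) (B m.+1).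
Proof. by rewrite /side cycS. Qed.

Let B_visible m : visible l (B m) (B m.+1).
Proof. by rewrite /B -cycS; exact: side_visible. Qed.

Let B_side m : not_antipodal l (B m) (B m.+1).
Proof. by move=> hl; rewrite /B -cycS; exact: short_sides. Qed.

Let B_boundary m : segment l (B m) (B m.+1) `<=` boundary l D.
Proof. by rewrite -sideE; exact: side_sub_boundary. Qed.

Let B_simple i j : (i < j < i + n)%N -> forall x,
  segment l (B i) (B i.+1) x -> segment l (B j) (B j.+1) x -> x = B i \/ x = B i.+1.
Proof.
move=> ij x; rewrite -!sideE => hi hj.
have n2 : n != 2%N by lia.
have := @polygon_simple _ _ _ _ _ polygonP n2 _ _ (cyc_neq n_gt0 ij) x (conj hi hj).
by rewrite cycS.
Qed.

Let B_turn_angle m :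
  k * (ta_ l (dist l (B m) (B m.+1) / 2) + ta_ l (dist l (B m.+1) (B m.+2) / 2)) <=
  pi - angle_at l (B m.+1) (B m) (B m.+2).
Proof. by have := turn_angle (cyc n_gt0 m.+1); rewrite /side_length cyc_pred !cycS. Qed.

Let B_angle m : angle_at l (B m.+1) (B m) (B m.+2) < pi.
Proof.
have := B_turn_angle m.
have := mulr_gt0 k_gt0 (addr_gt0 (half_ta_gt0 (B_visible m)) (half_ta_gt0 (B_visible m.+1))).
by move: (k * _) (angle_at _ _ _ _) => a b; lra.
Qed.

Let D_sub := polygon_sub polygonP.
Let D_convex := polygon_convex polygonP.

(** The conclusion [2 * k / pi < c_ l r / s_ l r] is the strict bound on [ta_ l r] in a form
    that does not presuppose [0 < c_ l r]. *)
Lemma polygon_curvature_bound :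
  [/\ 0 < s_ l r, 0 <= c_ l r & 2 * k / pi < c_ l r / s_ l r].
Proof.
have r0 := circumradius_gt0.
have [e e_sign e_turn] := exists_orientation n_gt2 D_sub D_convex B_periodic B_in B_neq
  B_side B_boundary B_simple B_angle.
have e_order := polygon_order n_gt2 D_sub D_convex B_periodic B_in B_neq
  B_side B_boundary B_simple e_sign e_turn.
have e_support := side_support n_gt2 D_sub D_convex B_in B_neq B_side B_boundary e_sign e_turn.
have sub_disk := polygon_sub_disk n_gt2 D_sub D_convex B_periodic B_in B_neq
  B_side B_boundary B_simple e_sign e_turn.
have [[ctr ho hD] hmin] := circumradiusP.
have r_le : 0 < l -> r <= pi / Num.sqrt l / 2.
  move=> hl; apply: hmin.
  exact: (hemisphere_cover hl e_sign (B_visible 0%N) D_sub (fun x => e_support 0%N x)).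
have r_le_pi : 0 < l -> r <= pi / Num.sqrt l by move=> hl; have := r_le hl; lra.
have cr : 0 <= c_ l r by apply: c_ge0 => //; exact: ltW.
have sr : 0 < s_ l r.
  apply: s_gt0 => // hl; have := r_le hl.
  have : 0 < pi / Num.sqrt l by rewrite divr_gt0 ?pi_gt0 ?sqrtr_gt0.
  lra.
split=> //; rewrite ltNge; apply/negP => hK.
have K0 : 0 <= c_ l r / s_ l r by rewrite divr_ge0 // ltW.
have B_sf m : space_form l (B m) by exact/D_sub.
(* A disk around [c'] through the farthest vertex would contain the region and be smaller. *)
have no_better : ~ exists2 c', space_form l c' & forall i, chord l c' (A i) < 4 * s_ l (r / 2) ^+ 2.
  move=> [c' hctr hlt].
  have hlt' i : dist l c' (A i) < r.
    by rewrite dist_lt ?(ltW r0) //; exact: (polygon_vertices polygonP).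
  have [i0 _ hmax] := arg_maxP (fun i => dist l c' (A i)) (isT : xpredT (cyc n_gt0 0)).
  have := hmin (dist l c' (A i0)); rewrite leNgt hlt' => H; apply: notF; apply: H.
  have h0 : 0 <= dist l c' (A i0) by apply: dist_ge0 => //; exact: (polygon_vertices polygonP).
  have hpi : 0 < l -> dist l c' (A i0) <= pi / Num.sqrt l.
    by move=> hl; apply/ltW/(lt_le_trans (hlt' i0))/r_le_pi.
  exists c' => // x Dx; split; first exact: D_sub.
  rewrite dist_le //; last exact: D_sub.
  apply: sub_disk => //.
  - by rewrite mulr_ge0 // sqr_ge0.
  - have hc : 0 <= c_ l (dist l c' (A i0)).
      by apply: c_ge0 => // hl; apply/ltW/(lt_le_trans (hlt' i0))/r_le.
    rewrite c_half in hc; move: (s_ _ _) hc => s hc; lra.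
  - move=> i; rewrite -dist_le //; first exact: hmax.
have vle i : chord l ctr (A i) <= 4 * s_ l (r / 2) ^+ 2.
  have [hA hd] := hD _ (vertex_in i).
  by rewrite -dist_le // ltW.
pose C i := chord l ctr (A i) = 4 * s_ l (r / 2) ^+ 2.
have Cdist i : C i -> dist l ctr (A i) = r.
  by move=> h; apply: dist_eq => //; [exact: (polygon_vertices polygonP) | exact: ltW].
have Cvis i : visible l ctr (A i) \/ ~ C i.
  have [h|h] := pselect (C i); last by right.
  by left; split=> //; [exact: (polygon_vertices polygonP) | rewrite Cdist].
(* [C i] means that [A i] is on the circle. *)
have [i Ci] : exists i, C i.
  apply: contrapT => h; apply: no_better; exists ctr => // i.
  by rewrite lt_neqAle vle andbT; apply/eqP => Ci; apply: h; exists i.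
have side (s : R) : s * s = 1 -> exists2 j, C j /\ j != i & 0 <= s * det3 ctr (A i) (A j).
  move=> hs; apply: contrapT => h.
  have [v uv hv] : exists2 v, unit_tangent l ctr v &
      forall j, C j -> 0 < form l v (radial l ctr (A j)).
    apply: (contact_side hs Cvis Ci) => j Cj ji; rewrite ltNge; apply/negP => hge.
    by apply: h; exists j.
  apply: no_better; apply: (move_center ho uv) => //.
  exact: (polygon_vertices polygonP).
(* Contact vertices on both sides of the line from [ctr] to [A i], possibly on the line. *)
have [j [Cj ji] hj] := side e e_sign.
have [j' [Cj' ji'] hj'] := side (- e) (etrans (mulrNN e e) e_sign).
rewrite mulNr oppr_ge0 in hj'.
rewrite eq_sym in ji; rewrite eq_sym in ji'.
have [m [hm em]] := cyc_rep n_gt0 ji.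
have [m' [hm' em']] := cyc_rep n_gt0 ji'.
have good i1 i2 : (i1 < i2 < i1 + n)%N -> chord_fits l (c_ l r / s_ l r) (B i1) (B i2).
  move=> h12; apply: (chord_fits_disk ho) => //.
  - apply: visible_neq => //; first exact: B_neq.
    apply: contrapT => hna; have eopp := antipodal_opp (B_sf i1) (B_sf i2) hna.
    exact: (cyclic_order_not_opp n_gt2 e_order h12 eopp).
  - exact: ltW.
  - by have [] := hD _ (B_in i1).
  - by have [] := hD _ (B_in i2).
have turn i1 : half_chord_angle l (c_ l r / s_ l r) (B i1) (B i1.+1) +
    half_chord_angle l (c_ l r / s_ l r) (B i1.+1) (B i1.+2) +
    angle_at l (B i1.+1) (B i1) (B i1.+2) < pi.
  have g1 : chord_fits l (c_ l r / s_ l r) (B i1) (B i1.+1) by apply: good; exact: next_lt.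
  have g2 : chord_fits l (c_ l r / s_ l r) (B i1.+1) (B i1.+2) by apply: good; exact: next_lt.
  have ang_gt0 : 0 < angle_at l (B i1.+1) (B i1) (B i1.+2).
    have v1 := visibleC (B_visible i1); have v2 := B_visible i1.+1.
    rewrite lt_neqAle angle_at_ge0 // andbT; apply/eqP => ang0.
    have := sin_angle_at v1 v2; rewrite -ang0 sin0 => /esym/eqP.
    rewrite normr_eq0 => /eqP sat0; have := sin_atE v1 v2.
    rewrite sat0 mulr0 => /esym/eqP; rewrite mulf_eq0 gt_eqF ?area_scale_gt0 //= => /eqP det0.
    have := e_turn i1; rewrite det3_swap det0 oppr0 mulr0 ltxx.
    by [].
  exact: (turn_arith ang_gt0 (half_chord_angle_le K0 k_gt0 hK g1)
    (half_chord_angle_le K0 k_gt0 hK g2) (B_turn_angle i1)).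
have wedge := @half_chord_wedge _ l _ e n B K0 e_sign B_periodic e_order good turn.
apply: (@contact_wedge_false _ l e r n B ctr i m m' e_sign cr sr ho e_order good) => //.
- by move=> i1 i2 i3 h1 h2 h3; apply: wedge.
- by rewrite /B cyc_ord Cdist.
- by rewrite /B em Cdist.
- by rewrite /B em' Cdist.
- by rewrite /B em cyc_ord.
- by rewrite /B em' cyc_ord.
Qed.

End ManyVertices.

(** * Convex sets bounded by a segment *)

Section BoundarySegment.
Context {R : realType}.
Implicit Types (l t : R) (p q x y z u v w : 'rV[R]_3) (D : set 'rV[R]_3).

Lemma continuous_geodesic l p v : continuous (geodesic l p v).
Proof.
move=> t; have h1 : (c_ l t *: p) @[t --> t] --> c_ l t *: p.
  by apply: cvgZl; exact: continuous_c.
have h2 : (s_ l t *: v) @[t --> t] --> s_ l t *: v.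
  by apply: cvgZl; exact: continuous_s.
exact: (cvgD h1 h2).
Qed.

Lemma geodesic0 l p v : geodesic l p v 0 = p.
Proof. by rewrite /geodesic c_0 s_0 scale1r scale0r addr0. Qed.

Lemma geodesic_end l p q : visible l p q -> geodesic l p (direction l p q) (dist l p q) = q.
Proof.
move=> [_ _ hs]; rewrite /geodesic /direction scalerA divff ?gt_eqF // scale1r.
by rewrite addrC subrK.
Qed.

(** The last parameter for which the geodesic from [p] is in the closed set gives a boundary
    point. *)
Lemma segment_crosses_boundary l D p z : closed D -> D p -> ~ D z ->
  space_form l p -> space_form l z -> p != z -> not_antipodal l p z ->
  exists2 x, segment l p z x & boundary l D x.
Proof.
move=> Dcl Dp nDz hp hz hpz hn; have hv := visible_neq hp hz hpz hn.
set f := geodesic l p (direction l p z); set d := dist l p z.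
have d0 : 0 < d by exact: dist_gt0.
pose E := [set t | 0 <= t <= d /\ D (f t)].
have E0 : E 0 by split; [rewrite lexx ltW | rewrite /f geodesic0].
have Eub : ubound E d by move=> t [/andP[_ h] _].
have hE : has_sup E by split; [exists 0 | exists d].
set s := sup E.
have s0 : 0 <= s by exact: (sup_upper_bound hE).
have sd : s <= d by apply: ge_sup => //; exists 0.
have fc : f @ s --> f s by exact: continuous_geodesic.
have fM t : 0 <= t <= d -> segment l p z (f t) by move=> ht; exists t.
have fsf t : 0 <= t <= d -> space_form l (f t).
  by move=> /fM ht; have [a [b [_ _ h _]]] := segment_comb hp hz hpz hn ht.
have clD : closure D (f s).
  move=> U /fc /nbhs_ballP[eps /= eps0 hU].
  have [t Et ht] := sup_adherent eps0 hE.
  exists (f t); split; first by case: Et.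
  apply: hU; rewrite /ball /= ger0_norm; first by move: ht; rewrite -/s; lra.
  by rewrite subr_ge0; exact: (sup_upper_bound hE).
have Ds : D (f s) by rewrite (closure_id D).1.
have lt_sd : s < d.
  rewrite lt_neqAle sd andbT; apply/eqP => esd; apply: nDz.
  by rewrite -(geodesic_end hv) -/f -/d -esd.
exists (f s); first by apply: fM; rewrite s0.
split=> // U /fc /nbhs_ballP[eps /= eps0 hU].
pose t := Num.min (s + eps / 2) ((s + d) / 2).
have ht1 : s < t by rewrite lt_min; apply/andP; split; lra.
have ht2 : t <= (s + d) / 2 by rewrite ge_min lexx orbT.
have ht3 : t <= s + eps / 2 by rewrite ge_min lexx.
have ht4 : 0 <= t <= d by apply/andP; split; lra.
exists (f t); split; last first.
  by apply: hU; rewrite /ball /= ltr0_norm; lra.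
split; first exact: fsf.
move=> Dt; have : t <= s by apply: (sup_upper_bound hE).
by rewrite leNgt ht1.
Qed.

(** The poles of a line: the unit normal at one of its points is normal at all of them,
    since it is also orthogonal to [q]. *)
Lemma line_normal l p q : visible l p q -> exists2 w, det3 p q w != 0 &
  forall z, space_form l z -> det3 p q z = 0 -> unit_tangent l z w.
Proof.
move=> hv; have [hp hq hs] := hv.
have [w [uw huw hw]] := exists_normal hp (unit_visible hv).
exists w; first exact: (normal_det3_neq0 uw).
have [tw ew] := uw.
move=> z hz /(det3_eq0_comb hv)[a [b ez]]; split=> //.
move: tw; rewrite /tangent; case: eqVneq => // l0 fpw.
have fqw : form l q w = 0.
  have := huw; rewrite directionE formZ => /eqP.
  rewrite mulf_eq0 invr_eq0 gt_eqF //= radial.unlock => /eqP.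
  move: (c_ _ _) => c; have -> : form l (q - c *: p) w = form l q w - c * form l p w.
    by rewrite /form !mxE; gen_coords p; gen_coords q; gen_coords w; ring.
  by rewrite fpw mulr0 subr0.
by rewrite ez formDZ fpw fqw !mulr0 addr0.
Qed.

(** Points off a line are dense: from a point of the line one moves along its normal. *)
Lemma off_line_near l p q z (U : set 'rV[R]_3) : visible l p q -> space_form l z -> nbhs z U ->
  exists y, [/\ space_form l y, U y & det3 p q y != 0].
Proof.
move=> hv hz hU; have [w hw htw] := line_normal hv.
have [h0|h0] := eqVneq (det3 p q z) 0; last first.
  by exists z; split=> //; exact: nbhs_singleton.
have uw := htw z hz h0.
have h1 := near_right0 (geodesic_near hz uw).
have h2 : \forall t \near 0^'+, U (geodesic l z w t).
  by apply: near_right0; apply: (@continuous_geodesic l z w 0); rewrite geodesic0.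
have h3 := near_s_gt0 l; have h4 : \forall t \near 0^'+, 0 < c_ l (t / 2).
  by apply: near_right0; apply: (cvgr_gt _ (@cvg_c_half R l)); exact: ltr01.
have [t [[h5 h6] [h7 h8]]] :=
  @filter_ex _ (0^'+ : set_system R) _ _ (filterI (filterI h1 h2) (filterI h3 h4)).
exists (geodesic l z w t); split=> //.
by rewrite /geodesic det3_lin h0 mulr0 add0r mulf_neq0 // s_half !mulf_neq0 ?gt_eqF.
Qed.

(** A segment that ends at a point [e] of the line of [p] and [q], outside the segment [p
    q], and starts off this line, meets the line only in [e]. *)
Lemma segment_neq_ends l p q x e : visible l p q -> not_antipodal l p q ->
  space_form l x -> space_form l e -> det3 p q x != 0 -> det3 p q e = 0 -> ~ segment l p q e ->
  [/\ x != e, not_antipodal l x e & forall y, segment l x e y -> ~ segment l p q y].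
Proof.
move=> hv hn hx he hdx hde ne; have [hp hq _] := hv.
have hpq : p != q by apply: contraNneq hdx => ->; rewrite det3ppx.
have xe : x != e by apply: contraNneq hdx => ->; rewrite hde.
have nxe : not_antipodal l x e.
  apply: contrapT => /(antipodal_opp hx he) ee; move/eqP: hdx; apply.
  have : det3 p q (- x) = 0 by rewrite -ee.
  rewrite -scaleN1r -[_ *: x]addr0 -(scale0r x) det3_lin mul0r addr0 mulN1r => /eqP.
  by rewrite oppr_eq0 => /eqP.
split=> // y hy hpy.
have [a [b [a0 b0 hyM ey]]] := segment_comb hx he xe nxe hy.
have [a' [b' [a0' b0' _ ey']]] := segment_comb hp hq hpq hn hpy.
have : det3 p q y = 0 by rewrite ey' det3_lin det3pxp det3pxx !mulr0 addr0.
rewrite ey det3_lin hde mulr0 addr0 => /eqP; rewrite mulf_eq0 (negbTE hdx) orbF => /eqP ea.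
have hyM2 : space_form l (a *: x + b *: e) by rewrite -ey.
have := comb_norm hx he hyM2.
rewrite ea add0r mul0r mulr0 mul0r subr0 => /eqP; rewrite sqrf_eq1 => /orP[/eqP eb|/eqP eb].
  by apply: ne; have -> : e = y by rewrite ey ea eb scale0r scale1r add0r.
by exfalso; lra.
Qed.

(** Otherwise the set and its complement both have points off the line of [p q], say [y] and
    [z]. Take a point [e] of the line slightly beyond [p]. Whether [e] belongs to the set or
    not, it is joined to [z] or to [y] by a segment that has one end in the set and the
    other outside, hence meets the boundary, but does not meet the segment [p q]. *)
Lemma convex_boundary_segment l D p q : closed D -> D `<=` space_form l ->
  visible l p q -> not_antipodal l p q -> boundary l D = segment l p q ->
  D `<=` segment l p q.
Proof.
move=> Dcl hD hv hn hb x Dx; apply: contrapT => hxs.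
have [hp hq hs] := hv.
have [w hw _] := line_normal hv.
have hpq : p != q by apply: contraNneq hw => ->; rewrite det3ppx.
have ps : segment l p q p.
  by exists 0; [rewrite /= lexx dist_ge0 | rewrite geodesic0].
have [y [hy Dy hdy]] : exists y, [/\ space_form l y, D y & det3 p q y != 0].
  have hnb : ~ closure (space_form l `\` D) x.
    by move=> hcl; apply: hxs; rewrite -hb; split=> //; exact: subset_closure.
  have [U hU hUD] : exists2 U, nbhs x U & forall z, U z -> space_form l z -> D z.
    apply: contrapT => hno; apply: hnb => U hU; apply: contrapT => hdis.
    apply: hno; exists U => // z Uz hz; apply: contrapT => nDz; apply: hdis.
    by exists z.
  have [y [hy Uy hdy]] := off_line_near hv (hD _ Dx) hU.
  by exists y; split=> //; exact: hUD.
have [z [hz nDz hdz]] : exists z, [/\ space_form l z, ~ D z & det3 p q z != 0].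
  have [_ hcl] : boundary l D p by rewrite hb.
  have [z [[hz nDz] _]] := hcl setT filterT.
  have hU : nbhs z (~` D) by apply: open_nbhs_nbhs; split=> //; exact: closed_openC.
  have [z' [hz' nDz' hdz']] := off_line_near hv hz hU.
  by exists z'.
have [tu eu] := unit_visible hv.
have uN : unit_tangent l p (- direction l p q).
  split; first by rewrite -scaleN1r; apply: tangentZ.
  by rewrite -scaleN1r formZ formC formZ eu !mulr1 mulrNN mulr1.
have h1 := near_right0 (geodesic_near hp uN).
have h3 := near_s_gt0 l; have h4 : \forall t \near 0^'+, 0 < c_ l (t / 2).
  by apply: near_right0; apply: (cvgr_gt _ (@cvg_c_half R l)); exact: ltr01.
have [t [h5 [h6 h7]]] := @filter_ex _ (0^'+ : set_system R) _ _ (filterI h1 (filterI h3 h4)).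
set e := geodesic _ _ _ _ in h5.
have [a [b [b0 ee]]] : exists a b, b < 0 /\ e = a *: p + b *: q.
  exists (c_ l t + s_ l t / s_ l (dist l p q) * c_ l (dist l p q)), (- (s_ l t / s_ l (dist l p q))).
  split; first by rewrite oppr_lt0 divr_gt0 // s_half !mulr_gt0.
  rewrite /e /geodesic /direction; move: (s_ l t) (c_ l t) (c_ _ _) (s_ l _) hs => s c c' s' hs'.
  by apply: row3_eq; rewrite !mxE; gen_coords p; gen_coords q; field; rewrite gt_eqF.
have hde : det3 p q e = 0 by rewrite ee det3_lin det3pxp det3pxx !mulr0 addr0.
have nse : ~ segment l p q e.
  move=> /(segment_comb hp hq hpq hn)[a' [b' [_ b0' _ ee']]].
  have E c d : det3 w p (c *: p + d *: q) = d * det3 p q w.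
    by rewrite det3_lin det3pxx mulr0 add0r det3_rot.
  have : det3 w p e = b' * det3 p q w by rewrite ee' E.
  rewrite ee E => /(mulIf hw) ebb; rewrite ebb in b0.
  by move: b0; rewrite ltNge b0'.
have [De|nDe] := pselect (D e).
  have [ze nze hdis] := segment_neq_ends hv hn hz h5 hdz hde nse.
  have ez : e != z by rewrite eq_sym.
  have [x' hx' hbx'] := segment_crosses_boundary Dcl De nDz h5 hz ez (not_antipodalC nze).
  apply: (hdis x'); last by rewrite -hb.
  have [a' [b' [a0' b0' hM ex']]] := segment_comb h5 hz ez (not_antipodalC nze) hx'.
  by rewrite ex' addrC; apply: comb_segment => //; rewrite addrC -ex'.
have [ye nye hdis] := segment_neq_ends hv hn hy h5 hdy hde nse.
have [x' hx' hbx'] := segment_crosses_boundary Dcl Dy nDe hy h5 ye nye.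
by apply: (hdis x') => //; rewrite -hb.
Qed.

End BoundarySegment.

(** * Polygons with two vertices *)

Section SegmentRadius.
Context {R : realType}.
Implicit Types (l t : R) (p q x o : 'rV[R]_3) (D : set 'rV[R]_3).

Lemma visible_distinct l p q : visible l p q -> p != q.
Proof.
move=> [hp _ hs]; apply: contraTneq hs => <-.
rewrite (@dist_eq _ l p p 0) ?s_0 ?ltxx ?chordxx ?mul0r ?s_0 ?expr0n ?mulr0 //.
by move=> hl; rewrite divr_ge0 ?pi_ge0.
Qed.

Lemma radialxx l p : space_form l p -> radial l p p = 0.
Proof.
move=> hp; rewrite radial.unlock c_dist // chordxx mulr0 mul0r subr0 scale1r subrr.
by [].
Qed.

Lemma segmentC l p q : visible l p q -> not_antipodal l p q -> segment l p q = segment l q p.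
Proof.
have H u v : visible l u v -> not_antipodal l u v -> segment l u v `<=` segment l v u.
  move=> huv hn x hx; have [hu hv hs] := huv.
  have uv := visible_distinct huv.
  have [a [b [a0 b0 hM ex]]] := segment_comb hu hv uv hn hx.
  rewrite ex addrC; apply: comb_segment => //; [by rewrite eq_sym|exact: not_antipodalC|].
  by rewrite addrC -ex.
move=> hv hn; apply/seteqP; split; apply: H => //; [exact: visibleC|exact: not_antipodalC].
Qed.

(** The disk around the midpoint is convex and contains both ends, at distance half the
    length. *)
Lemma segment_midpoint l p q : visible l p q -> not_antipodal l p q ->
  exists2 m, space_form l m & segment l p q `<=` disk l m (dist l p q / 2).
Proof.
move=> hv hn; have [hp hq hs] := hv; have d0 := dist_ge0 hp hq.
have hpq := visible_distinct hv.
set d := dist l p q in d0 hs *.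
pose m := geodesic l p (direction l p q) (d / 2).
have seg_sf x : segment l p q x -> space_form l x.
  by move=> hx; have [a [b [_ _ h _]]] := segment_comb hp hq hpq hn hx.
have hm : space_form l m.
  by apply: seg_sf; exists (d / 2) => //=; apply/andP; split; rewrite -/d; lra.
have d2pi : 0 < l -> d / 2 <= pi / Num.sqrt l / 2.
  by move=> hl; rewrite ler_pM2r ?invr_gt0 // dist_le_pi.
have d2pi' : 0 < l -> d / 2 <= pi / Num.sqrt l.
  by move=> hl; have := d2pi hl; lra.
have uv := unit_visible hv.
have cp : chord l m p = 4 * s_ l (d / 2 / 2) ^+ 2.
  rewrite /m chord_geodesic // radialxx // chordxx.
  have -> : form l (direction l p q) 0 = 0 by rewrite /form !mxE; ring.
  by move: (s_ _ _) (s_ _ _) => a b; field.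
have cq : chord l m q = 4 * s_ l (d / 2 / 2) ^+ 2.
  rewrite /m chord_geodesic // directionE formZ form_radial_radial // -/d.
  have -> : (s_ l d)^-1 * s_ l d ^+ 2 = s_ l d by rewrite expr2 mulrA mulVf ?mul1r // gt_eqF.
  rewrite chord_dist // -/d [s_ l d]s_half [s_ l (d / 2)]s_half [c_ l (d / 2)]c_half.
  by move: (s_ _ _) (c_ _ _) => a b; field.
exists m => // x hx; split; first exact: seg_sf.
rewrite dist_le //; [|exact: seg_sf|lra].
have [a [b [a0 b0 hM ex]]] := segment_comb hp hq hpq hn hx.
have ex3 : x = a *: p + b *: q + 0 *: q by rewrite scale0r addr0.
have hc : 0 <= c_ l (d / 2) by apply: c_ge0 => //; lra.
rewrite ex3; apply: chord_comb3 => //.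
- by rewrite -ex3.
- by rewrite mulr_ge0 // sqr_ge0.
- by rewrite c_half in hc; move: (s_ _ _) hc => s hc; lra.
- by rewrite cp.
- by rewrite cq.
- by rewrite cq.
Qed.

(** The triangle inequality through the centre. If the two distances to the centre add up to
    more than [pi / sqrt l], the bound holds because no distance exceeds this number. *)
Lemma covering_radius_ge l p q o D r : space_form l o -> space_form l p -> space_form l q ->
  D p -> D q -> D `<=` disk l o r -> dist l p q / 2 <= r.
Proof.
move=> ho hp hq Dp Dq hD; have [_ h1] := hD _ Dp; have [_ h2] := hD _ Dq.
have [h|h] := boolP ((0 < l) && (pi / Num.sqrt l < dist l o p + dist l o q)).
  move/andP: h => [hl h]; have := dist_le_pi hp hq hl; lra.
have : dist l p q <= dist l o p + dist l o q.
  apply: dist_triangle => // hl; rewrite leNgt; apply/negP => h'.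
  by move: h; rewrite hl h'.
lra.
Qed.

End SegmentRadius.

Lemma ordS_two n (i j : 'I_n) : n = 2%N -> ordS (ordS i) = i /\ (j = i \/ j = ordS i).
Proof.
move=> n2; subst n; have H (a : 'I_2) : a = 0%:R \/ a = 1%:R.
  by case: a => [[|[|m]] hm] //; [left|right]; exact: val_inj.
split; first by case: (H i) => ->; exact: val_inj.
by case: (H i) => ->; case: (H j) => ->; first [by left; exact: val_inj | by right; exact: val_inj].
Qed.

(** The sides coincide, so that the region is the segment and the interior angles are 0;
    both half sides have length [r]. *)
Lemma two_vertices {R : realType} (l : R) (n : nat)
    (A : 'I_n -> 'rV[R]_3) (D : set 'rV[R]_3) (r : R) :
  convex_polygon A l D -> (0 < l -> forall i, side_length A l i < pi / Num.sqrt l) ->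
  is_circumradius l D r -> n = 2%N ->
  [/\ 0 < c_ l r, 0 < ta_ l r, forall i, D = side A l i &
    forall i, vertex_curvature A l i = pi / (2 * ta_ l r)].
Proof.
move=> hP hl hr n2; have n0 : (0 < n)%N by rewrite n2.
have SS (i : 'I_n) : ordS (ordS i) = i by have [] := ordS_two i i n2.
have pS (i : 'I_n) : ord_pred i = ordS i by rewrite -{1}(SS i) ordSK.
have two (i j : 'I_n) : j = i \/ j = ordS i by have [] := ordS_two i j n2.
have vis i := side_visible hP hl i.
have na i : not_antipodal l (A i) (A (ordS i)) by move=> h; exact: hl.
have sideS i : side A l (ordS i) = side A l i.
  by rewrite /side SS [RHS]segmentC.
have bE i : boundary l D = side A l i.
  rewrite (polygon_boundary hP); apply/seteqP; split=> x; last by exists i.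
  by move=> [j _]; have [->|->] := two i j; rewrite ?sideS.
have DE i : D = side A l i.
  apply/seteqP; split.
    by apply: convex_boundary_segment => //; [exact: polygon_closed hP|exact: polygon_sub hP|exact: bE].
  by rewrite -(bE i); exact: boundary_sub hP.
have dE i j : dist l (A i) (A (ordS i)) = dist l (A j) (A (ordS j)).
  by have [->|->] := two i j; rewrite ?SS // distC.
pose i0 := cyc n0 0.
have rE : r = dist l (A i0) (A (ordS i0)) / 2.
  have [[z hz hD] hmin] := hr; apply/eqP; rewrite eq_le; apply/andP; split.
    have [m hm hsub] := segment_midpoint (vis i0) (na i0).
    by apply: hmin; exists m; rewrite // (DE i0).
  by apply: covering_radius_ge hD => //; try exact: (polygon_vertices hP); exact: (vertex_in hP).
have [t0 c0 _] := half_dist_gt0 (vis i0).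
split; [by rewrite rE | by rewrite /ta_ rE; exact: (divr_gt0 t0 c0) | exact: DE |].
move=> i; rewrite rE; rewrite /vertex_curvature /side_length !pS SS.
have -> : interior_angle A l i = 0.
  have := angle_at_refl (vis i); rewrite angle_at.unlock => h.
  by rewrite /interior_angle pS.
rewrite [dist l (A (ordS i)) _]distC !(dE i i0) subr0; congr (_ / _).
by rewrite mulr2n mulrDl mul1r.
Qed.

(** * The bound on the circumradius *)

Theorem theorem2 (R : realType) (lambda kappa0 : R) (n : nat)
    (A : 'I_n -> 'rV[R]_3) (P : set 'rV[R]_3) (r : R) :
  kappa_convex A lambda kappa0 P ->
  (0 < lambda -> forall i, side_length A lambda i < pi / Num.sqrt lambda) ->
  Num.max 0 (- lambda) < kappa0 ->
  is_circumradius lambda P r ->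
  [/\ c_ lambda r != 0,
      ta_ lambda r <= pi / (2 * kappa0) &
      ta_ lambda r = pi / (2 * kappa0) <->
        two_covered_segment A lambda P /\
        forall i, vertex_curvature A lambda i = kappa0].
Proof.
move=> [hP k0 hk] hs _ hr; have p0 := @pi_gt0 R.
have := polygon_size hP; rewrite leq_eqVlt => /orP[/eqP/esym n2|n2].
  have [c0 t0 hD hcurv] := two_vertices hP hs hr n2.
  have i : 'I_n by rewrite n2; exact: ord0.
  have eqv : pi / (2 * ta_ lambda r) = kappa0 <-> ta_ lambda r = pi / (2 * kappa0).
    move: (ta_ _ _) t0 => t t0; have kN := lt0r_neq0 k0; have tN := lt0r_neq0 t0.
    have pN := lt0r_neq0 p0.
    have E (a b : R) : a != 0 -> b != 0 -> pi / (2 * a) = b -> a = pi / (2 * b).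
      by move=> a0 b0 <-; move: (pi : R) pN => p' pN; field; rewrite a0 pN.
    by split=> h; [apply: E | symmetry; apply: E].
  split; first by rewrite gt_eqF.
    have := hk i; rewrite hcurv; move: (ta_ _ _) t0 => t t0.
    by rewrite ler_pdivlMr ?mulr_gt0 // ler_pdivlMr ?mulr_gt0 //; lra.
  split=> [h|[_ h]]; last by rewrite -eqv -(hcurv i).
  by split=> [|j]; [split | rewrite hcurv; apply/eqv].
have [s0 c0 hK] := polygon_curvature_bound hP hs hr k0 hk n2.
have c1 : 0 < c_ lambda r.
  rewrite lt_neqAle c0 andbT; apply/eqP => e.
  by move: hK; rewrite -e mul0r ltNge divr_ge0 ?pi_ge0 // mulr_ge0 // ltW.
have hlt : ta_ lambda r < pi / (2 * kappa0).
  move: hK; rewrite /ta_ ltr_pdivlMr // ltr_pdivrMr // => h.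
  move: h; move: (s_ _ _) (c_ _ _) s0 c1 => s c s0 c1.
  rewrite mulrAC ltr_pdivrMr // => h.
  by rewrite mulrAC ltr_pdivlMr ?mulr_gt0 //; lra.
split; [by rewrite gt_eqF | exact: ltW |].
split=> [h|[[e _] _]]; first by rewrite h ltxx in hlt.
by rewrite e in n2.
Qed.
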